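(* Let $\Delta$ be a $1$-dimensional flag simplicial complex on $[n]$, and let $p$ be an integer with $2\le p\le\nu(\overline\Delta)$. Suppose that: (1) $\Delta$ does not contain an induced subgraph isomorphic to $K_{2+i,\,2p-i}$ for any even integer $i$ with $0\le i\le p$; (2) $\Delta$ contains an induced subgraph isomorphic to the crown graph $Cr(2p+1)$. Then $$\beta_{2p+1,\,4p+2}(I_\Delta^{[p]})=p\,\bigl|\bigl\{\text{induced subgraphs of }\Delta\text{ isomorphic to }Cr(2p+1)\bigr\}\bigr|.$$
   Context: A $1$-dimensional flag simplicial complex $\Delta$ on $[n]=\{1,\dots,n\}$ is a $1$-dimensional simplicial complex whose Stanley--Reisner ideal $I_\Delta$ is generated in degree two; equivalently, a triangle-free graph on the vertex set $[n]$ (with at least one edge, isolated vertices allowed). $\overline{\Delta}$ denotes the complement graph on $[n]$, so $I_\Delta=(x_ix_j:\{i,j\}\in E(\overline\Delta))$ is the edge ideal of $\overline\Delta$ in $S=K[x_1,\dots,x_n]$, where $K$ is an arbitrary field. $\nu(\overline\Delta)$ is the largest size of a matching (set of pairwise disjoint edges) of $\overline\Delta$. The squarefree power $I_\Delta^{[p]}$ is generated by the squarefree monomials among the minimal generators of $I_\Delta^p$, i.e. by the products of the variables indexed by the $2p$ vertices of the $p$-matchings of $\overline\Delta$. Graded Betti numbers $\beta_{i,j}(I)$ are those of the minimal graded free $S$-resolution of the ideal $I$ (so $\beta_{0,j}$ counts minimal generators). $K_{a,b}$ is the complete bipartite graph with parts of sizes $a,b$. The crown graph $Cr(m)$ has vertex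 set $\{u_1,\dots,u_m\}\sqcup\{v_1,\dots,v_m\}$ and edges $\{u_i,v_j\}$ for $i\ne j$. The number of induced subgraphs isomorphic to $H$ is the number of vertex subsets $W\subseteq[n]$ whose induced subgraph $\Delta_W$ is isomorphic to $H$. *)

(* Defs.v *)
From HB Require Import structures.
From mathcomp Require Import all_boot all_order all_algebra.
From mathcomp Require Import mpoly.
From Stdlib Require Import ClassicalEpsilon.
Set Implicit Arguments.
Unset Strict Implicit.
Unset Printing Implicit Defensive.
Import GRing.Theory.
Local Open Scope ring_scope.

Section Complexes.
Variable n : nat.
Implicit Types (D : {set {set 'I_n}}) (M : {set {set 'I_n}}).

(* Every i : 'I_n is required to be a vertex. *)
Definition simplicial_complex D : Prop :=
  [/\ set0 \in D,
      forall i : 'I_n, [set i] \in D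
    & forall F G : {set 'I_n}, F \in D -> G \subset F -> G \in D].

(* The dimension of a face F is #|F| - 1. *)
Definition complex_dim D : int := (\max_(F in D) #|F|)%:Z - 1.

Definition adj D : rel 'I_n := [rel i j | (i != j) && ([set i; j] \in D)].

Definition compl_edges D : {set {set 'I_n}} :=
  [set E : {set 'I_n} | (#|E| == 2) && (E \notin D)].

Definition matching (E : {set {set 'I_n}}) M : bool :=
  (M \subset E) && trivIset M.

Definition matching_number (E : {set {set 'I_n}}) : nat :=
  \max_(M : {set {set 'I_n}} | matching E M) #|M|.

(* The subgraph of the 1-skeleton of D induced on W is isomorphic to (T, H). *)
Definition induced_iso (T : finType) (H : rel T) D (W : {set 'I_n}) : bool :=
  [exists f : {ffun T -> 'I_n},
    [&& injectiveb f, [set f x | x : T] == W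
      & [forall x, forall y, H x y == adj D (f x) (f y)]]].

End Complexes.

Definition complete_bipartite (a b : nat) : rel ('I_a + 'I_b)%type :=
  fun x y => match x, y with
             | inl _, inr _ | inr _, inl _ => true
             | _, _ => false
             end.

Definition crown (m : nat) : rel ('I_m + 'I_m)%type :=
  fun x y => match x, y with
             | inl i, inr j | inr i, inl j => i != j
             | _, _ => false
             end.

Section Ideals.
Variables (K : fieldType) (n : nat).
Notation S := {mpoly K[n]}.
Implicit Types (I G : S -> Prop) (m : 'X_{1..n}).

Definition ideal_gen G : S -> Prop := fun f =>
  exists s : seq (S * S),
    (forall q, q \in s -> G q.2) /\ f = \sum_(q <- s) q.1 * q.2.

Definition generated_in_degree (d : nat) I : Prop :=
  exists2 G : S -> Prop, (forall g, G g -> g \is d.-homog)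
                       & (forall f, I f <-> ideal_gen G f).

Definition stanley_reisner (D : {set {set 'I_n}}) : S -> Prop :=
  ideal_gen (fun f => exists2 F : {set 'I_n},
                        F \notin D & f = \prod_(i in F) 'X_i).

Definition ideal_pow I (p : nat) : S -> Prop :=
  ideal_gen (fun f => exists2 g : 'I_p -> S,
                        (forall i, I (g i)) & f = \prod_(i < p) g i).

(* Minimal generators are taken in the sense of monomial ideals: monomials of I
   that are minimal for divisibility. *)
Definition min_monomial_gen I m : Prop :=
  I 'X_[m] /\ forall m', I 'X_[m'] -> (m' <= m)%MM -> m' = m.

Definition squarefree m : Prop := forall i : 'I_n, (m i <= 1)%N.

Definition squarefree_power I (p : nat) : S -> Prop :=
  ideal_gen (fun f => exists m,
    [/\ min_monomial_gen (ideal_pow I p) m, squarefree m & f = 'X_[m]]).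

(* F_i is the direct sum of the S(-d), d ranging over the sequence shifts i;
   its elements are row vectors and maps act by right multiplication, aug being
   F_0 -> S and diff i being F_(i+1) -> F_i. Natural number shifts suffice for
   minimal resolutions of ideals of S, which live in degrees >= 0. *)
Record free_complex := FreeComplex {
  shifts : nat -> seq nat;
  aug : 'cV[S]_(size (shifts 0));
  diff : forall i, 'M[S]_(size (shifts i.+1), size (shifts i)) }.

(* The maps have degree 0: an entry from S(-a) to S(-b) is homogeneous of
   degree a - b, and vanishes if a < b. *)
Definition graded_complex (F : free_complex) : Prop :=
  (forall (a : 'I_(size (shifts F 0))) m,
     m \in msupp (aug F a 0) -> mdeg m = nth 0%N (shifts F 0) a) /\
  (forall i (a : 'I_(size (shifts F i.+1))) (b : 'I_(size (shifts F i))) m,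
     m \in msupp (diff F i a b) ->
     (mdeg m + nth 0 (shifts F i) b)%N = nth 0%N (shifts F i.+1) a).

(* ... -> F_1 -> F_0 -> I -> 0 is exact. *)
Definition resolves (F : free_complex) I : Prop :=
  [/\ forall f, I f <-> exists v : 'rV[S]_(size (shifts F 0)),
                          f = (v *m aug F) 0 0,
      forall v : 'rV[S]_(size (shifts F 0)),
        v *m aug F = 0 <-> exists w, v = w *m diff F 0
    & forall i (v : 'rV[S]_(size (shifts F i.+1))),
        v *m diff F i = 0 <-> exists w, v = w *m diff F i.+1].

(* d(F_(i+1)) is contained in (x_1, ..., x_n) F_i. *)
Definition minimal_complex (F : free_complex) : Prop :=
  forall i a b, (diff F i a b)@_0%MM = 0.

Definition minimal_graded_free_resolution (F : free_complex) I : Prop :=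
  [/\ graded_complex F, resolves F I & minimal_complex F].

(* Minimal graded free resolutions of a graded ideal exist and have the same
   shifts up to order, so the property below determines a unique number. *)
Definition graded_betti I (i j : nat) : nat :=
  epsilon (inhabits 0%N) (fun b => exists2 F,
    minimal_graded_free_resolution F I & b = count_mem j (shifts F i)).

End Ideals.

Arguments stanley_reisner K {n} D _.

Definition flag (K : fieldType) (n : nat) (D : {set {set 'I_n}}) : Prop :=
  generated_in_degree 2 (stanley_reisner K D).

(* Main.v *)
(* Koszul homology of the squarefree power I^[p] computes its Betti numbers: a
   minimal resolution F of I is cut into short exact sequences 0 -> Z' -> F_k -> Z -> 0,
   whose connecting maps identify H_i(I) with H_0 of the i-th syzygy module. In a
   multidegree with an exponent >= 2 the homology of a squarefree monomial ideal
   vanishes, which bounds the degrees of syzygies (whence a resolution exists) and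
   reduces the computation to the vertex sets W with 4p + 2 elements.
   As Delta is triangle-free, a set F of vertices supports a p-matching of the
   complement as soon as #|F| > 2p, and for #|F| = 2p exactly unless Delta induces on F
   a complete bipartite graph with two odd parts. So H_(2p+1)(I^[p])_W is dual to the
   space of functions z on these sets F in W that satisfy one signed relation for every
   (2p-1)-set T, and z(F) <> 0 forces, for every x in F, some y with
   z(F - x + y) <> 0. These exchanges, together with the absence of complete
   bipartite graphs with even parts on 2p + 2 vertices, exhibit 4p + 2 vertices that
   induce a crown, which is then W. On a crown the odd sizes 1, 3, ..., 2p - 1 of the
   left part of F split the functions z into p independent pieces; the exchanges connect
   each piece and force it to have dimension at most 1, and an explicit sign gives a
   nonzero element. *)
From HB Require Import structures.
Require Import Defs.
From mathcomp Require Import all_boot all_order all_algebra.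
From mathcomp Require Import mpoly ring zify.
From Stdlib Require Import ClassicalEpsilon.
Set Implicit Arguments.
Unset Strict Implicit.
Unset Printing Implicit Defensive.
Import GRing.Theory.
Local Open Scope ring_scope.

(** * Koszul complexes in a fixed multidegree *)

(** [graded_betti] is an epsilon over all minimal resolutions, so it takes an invariant, the
    dimension of Koszul homology, and a resolution built by hand. Finite generation comes not from
    noetherianity but from the vanishing of Koszul homology in degrees above [n], a bound that
    passes unchanged to every syzygy module. In multidegree W a cycle of I^[p] in exterior degree 2p
    + 1 bounds a chain b of the free Koszul complex. The exterior parts s of b have 2p + 2 elements
    and their complements in W have (4p + 2) - (2p + 2) = 2p; the boundary involves complements with
    2p + 1 vertices, which always lie in I^[p]. So the only obstruction sits at those s whose
    complement is unmatchable, modulo boundaries of chains on (2p + 3)-sets, the complements of the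
    sets T. The hypothesis on even parts enters through one fact: a vertex outside F joined to all
    of one part and a vertex outside F joined to all of the other are not adjacent, for otherwise
    they would enlarge the odd parts to even ones. Such nonadjacent pairs form the missing perfect
    matching of the crown. *)

Section Signs.
Variables (n : nat) (R : comNzRingType).
Implicit Types (u v w : 'I_n) (s t : {set 'I_n}).

(** The sign of the position of [v] in [v |: s]: one factor -1 for each element of [s] below [v]. *)
Definition ksign v s : R := \prod_(u in s) (-1) ^+ (u < v)%N.

Lemma ksignU1 v w s : w \notin s -> ksign v (w |: s) = (-1) ^+ (w < v)%N * ksign v s.
Proof. by move=> ws; rewrite /ksign big_setU1. Qed.

Lemma sign_ltC v w : v != w -> (-1) ^+ (v < w)%N = - (-1) ^+ (w < v)%N :> R.
Proof.
move=> vw; have: (v != w :> nat) by [].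
by case: ltngtP => // _ _; rewrite ?expr0 ?expr1 ?opprK.
Qed.

Lemma ksign_sqr v s : ksign v s * ksign v s = 1.
Proof.
rewrite /ksign -big_split /= big1 // => u _; by rewrite -expr2 sqrr_sign.
Qed.

Lemma ksign_swap v w s : v != w -> v \notin s -> w \notin s ->
  ksign v s * ksign w (v |: s) = - (ksign w s * ksign v (w |: s)).
Proof.
move=> vw vs ws; rewrite !ksignU1 // sign_ltC // mulNr mulrN.
by congr (- _); rewrite mulrCA [RHS]mulrCA; congr (_ * _); rewrite mulrC.
Qed.

(** The boundary of a simplex on coefficient functions: the basis element of [v |: s] maps to its
    facet [s], so the coefficient at [s] is a sum over the added [v]. *)
Definition sdiff (a : {set 'I_n} -> R) s : R :=
  \sum_(v | v \notin s) ksign v s * a (v |: s).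

Definition cone w (a : {set 'I_n} -> R) s : R :=
  if w \in s then ksign w (s :\ w) * a (s :\ w) else 0.

(** Coning off with [w] is a contracting homotopy: the term [v = w] returns [a s], and the others
    cancel by anticommutation. *)
Lemma cone_sdiff w a s : sdiff (cone w a) s + cone w (sdiff a) s = a s.
Proof.
rewrite {2}/cone; case: ifP => ws; last first.
  rewrite addr0 /sdiff (bigD1 w) ?ws //= big1 => [|v /andP[vs vw]].
    by rewrite /cone setU11 setU1K ?ws // addr0 mulrA ksign_sqr mul1r.
  by rewrite /cone in_setU1 ws (negPf (_ : w != v)) ?mulr0 // eq_sym.
have [t wt ->] : exists2 t : {set 'I_n}, w \notin t & s = w |: t.
  by exists (s :\ w); rewrite ?setD11 // setD1K.
rewrite setU1K // /sdiff [X in _ + _ * X](bigD1 w) //= mulrDr !mulrA ksign_sqr mul1r.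
rewrite addrCA mulr_sumr (eq_bigl (fun v => (v \notin t) && (v != w))); last first.
  by move=> v /=; rewrite !inE negb_or andbC.
rewrite -big_split /= big1 ?addr0 // => v /andP[vt vw].
rewrite /cone !inE eqxx orbT /=.
have -> : (v |: (w |: t)) :\ w = v |: t.
  by rewrite setUCA setU1K // !inE negb_or eq_sym vw.
rewrite !ksignU1 // (sign_ltC vw).
have := sqrr_sign R (w < v)%N; rewrite expr2; move: ((-1) ^+ _) => e ee.
by transitivity ((1 - e * e) * (ksign v t * ksign w t * a (v |: t))); [ring | rewrite ee subrr mul0r].
Qed.

End Signs.

Section Multidegree.
Variables (n : nat) (K : fieldType).
Notation S := {mpoly K[n]}.
Implicit Types (u v w : 'I_n) (s t : {set 'I_n}) (m mu : 'X_{1..n}).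
Implicit Types (c : {set 'I_n} -> S).

Definition chi s : 'X_{1..n} := [multinom (i \in s : nat) | i < n].

Lemma chiE s i : chi s i = (i \in s) :> nat. Proof. exact: mnmE. Qed.

Lemma chiU1 v s : v \notin s -> chi (v |: s) = (U_(v) + chi s)%MM.
Proof.
move=> vs; apply/mnmP => i; rewrite mnmDE !chiE mnm1E !inE [i == v]eq_sym.
by case: eqP => // <-; rewrite (negPf vs).
Qed.

Lemma mdeg_chi s : mdeg (chi s) = #|s|.
Proof.
by rewrite mdegE -sum1_card [RHS]big_mkcond; apply: eq_bigr => i _; rewrite chiE; case: (i \in s).
Qed.

Lemma chi_inj : injective chi.
Proof.
move=> s t /mnmP E; apply/setP => i; move: (E i); rewrite !chiE.
by case: (i \in s); case: (i \in t).
Qed.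

Lemma msuppD_sum (I : eqType) (r : seq I) (P : pred I) (F : I -> S) m :
  m \in msupp (\sum_(i <- r | P i) F i) -> exists2 i, P i & m \in msupp (F i).
Proof.
move=> h; have /hasP : has (fun i => P i && (m \in msupp (F i))) r.
  apply: contraTT h => /hasPn h; rewrite -mcoeff_eq0 raddf_sum /=.
  rewrite big_seq_cond big1 // => i /andP[/h]; rewrite negb_and => /orP[/negP//|].
  by rewrite -mcoeff_eq0 => /eqP.
by case=> i _ /andP[]; exists i.
Qed.

Lemma mcoeff_filter (P : pred 'X_{1..n}) (p : S) m :
  (\sum_(k <- msupp p | P k) p@_k *: 'X_[k])@_m = if P m then p@_m else 0.
Proof.
rewrite raddf_sum /=; case: ifP => Pm; last first.
  rewrite big1 // => k Pk; rewrite mcoeffZ mcoeffX; case: eqP => [E|]; rewrite ?mulr0 //.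
  by rewrite -E Pk in Pm.
have [h|h] := boolP (m \in msupp p).
  rewrite -big_filter (bigD1_seq m) ?filter_uniq ?msupp_uniq ?mem_filter ?h ?Pm //=.
  rewrite mcoeffZ mcoeffX eqxx mulr1 big1 ?addr0 // => k ne.
  by rewrite mcoeffZ mcoeffX (negPf ne) mulr0.
rewrite (memN_msupp_eq0 h) big_seq_cond big1 // => k /andP[h' _].
by rewrite mcoeffZ mcoeffX; case: eqP => [E|]; rewrite ?mulr0 //; rewrite -E h' in h.
Qed.

Lemma msuppMP (p q : S) m : m \in msupp (p * q) ->
  exists m1 m2, [/\ m1 \in msupp p, m2 \in msupp q & m = (m1 + m2)%MM].
Proof. by move/msuppM_le/allpairsP => [[m1 m2] /= [h1 h2 ->]]; exists m1, m2. Qed.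

Definition kdiff1 c s : S := \sum_(v | v \notin s) (ksign S v s * 'X_v) * c (v |: s).

(** In multidegree [m] only the monomial x^(m - chi s) can accompany the exterior part [s], so the
    strand of a chain in this multidegree is a scalar function of [s]. *)
Definition comp m c s : K := if (chi s <= m)%MM then (c s)@_(m - chi s) else 0.

Lemma compE mu c s : comp (mu + chi s) c s = (c s)@_mu.
Proof. by rewrite /comp lem_addl addmK. Qed.

Lemma ksignC v s : ksign S v s = (ksign K v s)%:MP.
Proof.
rewrite /ksign rmorph_prod; apply: eq_bigr => u _; by rewrite rmorph_sign.
Qed.

Lemma mcoeff_XM (p : S) v m : ('X_v * p)@_m = if m v == 0%N then 0 else p@_(m - U_(v)).
Proof.
case: ifP => [mv|/negbT mv].
  apply/eqP; rewrite mcoeff_eq0; apply/negP => /msuppMP [m1 [m2 [h1 _ E]]].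
  move: mv; rewrite E mnmDE; move/mem_msuppXP: h1 => <-.
  by rewrite mnm1E eqxx.
have /submK {1}<- : (U_(v) <= m)%MM by rewrite lep1mP.
by rewrite mulrC addmC mcoeffMX.
Qed.

Lemma comp_kdiff m c s : comp m (kdiff1 c) s = sdiff (comp m c) s.
Proof.
rewrite /comp /sdiff; case: ifP => [sm|/negbT sm]; last first.
  rewrite big1 // => v vs; rewrite ifF ?mulr0 //; apply: contraNF sm.
  by apply: lepm_trans; rewrite chiU1 // lem_addl.
rewrite /kdiff1 raddf_sum; apply: eq_bigr => v vs.
rewrite ksignC -mulrA /= mcoeffCM; congr (_ * _).
rewrite mcoeff_XM chiU1 // submDA addmC -submDA.
have -> : (U_(v) + chi s <= m)%MM = ((m - chi s)%MM v != 0%N).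
  rewrite mnmBE; apply/mnm_lepP/idP => [/(_ v)|h i].
    by rewrite mnmDE mnm1E eqxx; lia.
  move/mnm_lepP: sm => /(_ i); rewrite mnmDE mnm1E.
  by case: eqP => [<-|_] //; move: h; lia.
by case: eqP; rewrite // addmC submDA.
Qed.

(* In multidegree m the Koszul complex is the chain complex of a simplex on the
   support of m, contracted by the cone over any vertex v of that support. *)
Lemma koszul_exact c (P : 'X_{1..n} -> 'I_n -> bool) :
  (forall s, kdiff1 c s = 0) ->
  (forall s mu, mu \in msupp (c s) -> exists v, P (mu + chi s)%MM v) ->
  (forall m v, P m v -> m v != 0%N) ->
  exists2 b : {set 'I_n} -> S, (forall s, kdiff1 b s = c s)
  & forall s mu, mu \in msupp (b s) ->
      exists v, [/\ P (mu + chi s)%MM v, v \in s & (mu + U_(v))%MM \in msupp (c (s :\ v))].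
Proof.
move=> cyc hP Ppos.
(* Only finitely many multidegrees carry a nonzero component of [c]; [N] bounds their degrees, so
   that [b] is a finite sum. *)
pose N := (\max_s \max_(mu <- msupp (c s)) (mdeg (mu + chi s)).+1)%N.
(* The cone vertex is picked from [m] alone, so that one homotopy serves the whole strand. An
   abstract [P] covers both uses: exponents at least 1 for free modules, at least 2 for monomial
   ideals. *)
pose a m s : K := if [pick v | P m v] is Some v then cone v (comp m c) s else 0.
pose b s : S := \sum_(m : 'X_{1..n < N} | (chi s <= m)%MM) a m s *: 'X_[m - chi s].
have N_gt m s : comp m c s != 0 -> (mdeg m < N)%N.
  rewrite /comp; case: ifP; rewrite ?eqxx // => sm; rewrite -mcoeff_msupp => h.
  rewrite /N; apply: leq_trans (leq_bigmax s).
  by rewrite -{1}(submK sm) (@leq_bigmax_seq _ _ xpredT (fun mu => (mdeg (mu + chi s)).+1)).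
have a_neq0 m s : a m s != 0 ->
  exists v, [/\ P m v, v \in s & comp m c (s :\ v) != 0].
  rewrite /a; case: pickP => [v Pv|_]; rewrite ?eqxx // /cone.
  case: ifP => [vs h|]; rewrite ?eqxx //; exists v; split => //.
  by apply: contraNneq h => ->; rewrite mulr0.
have a_le m s : a m s != 0 -> (chi s <= m)%MM.
  move=> /a_neq0 [v [Pv vs]]; rewrite /comp; case: ifP; rewrite ?eqxx // => h _.
  rewrite -(setD1K vs) chiU1 ?setD11 //; apply/mnm_lepP => i.
  move/mnm_lepP: h => /(_ i); rewrite mnmDE mnm1E chiE !inE.
  by have := Ppos _ _ Pv; case: (v =P i) => [<-|]; rewrite ?eqxx //=; lia.
have compb m s : comp m b s = a m s.
  rewrite /comp; case: ifP => [sm|/negbT sm]; last first.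
    by apply/esym/eqP; apply: contraNT sm; apply: a_le.
  rewrite /b raddf_sum /=.
  have [mN|mN] := ltnP (mdeg m) N.
    rewrite (bigD1 (BMultinom mN)) //= mcoeffZ mcoeffX eqxx mulr1 big1 ?addr0 //.
    move=> m' /andP[sm' ne]; rewrite mcoeffZ mcoeffX.
    case: eqP => [E|]; rewrite ?mulr0 //; case/eqP: ne; apply/eqP; rewrite bmeqP /=.
    by rewrite -(submK sm) -(submK sm') E.
  rewrite big1 => [|m' sm'].
    apply/esym/eqP; apply: contraTT mN => /a_neq0 [v [_ _ /N_gt]].
    by rewrite -ltnNge.
  rewrite mcoeffZ mcoeffX; case: eqP => [E|]; rewrite ?mulr0 //.
  by have := bmdeg m'; rewrite -(submK sm') E submK // ltnNge mN.
have mem_supp c' s mu : (mu \in msupp (c' s)) = (comp (mu + chi s) c' s != 0).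
  by rewrite compE mcoeff_msupp.
exists b => [s|s mu]; last first.
  rewrite mem_supp compb => /a_neq0 [v [Pv vs h]]; exists v; split => //.
  by rewrite mem_supp; rewrite -{1}(setD1K vs) chiU1 ?setD11 // addmA in h.
apply/mpolyP => mu; rewrite -!compE comp_kdiff.
rewrite /sdiff (eq_bigr (fun v => ksign K v s * a (mu + chi s)%MM (v |: s))); last first.
  by move=> v vs; rewrite compb.
set m := (mu + chi s)%MM.
have [|] := pickP (P m) => [v Pv | noP]; last first.
  rewrite big1 => [|v vs]; last by rewrite /a; case: pickP => [v' | _]; rewrite ?noP ?mulr0.
  apply/esym/eqP; rewrite compE mcoeff_eq0; apply/negP => /hP [v].
  by rewrite -/m noP.
(* The default of [odflt] is never taken, as [P m v] holds; the second cone term vanishes because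
   [c] is a cycle. *)
rewrite -[RHS](cone_sdiff (odflt v [pick v | P m v])) [X in _ = _ + X](_ : _ = 0); last first.
  rewrite /cone; case: ifP => // _; rewrite -comp_kdiff /comp cyc; by case: ifP; rewrite ?mcoeff0 mulr0.
rewrite addr0; apply: eq_bigr => u us; congr (_ * _).
by rewrite /a; case: pickP => // /(_ v); rewrite Pv.
Qed.

End Multidegree.

(** * Subquotients with a finite basis *)

Section QuotientDimension.
Variables (n : nat) (K : fieldType).
Notation S := {mpoly K[n]}.

(* The subquotient P / Q, as a K-space, has a basis indexed by T; K acts through
   the constants of S. *)
Definition qdim (T : finType) (V : lmodType S) (P Q : V -> Prop) : Prop :=
  exists e : T -> V,
  [/\ forall t, P (e t),
      forall x, P x -> exists a : T -> K, Q (x - \sum_t (a t)%:MP *: e t)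
    & forall a : T -> K, Q (\sum_t (a t)%:MP *: e t) -> forall t, a t = 0].

Definition klinear (V : lmodType S) (P : V -> Prop) : Prop :=
  P 0 /\ forall (a : K) x y, P x -> P y -> P (a%:MP *: x + y).

Lemma klinear_sum (V : lmodType S) (P : V -> Prop) (I : Type) (r : seq I)
    (a : I -> K) (e : I -> V) :
  klinear P -> (forall t, P (e t)) -> P (\sum_(t <- r) (a t)%:MP *: e t).
Proof.
move=> [P0 PD] Pe; elim: r => [|i r IH]; rewrite ?big_nil // big_cons.
by apply: PD.
Qed.

Lemma klinearB (V : lmodType S) (P : V -> Prop) x y :
  klinear P -> P x -> P y -> P (x - y).
Proof.
move=> [P0 PD] Px Py; rewrite addrC -scaleN1r -[-1](rmorphN1 (mpolyC n (R := K))).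
exact: PD.
Qed.

(** A relation [R] replaces an isomorphism: a connecting map is multivalued on chains and well
    defined only on homology, so one checks totality in both directions and agreement of
    boundaries. *)
Lemma qdim_transport (T : finType) (V V' : lmodType S) (P Q : V -> Prop)
    (P' Q' : V' -> Prop) (R : V -> V' -> Prop) :
  klinear P -> klinear P' ->
  R 0 0 -> (forall a x x' y y', R x x' -> R y y' -> R (a%:MP *: x + y) (a%:MP *: x' + y')) ->
  (forall x, P x -> exists2 x', P' x' & R x x') ->
  (forall x', P' x' -> exists2 x, P x & R x x') ->
  (forall x x', P x -> P' x' -> R x x' -> (Q x <-> Q' x')) ->
  qdim T P' Q' -> qdim T P Q.
Proof.
move=> linP linP' R0 RD totP totP' QQ' [e [Pe span free]].
have [f Pf] : exists f : T -> V, forall t, P (f t) /\ R (f t) (e t).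
  apply: (@fin_all_exists T (fun=> V) (fun t x => P x /\ R x (e t))) => t.
  by have [x] := totP' _ (Pe t); exists x.
have Rsum (a : T -> K) : R (\sum_t (a t)%:MP *: f t) (\sum_t (a t)%:MP *: e t).
  elim: (index_enum T) => [|i r IH]; rewrite ?big_nil // !big_cons.
  by apply: RD => //; case: (Pf i).
exists f; split=> [t|x Px|a Qa]; first by case: (Pf t).
- have [x' Px' xx'] := totP _ Px; have [a Qa] := span _ Px'; exists a.
  apply: (proj2 (QQ' _ (x' - \sum_t (a t)%:MP *: e t) _ _ _)) => //.
  + by apply: klinearB => //; apply: klinear_sum => // t; case: (Pf t).
  + by apply: klinearB => //; apply: klinear_sum.
  + rewrite -[- \sum_t _ *: f t]scaleN1r -[- \sum_t _ *: e t]scaleN1r.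
    rewrite -[-1](rmorphN1 (mpolyC n (R := K))).
    by rewrite addrC [x' + _]addrC; apply: RD.
- by apply: free; apply: (proj1 (QQ' _ _ _ _ (Rsum a))) => //; apply: klinear_sum => // t; case: (Pf t).
Qed.

(** Steinitz modulo [Q]: if [T] were larger, the matrix expressing [e] through [e'] would have a
    nonzero left kernel vector, a dependence of [e] modulo [Q]. *)
Lemma qdim_le (T T' : finType) (V : lmodType S) (P Q : V -> Prop) :
  klinear Q -> qdim T P Q -> qdim T' P Q -> (#|T| <= #|T'|)%N.
Proof.
move=> linQ [e [Pe _ free]] [e' [_ span _]].
have [M HM] : exists M : T -> T' -> K,
    forall t, Q (e t - \sum_t' (M t t')%:MP *: e' t').
  apply: (@fin_all_exists T (fun=> T' -> K)
    (fun t a => Q (e t - \sum_t' (a t')%:MP *: e' t'))) => t; exact: span.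
pose A : 'M[K]_(#|T|, #|T'|) := \matrix_(i, j) M (enum_val i) (enum_val j).
rewrite leqNgt; apply/negP => lt.
have /row_subPn[i ki] : ~~ (kermx A <= (0 : 'M_#|T|))%MS.
  rewrite submx0 -mxrank_eq0 mxrank_ker -lt0n subn_gt0.
  by apply: leq_ltn_trans lt; apply: rank_leq_col.
set r := row i _ in ki; have rA : r *m A = 0.
  by apply/sub_kermxP/row_sub.
pose a t := r 0 (enum_rank t).
have /free a0 : Q (\sum_t (a t)%:MP *: e t).
  have -> : \sum_t (a t)%:MP *: e t =
    \sum_t (a t)%:MP *: (e t - \sum_t' (M t t')%:MP *: e' t').
    apply/esym; under eq_bigr do rewrite scalerBr.
    rewrite big_split /= sumrN; apply/eqP; rewrite subr_eq addrC -subr_eq subrr eq_sym.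
    under eq_bigr do rewrite scaler_sumr.
    rewrite exchange_big big1 //= => t' _.
    under eq_bigr do rewrite scalerA -rmorphM.
    rewrite -scaler_suml -rmorph_sum /=.
    have -> : \sum_t a t * M t t' = (r *m A) 0 (enum_rank t').
      rewrite mxE (reindex _ (onW_bij _ (@enum_rank_bij T))) /=; apply: eq_bigr => t _.
      by rewrite [A _ _]mxE !enum_rankK.
    by rewrite rA mxE rmorph0 scale0r.
  exact: klinear_sum.
case/negP: ki; rewrite submx0; apply/eqP/rowP => k; rewrite [RHS]mxE.
by rewrite -(a0 (enum_val k)) /a enum_valK.
Qed.

Lemma qdim_unique (T T' : finType) (V : lmodType S) (P Q : V -> Prop) :
  klinear Q -> qdim T P Q -> qdim T' P Q -> #|T| = #|T'|.
Proof. by move=> lQ h h'; apply/eqP; rewrite eqn_leq (qdim_le lQ h h') (qdim_le lQ h' h). Qed.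

End QuotientDimension.

(** * Koszul homology of graded submodules of free modules *)

Section GradedVectors.
Variables (n : nat) (K : fieldType).
Notation S := {mpoly K[n]}.
Implicit Types (s t : seq nat) (D : pred nat).

(* v is an element of the direct sum of the S(-d), d in s, so degrees are shifted. *)
Definition degs_in s D (v : 'rV[S]_(size s)) : Prop :=
  forall b m, m \in msupp (v 0 b) -> D (mdeg m + nth 0 s b)%N.

Lemma degs_in0 s D : degs_in D (0 : 'rV[S]_(size s)).
Proof. by move=> b m; rewrite mxE msupp0. Qed.

Lemma degs_inD s D (u v : 'rV[S]_(size s)) :
  degs_in D u -> degs_in D v -> degs_in D (u + v).
Proof.
move=> hu hv b m; rewrite mxE => /msuppD_le; rewrite mem_cat.
by case/orP; [apply: hu | apply: hv].
Qed.

Lemma degs_inC s D a (u : 'rV[S]_(size s)) : degs_in D u -> degs_in D (a%:MP *: u).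
Proof. by move=> hu b m; rewrite mxE mul_mpolyC => /msuppZ_le; apply: hu. Qed.

Lemma degs_inB s D (u v : 'rV[S]_(size s)) :
  degs_in D u -> degs_in D v -> degs_in D (u - v).
Proof.
move=> hu hv; apply: degs_inD => // b m; rewrite mxE.
by rewrite (perm_mem (msuppN _)); apply: hv.
Qed.

Lemma degs_in_sum s D (I : Type) (r : seq I) (P : pred I) (F : I -> 'rV[S]_(size s)) :
  (forall i, P i -> degs_in D (F i)) -> degs_in D (\sum_(i <- r | P i) F i).
Proof.
move=> h; apply: (big_ind (@degs_in s D)) => //; first exact: degs_in0.
exact: degs_inD.
Qed.

Lemma degs_inX s D D' (u : 'rV[S]_(size s)) a (v : 'I_n) :
  (forall d, D d -> D' d.+1) -> degs_in D u -> degs_in D' ((a%:MP * 'X_v) *: u).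
Proof.
move=> DD' hu; rewrite -scalerA; apply: degs_inC => b m.
rewrite mxE => /msuppMP [m1 [m2 [/mem_msuppXP <- h ->]]].
by rewrite mdegD mdeg1 -addnA add1n; apply/DD'/hu.
Qed.

Lemma degs_in_disjoint s D (v : 'rV[S]_(size s)) :
  degs_in D v -> degs_in (predC D) v -> v = 0.
Proof.
move=> h h'; apply/rowP => b; apply/mpolyP => m; rewrite mxE mcoeff0.
apply/eqP; rewrite mcoeff_eq0; apply/negP => mi.
by have := h' _ _ mi; rewrite /= (h _ _ mi).
Qed.

Definition degs_proj s D (v : 'rV[S]_(size s)) : 'rV[S]_(size s) :=
  \row_b \sum_(m <- msupp (v 0 b) | D (mdeg m + nth 0 s b)%N) (v 0 b)@_m *: 'X_[m].

Lemma degs_projE s D (v : 'rV[S]_(size s)) b m :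
  (degs_proj D v 0 b)@_m = if D (mdeg m + nth 0 s b)%N then (v 0 b)@_m else 0.
Proof. by rewrite mxE (mcoeff_filter (fun m => D (mdeg m + nth 0 s b)%N)). Qed.

Lemma degs_proj_in s D (v : 'rV[S]_(size s)) : degs_in D (degs_proj D v).
Proof.
move=> b m; rewrite mcoeff_msupp degs_projE; case: ifP => //; by rewrite eqxx.
Qed.

Lemma degs_proj_out s D (v : 'rV[S]_(size s)) : degs_in (predC D) (v - degs_proj D v).
Proof.
move=> b m; rewrite mcoeff_msupp mxE [(- _ : 'M_(_,_)) _ _]mxE mcoeffB degs_projE /=.
by case: ifP => //; rewrite subrr eqxx.
Qed.

Lemma degs_proj_id s D (v : 'rV[S]_(size s)) : degs_in D v -> degs_proj D v = v.
Proof.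
move=> h; apply/rowP => b; apply/mpolyP => m; rewrite degs_projE; case: ifP => // nD.
by apply/esym/memN_msupp_eq0; apply: contraFN nD; apply: h.
Qed.

Lemma degs_proj_msupp s D (v : 'rV[S]_(size s)) b m :
  m \in msupp (degs_proj D v 0 b) -> m \in msupp (v 0 b).
Proof. by rewrite !mcoeff_msupp degs_projE; case: ifP => //; rewrite eqxx. Qed.

Section GradedMap.
Variables (s t : seq nat) (G : 'M[S]_(size t, size s)).
Hypothesis G_graded : forall a b m, m \in msupp (G a b) ->
  (mdeg m + nth 0 s b)%N = nth 0%N t a.

Lemma degs_in_mul D (u : 'rV[S]_(size t)) : degs_in D u -> degs_in D (u *m G).
Proof.
move=> hu b m; rewrite mxE => /msuppD_sum [a _] /msuppMP [m1 [m2 [h1 h2 ->]]].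
by rewrite mdegD -addnA (G_graded h2); apply: hu.
Qed.

(** The difference of the two sides has degrees in [D], and it is also a difference of vectors with
    degrees outside [D]. *)
Lemma degs_proj_mul D (u : 'rV[S]_(size t)) :
  degs_proj D (u *m G) = degs_proj D u *m G.
Proof.
apply/eqP; rewrite -subr_eq0; apply/eqP; apply: (@degs_in_disjoint s D).
  by apply: degs_inB; [apply: degs_proj_in | apply/degs_in_mul/degs_proj_in].
have -> : degs_proj D (u *m G) - degs_proj D u *m G =
   (u - degs_proj D u) *m G - (u *m G - degs_proj D (u *m G)).
  by rewrite mulmxBl opprB [RHS]addrC subrKA.
by apply: degs_inB; [apply/degs_in_mul/degs_proj_out | apply: degs_proj_out].
Qed.

Lemma degs_in_lift D (v : 'rV[S]_(size s)) (w : 'rV[S]_(size t)) :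
  degs_in D v -> v = w *m G -> exists2 u : 'rV[S]_(size t), degs_in D u & v = u *m G.
Proof.
move=> hv E; exists (degs_proj D w); first exact: degs_proj_in.
by rewrite -degs_proj_mul -E degs_proj_id.
Qed.

End GradedMap.

End GradedVectors.

Section KoszulChains.
Variables (n : nat) (K : fieldType).
Notation S := {mpoly K[n]}.
Implicit Types (s t : {set 'I_n}).

Definition kdiff (V : lmodType S) (c : {ffun {set 'I_n} -> V}) : {ffun {set 'I_n} -> V} :=
  [ffun s : {set 'I_n} => \sum_(v | v \notin s) (ksign S v s * 'X_v) *: c (v |: s)].

Lemma kdiff_is_linear (V : lmodType S) : linear (@kdiff V).
Proof.
move=> a c c'; apply/ffunP => s; rewrite !ffunE scaler_sumr -big_split /=.
apply: eq_bigr => v _; rewrite !ffunE scalerDr; congr (_ + _).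
by rewrite !scalerA mulrC.
Qed.
HB.instance Definition _ (V : lmodType S) :=
  GRing.isLinear.Build S {ffun {set 'I_n} -> V} {ffun {set 'I_n} -> V} _ (@kdiff V)
    (@kdiff_is_linear V).

(** The diagonal is assumed to vanish because antisymmetry alone does not give this in
    characteristic 2. *)
Lemma sum_antisym (V : zmodType) (F : 'I_n -> 'I_n -> V) :
  (forall v, F v v = 0) -> (forall v w, F v w = - F w v) ->
  \sum_v \sum_w F v w = 0.
Proof.
move=> F0 FN.
have split v : \sum_w F v w =
      \sum_(w : 'I_n | (v < w)%N) F v w + \sum_(w : 'I_n | (w < v)%N) F v w.
  rewrite (bigID (fun w : 'I_n => (v < w)%N)) /=; congr (_ + _).
  rewrite (bigD1 v) ?ltnn //= F0 add0r; apply: eq_bigl => w.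
  by rewrite -leqNgt ltn_neqAle andbC.
under eq_bigr do rewrite split.
rewrite big_split /= [X in _ + X](exchange_big_dep xpredT) //= -big_split /=.
by apply: big1 => v _; rewrite -big_split big1 //= => w _; rewrite FN addNr.
Qed.

Lemma kdiff_kdiff (V : lmodType S) (c : {ffun {set 'I_n} -> V}) : kdiff (kdiff c) = 0.
Proof.
apply/ffunP => s; rewrite !ffunE.
pose F v w : V := if [&& v != w, v \notin s & w \notin s] then
  (ksign S v s * ksign S w (v |: s) * 'X_v * 'X_w) *: c (w |: (v |: s)) else 0.
rewrite -[RHS](@sum_antisym _ F) => [|v|v w].
- rewrite big_mkcond; apply: eq_bigr => v _; case: ifP => vs; last first.
    by rewrite big1 // => w _; rewrite /F vs andbF.
  rewrite ffunE scaler_sumr big_mkcond; apply: eq_bigr => w _.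
  rewrite /F vs !inE negb_or eq_sym; case: ifP => // _.
  by rewrite scalerA; congr (_ *: _); ring.
- by rewrite /F eqxx.
- rewrite /F [w == v]eq_sym [(w \notin s) && _]andbC; case: ifP => [/and3P[vw vs ws]|]; rewrite ?oppr0 //.
  rewrite ksign_swap // setUCA -scaleNr; congr (_ *: _); ring.
Qed.

Lemma kdiff_mulmx r r' (G : 'M[S]_(r, r')) (c : {ffun {set 'I_n} -> 'rV[S]_r}) :
  kdiff [ffun s => c s *m G] = [ffun s => kdiff c s *m G].
Proof.
apply/ffunP => s; rewrite !ffunE mulmx_suml; apply: eq_bigr => v _.
by rewrite ffunE scalemxAl.
Qed.

Lemma kdiff_entry r (c : {ffun {set 'I_n} -> 'rV[S]_r}) s k :
  kdiff c s 0 k = kdiff1 (fun t => c t 0 k) s.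
Proof. by rewrite ffunE summxE; apply: eq_bigr => v _; rewrite mxE. Qed.

End KoszulChains.

Section KoszulHomology.
Variables (n : nat) (K : fieldType).
Notation S := {mpoly K[n]}.
Notation chain s := {ffun {set 'I_n} -> 'rV[S]_(size s)}.

Definition submod (V : lmodType S) (Z : V -> Prop) : Prop :=
  Z 0 /\ forall a x y, Z x -> Z y -> Z (a *: x + y).

(* Elements of total degree j in homological degree i of the Koszul complex with
   coefficients in the submodule Z of the direct sum of the S(-d), d in s. *)
Definition kchain (s : seq nat) (Z : 'rV[S]_(size s) -> Prop) (i j : nat) (c : chain s) :=
  forall f : {set 'I_n},
    [/\ Z (c f), degs_in (fun d => d + #|f| == j)%N (c f) & #|f| != i -> c f = 0].

Definition kcycle s Z i j (c : chain s) := kchain Z i j c /\ kdiff c = 0.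

Definition kboundary s Z i j (c : chain s) := exists2 b, kchain Z i.+1 j b & c = kdiff b.

Section Closure.
Variables (s : seq nat) (Z : 'rV[S]_(size s) -> Prop).
Hypothesis subZ : submod Z.

Lemma submodZ a x : Z x -> Z (a *: x).
Proof. by move=> Zx; rewrite -[a *: x]addr0; apply: subZ.2 => //; apply: subZ.1. Qed.

Lemma submodD x y : Z x -> Z y -> Z (x + y).
Proof. by move=> Zx Zy; rewrite -[x]scale1r; apply: subZ.2. Qed.

Lemma submodB x y : Z x -> Z y -> Z (x - y).
Proof. by move=> Zx Zy; rewrite addrC -scaleN1r; apply: subZ.2. Qed.

Lemma submod_sum (I : Type) (r : seq I) (P : pred I) F :
  (forall i, P i -> Z (F i)) -> Z (\sum_(i <- r | P i) F i).
Proof. by move=> h; apply: (big_ind Z) => //; [apply: subZ.1 | apply: submodD]. Qed.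

Lemma kchain_linear i j : klinear (kchain Z i j).
Proof.
split=> [f|a x y hx hy f]; first by rewrite ffunE; split=> //; [exact: subZ.1 | exact: degs_in0].
have [Zx dx x0] := hx f; have [Zy dy y0] := hy f; rewrite !ffunE; split.
- exact: subZ.2.
- by apply: degs_inD => //; apply: degs_inC.
- by move=> fi; rewrite x0 // y0 // scaler0 addr0.
Qed.

Lemma kcycle_linear i j : klinear (kcycle Z i j).
Proof.
split; first by split; [exact: (kchain_linear i j).1 | rewrite linear0].
move=> a x y [hx dx] [hy dy]; split; first exact: (kchain_linear i j).2.
by rewrite linearP /= dx dy scaler0 addr0.
Qed.

Lemma kboundary_linear i j : klinear (kboundary Z i j).
Proof.
split; first by exists 0; [exact: (kchain_linear _ _).1 | rewrite linear0].
move=> a _ _ [b hb ->] [b' hb' ->]; exists (a%:MP *: b + b'); last by rewrite linearP.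
exact: (kchain_linear _ _).2.
Qed.

Lemma kchain_kdiff i j b : kchain Z i.+1 j b -> kchain Z i j (kdiff b).
Proof.
move=> hb f; rewrite ffunE; split.
- by apply: submod_sum => v _; apply: submodZ; have [] := hb (v |: f).
- apply: degs_in_sum => v vf; rewrite ksignC; have [_ dv _] := hb (v |: f).
  apply: degs_inX dv => d; rewrite cardsU1 vf; lia.
- move=> fi; apply: big1 => v vf; have [_ _ ->] := hb (v |: f); rewrite ?scaler0 //.
  by rewrite cardsU1 vf add1n eqSS.
Qed.

Lemma kchain0_cycle j c : kchain Z 0 j c -> kdiff c = 0.
Proof.
move=> hc; apply/ffunP => f; rewrite !ffunE big1 // => v vf.
by have [_ _ ->] := hc (v |: f); rewrite ?scaler0 // cardsU1 vf.
Qed.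

End Closure.

Lemma kchain_sub s (Z Z' : 'rV[S]_(size s) -> Prop) i j c :
  (forall v, Z v -> Z' v) -> kchain Z i j c -> kchain Z' i j c.
Proof. by move=> ZZ' hc f; have [Zf df f0] := hc f; split; auto. Qed.

Notation anything := (fun=> True).

Lemma submod_anything (V : lmodType S) : submod (fun _ : V => True).
Proof. by []. Qed.

(** The Koszul complex of a free module is acyclic except in homological degree 0, where constants
    span the homology; the condition at [set0] excludes those classes. *)
Lemma free_koszul_exact (t : seq nat) i j (c : chain t) :
  kchain anything i j c -> kdiff c = 0 -> (forall k, (c set0 0 k)@_0%MM = 0) ->
  exists2 b, kchain anything i.+1 j b & c = kdiff b.
Proof.
move=> hc dc c0.
have [b hb] : exists b : 'I_(size t) -> {set 'I_n} -> S, forall k,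
   (forall f, kdiff1 (b k) f = c f 0 k) /\
   (forall f m, m \in msupp (b k f) -> exists v, v \in f /\ (m + U_(v))%MM \in msupp (c (f :\ v) 0 k)).
  apply: (@fin_all_exists _ (fun=> {set 'I_n} -> S) (fun k b => (forall f, kdiff1 b f = c f 0 k) /\
   (forall f m, m \in msupp (b f) -> exists v, v \in f /\ (m + U_(v))%MM \in msupp (c (f :\ v) 0 k)))) => k.
  have [||//|b db hb] := @koszul_exact n K (fun f => c f 0 k) (fun m v => m v != 0%N).
  - by move=> f; rewrite -kdiff_entry dc ffunE mxE.
  - move=> f mu h; apply/existsP; apply: contraT; rewrite negb_exists => /forallP all0.
    have : (mu + chi f)%MM == 0%MM.
      by apply/eqP/mnmP => v; rewrite mnm0E; apply/eqP; have := all0 v; rewrite negbK.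
    rewrite mnmD_eq0 => /andP[/eqP mu0 /eqP f0].
    have {}f0 : f = set0.
      by apply: (@chi_inj n); rewrite f0; apply/mnmP => v; rewrite chiE inE mnm0E.
    by move: h; rewrite mu0 f0 mcoeff_msupp c0 eqxx.
  - exists b; split => // f m /hb [v [_ vf h]]; by exists v.
exists [ffun f => \row_k b k f]; last first.
  apply/ffunP => f; apply/rowP => k; have [<- _] := hb k.
  rewrite kdiff_entry /kdiff1; apply: eq_bigr => v _; by rewrite ffunE mxE.
move=> f; rewrite ffunE; split => // [k m|fi].
  rewrite mxE => /(hb k).2 [v [vf h]]; have [_ /(_ _ _ h) d _] := hc (f :\ v).
  by move: d; rewrite mdegD mdeg1 [#|f|](cardsD1 v) vf; lia.
apply/rowP => k; rewrite !mxE; apply/mpolyP => m; rewrite mcoeff0; apply/eqP.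
rewrite mcoeff_eq0; apply/negP => /(hb k).2 [v [vf]].
have [_ _ ->] := hc (f :\ v); first by rewrite mxE msupp0.
by move: fi; rewrite (cardsD1 v f) vf add1n eqSS.
Qed.

Section Step.
Variables (s t : seq nat) (G : 'M[S]_(size t, size s)).
Hypothesis G_graded : forall a b m, m \in msupp (G a b) ->
  (mdeg m + nth 0 s b)%N = nth 0%N t a.
Notation im := (fun v : 'rV[S]_(size s) => exists w, v = w *m G).
Notation ker := (fun v : 'rV[S]_(size t) => v *m G = 0).
(** Minimality in terms of syzygies: it makes ker -> F zero on homology in degree 0, so that the
    connecting map is onto there as well. *)
Hypothesis G_min : forall v, ker v -> forall k, (v 0 k)@_0%MM = 0.

Lemma submod_im : submod im.
Proof.
split; first by exists 0; rewrite mul0mx.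
by move=> a _ _ [u ->] [v ->]; exists (a *: u + v); rewrite mulmxDl scalemxAl.
Qed.

Lemma submod_ker : submod ker.
Proof.
split; first by rewrite mul0mx.
by move=> a u v hu hv; rewrite mulmxDl -scalemxAl hu hv scaler0 addr0.
Qed.

Let push (b : chain t) : chain s := [ffun f => b f *m G].

Lemma kchain_push i j b : kchain anything i j b -> kchain im i j (push b).
Proof.
move=> hb f; have [_ df f0] := hb f; rewrite ffunE; split.
- by exists (b f).
- exact: degs_in_mul.
- by move/f0 => ->; rewrite mul0mx.
Qed.

Lemma kchain_lift i j c : kchain im i j c ->
  exists2 b, kchain anything i j b & c = push b.
Proof.
move=> hc.
have [b hb] : exists b : {set 'I_n} -> 'rV[S]_(size t), forall f : {set 'I_n},
   [/\ degs_in (fun d => d + #|f| == j)%N (b f), #|f| != i -> b f = 0 & c f = b f *m G].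
  apply: (@fin_all_exists _ (fun=> 'rV[S]_(size t)) (fun (f : {set 'I_n}) b =>
    [/\ degs_in (fun d => d + #|f| == j)%N b, #|f| != i -> b = 0 & c f = b *m G])) => f.
  have [[w E] df f0] := hc f; have [fi|fi] := eqVneq #|f| i.
    by have [u du E'] := degs_in_lift G_graded df E; exists u.
  by exists 0; split=> //; [exact: degs_in0 | rewrite mul0mx f0].
exists (finfun b); last by apply/ffunP => f; rewrite !ffunE; have [] := hb f.
by move=> f; rewrite ffunE; have [] := hb f.
Qed.

(* Snake relation of the short exact sequence 0 -> ker -> F -> im -> 0, where F
   is free on t: it induces the connecting map. *)
Let snake i j (c : chain s) (c' : chain t) : Prop :=
  exists b, [/\ kchain anything i.+1 j b, c = push b & c' = kdiff b].

Lemma push_kdiff b : kdiff (push b) = push (kdiff b).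
Proof. exact: kdiff_mulmx. Qed.

Lemma pushB b b' : push (b - b') = push b - push b'.
Proof. by apply/ffunP => f; rewrite !ffunE mulmxBl. Qed.

Lemma kchain_ker i j b : kchain anything i j b -> push b = 0 -> kchain ker i j b.
Proof.
move=> hb /ffunP pb f; have [_ df f0] := hb f; split => //.
by have := pb f; rewrite !ffunE.
Qed.

Lemma snake_total i j c : kcycle im i.+1 j c -> exists2 c', kcycle ker i j c' & snake i j c c'.
Proof.
case=> /kchain_lift [b hb Ec] dc; exists (kdiff b); last by exists b.
split; last exact: kdiff_kdiff.
apply: kchain_ker; last by rewrite -push_kdiff -Ec.
by apply: kchain_kdiff.
Qed.

Lemma snake_total' i j c' : kcycle ker i j c' -> exists2 c, kcycle im i.+1 j c & snake i j c c'.
Proof.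
case=> hc' dc'; have [|//|k|b hb E] := free_koszul_exact (i := i) (j := j) (c := c').
- by apply: kchain_sub hc'.
- by apply: G_min; have [] := hc' set0.
- exists (push b); last by exists b.
  split; first exact: kchain_push.
  rewrite push_kdiff -E; apply/ffunP => f; rewrite !ffunE.
  by have [] := hc' f.
Qed.

Lemma snake_boundary i j c c' : snake i j c c' ->
  kboundary im i.+1 j c <-> kboundary ker i j c'.
Proof.
case=> b [hb -> ->]; split.
- case=> e /kchain_lift [g hg ->] E; exists (b - kdiff g).
    apply: kchain_ker; last by rewrite pushB E push_kdiff subrr.
    by apply: klinearB (kchain_linear (submod_anything _) _ _) _ _ => //; apply: kchain_kdiff.
  by rewrite linearB /= kdiff_kdiff subr0.
- case=> b' hb' E.
  have hbb' : kchain anything i.+1 j (b - b').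
    apply: klinearB (kchain_linear (submod_anything _) _ _) _ _ => //.
    by apply: kchain_sub hb'.
  have [||g hg Eg] := free_koszul_exact hbb'.
  + by rewrite linearB /= E subrr.
  + move=> k; have [_ _ ->] := hbb' set0; first by rewrite mxE mcoeff0.
    by rewrite cards0.
  exists (push g); first exact: kchain_push.
  rewrite push_kdiff -Eg pushB [X in _ - X](_ : _ = 0) ?subr0 //.
  by apply/ffunP => f; rewrite !ffunE; have [] := hb' f.
Qed.

(** Long exact sequence of 0 -> ker -> F -> im -> 0: F has no higher Koszul homology and H_0(ker) ->
    H_0(F) is zero by minimality, so H_(i+1)(im) and H_i(ker) agree in every degree [j]. *)
Lemma qdim_koszul_step (T : finType) i j :
  qdim T (kcycle ker i j) (kboundary ker i j) ->
  qdim T (kcycle im i.+1 j) (kboundary im i.+1 j).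
Proof.
apply: (qdim_transport (R := snake i j)).
- exact/kcycle_linear/submod_im.
- exact/kcycle_linear/submod_ker.
- exists 0; split; [exact: (kchain_linear _ _ _).1 | | by rewrite linear0].
  by apply/ffunP => f; rewrite !ffunE mul0mx.
- move=> a x x' y y' [b [hb -> ->]] [b' [hb' -> ->]]; exists (a%:MP *: b + b'); split.
  + exact: (kchain_linear _ _ _).2.
  + by apply/ffunP => f; rewrite !ffunE mulmxDl scalemxAl.
  + by rewrite linearP.
- exact: snake_total.
- exact: snake_total'.
- by move=> x x' _ _; apply: snake_boundary.
Qed.

(** The same isomorphism read towards syzygies: this is how the degree bound travels along a
    resolution under construction. *)
Lemma vanish_koszul_step i j :
  (forall c, kcycle im i.+1 j c -> kboundary im i.+1 j c) ->
  (forall c, kcycle ker i j c -> kboundary ker i j c).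
Proof.
by move=> h c' /snake_total' [c cc /snake_boundary <-]; apply: h.
Qed.

Definition chain0 (r : nat) (v : 'rV[S]_r) : {ffun {set 'I_n} -> 'rV[S]_r} :=
  [ffun f => if f == set0 then v else 0].

Lemma kchain_chain0 (r : seq nat) (Z : 'rV[S]_(size r) -> Prop) j v :
  submod Z -> Z v -> degs_in (fun d => d == j) v -> kchain Z 0 j (chain0 v).
Proof.
move=> sZ Zv dv f; rewrite ffunE; case: eqP => [->|/eqP f0]; last first.
  by split=> //; [exact: sZ.1 | exact: degs_in0].
rewrite cards0; split=> // b m /dv; by rewrite addn0.
Qed.

Lemma kdiff_const r (c : {ffun {set 'I_n} -> 'rV[S]_r}) f k : (kdiff c f 0 k)@_0%MM = 0.
Proof.
rewrite kdiff_entry /kdiff1 raddf_sum /= big1 // => v _.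
by rewrite ksignC -mulrA mcoeffCM mcoeff_XM mnm0E mulr0.
Qed.

(** H_0(im) is im modulo (x_1, ..., x_n) im, and minimality makes the rows of degree [j] a basis of
    its degree [j] part. *)
Lemma qdim_koszul0 j :
  qdim {a : 'I_(size t) | nth 0%N t a == j} (kcycle im 0 j) (kboundary im 0 j).
Proof.
exists (fun a => chain0 (row (val a) G)).
have sumE (F : 'I_(size t) -> K) : 
   (\row_a (if nth 0%N t a == j then (F a)%:MP else 0)) *m G =
   \sum_(a : {a : 'I_(size t) | nth 0%N t a == j}) (F (val a))%:MP *: row (val a) G.
  rewrite mulmx_sum_row; under eq_bigr do rewrite mxE.
  rewrite (bigID (fun a : 'I_(size t) => nth 0%N t a == j)) /= [X in _ + X]big1 ?addr0; last first.
    by move=> a /negPf ->; rewrite scale0r.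
  rewrite (reindex_omap (J := {a : 'I_(size t) | nth 0%N t a == j}) val insub) => [|a ja]; last by rewrite insubT.
  by apply: eq_big => a; rewrite (valP a) // valK eqxx.
have sum0 (F : {a : 'I_(size t) | nth 0%N t a == j} -> K) f :
  (\sum_a (F a)%:MP *: chain0 (row (val a) G)) f =
  if f == set0 then \sum_a (F a)%:MP *: row (val a) G else 0.
  rewrite sum_ffunE; case: ifP => f0.
    by apply: eq_bigr => a _; rewrite !ffunE f0.
  by rewrite big1 // => a _; rewrite !ffunE f0 scaler0.
have chain_e (a : {a : 'I_(size t) | nth 0%N t a == j}) : kchain im 0 j (chain0 (row (val a) G)).
  apply: kchain_chain0; first exact: submod_im.
    by exists (delta_mx 0 (val a)); rewrite rowE.
  by move=> b m; rewrite mxE => /G_graded ->; apply: (valP a).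
split.
- by move=> a; split; [ | apply: kchain0_cycle (chain_e a)].
- move=> x [hx dx]; have [u hu Ex] := kchain_lift hx.
  (* Modulo (x_1, ..., x_n) only the constant terms of a lift survive; [w] keeps exactly those in
     degree [j]. *)
  exists (fun a => (u set0 0 (val a))@_0%MM).
  pose w := \row_a (if nth 0%N t a == j then ((u set0 0 a)@_0%MM)%:MP_[n] else 0).
  have hw : kchain anything 0 j (chain0 (u set0 - w)).
    apply: kchain_chain0 => //; apply: degs_inB.
      by have [_ d0 _] := hu set0; move=> b m /d0; rewrite cards0 addn0.
    move=> b m; rewrite mxE; case: eqP => [<-|]; last by rewrite msupp0.
    rewrite msuppC; case: ifP => // _; rewrite inE => /eqP ->.
    by rewrite mdeg0.
  have [||g hg Eg] := free_koszul_exact hw.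
  + by apply: kchain0_cycle hw.
  + move=> k; rewrite ffunE eqxx mxE [(- _ : 'M_(_,_)) _ _]mxE mcoeffB [w _ _]mxE.
    case: eqP => [_|/eqP kj]; first by rewrite mcoeffC eqxx mulr1 subrr.
    rewrite mcoeff0 subr0; apply/eqP; rewrite mcoeff_eq0; apply: contra kj.
    have [_ d0 _] := hu set0; move=> /d0; by rewrite mdeg0 cards0 addn0.
  exists (push g); first exact: kchain_push.
  rewrite push_kdiff -Eg; apply/ffunP => f; rewrite ffunE [(- _ : {ffun _}) f]ffunE sum0 Ex !ffunE.
  case: eqP => [->|/eqP f0]; first by rewrite mulmxBl (sumE (fun b => (u set0 0 b)@_0%MM)).
  by have [_ _ ->] := hu f; rewrite ?mul0mx ?subr0 // cards_eq0.
- move=> F [b /kchain_lift [g hg ->]]; rewrite push_kdiff => /ffunP /(_ set0).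
  rewrite sum0 eqxx ffunE => E a.
  pose F' k := oapp F 0 (insub k).
  have E' : (\row_a (if nth 0%N t a == j then (F' a)%:MP else 0) - kdiff g set0) *m G = 0.
    rewrite mulmxBl -E sumE; apply/eqP; rewrite subr_eq0; apply/eqP; apply: eq_bigr => b' _.
    by rewrite /F' valK.
  have := G_min E' (val a); rewrite mxE [(- _ : 'M_(_,_)) _ _]mxE mcoeffB kdiff_const subr0.
  by rewrite mxE (valP a) mcoeffC eqxx mulr1 /F' valK.
Qed.

End Step.
End KoszulHomology.

(** * Betti numbers as Koszul homology *)

Section BettiKoszul.
Variables (n : nat) (K : fieldType).
Notation S := {mpoly K[n]}.

Lemma qdim_ext (T : finType) (V : lmodType S) (P Q P' Q' : V -> Prop) :
  (forall x, P x <-> P' x) -> (forall x, Q x <-> Q' x) -> qdim T P Q -> qdim T P' Q'.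
Proof.
move=> PP QQ [e [h1 h2 h3]]; exists e; split=> [t|x|a].
- exact/PP.
- by move/PP/h2 => [a /QQ]; exists a.
- by move/QQ/h3.
Qed.

Section Extensionality.
Variables (s : seq nat) (Z Z' : 'rV[S]_(size s) -> Prop).
Hypothesis ZZ' : forall v, Z v <-> Z' v.

Lemma kchain_ext i j c : kchain Z i j c <-> kchain Z' i j c.
Proof. by split; apply: kchain_sub => v /ZZ'. Qed.

Lemma kcycle_ext i j c : kcycle Z i j c <-> kcycle Z' i j c.
Proof. by split=> -[/kchain_ext h d]; split => //; apply/kchain_ext. Qed.

Lemma kboundary_ext i j c : kboundary Z i j c <-> kboundary Z' i j c.
Proof. by split=> -[b /kchain_ext h ->]; exists b => //; apply/kchain_ext. Qed.

End Extensionality.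

Variables (F : free_complex K n) (I : S -> Prop).

(** The target of the map of stage [k]: S itself, as S(0), for the augmentation and F_(k-1)
    afterwards. This puts the augmentation and the differentials under one index. *)
Definition ambient k : seq nat := if k is k'.+1 then shifts F k' else [:: 0%N].

Definition stage k : 'M[S]_(size (shifts F k), size (ambient k)) :=
  match k with 0 => aug F | k'.+1 => diff F k' end.

Lemma qdim_resolution i j : minimal_graded_free_resolution F I ->
  qdim {a : 'I_(size (shifts F i)) | nth 0%N (shifts F i) a == j}
    (kcycle (s := [:: 0%N]) (fun v => I (v 0 0)) i j)
    (kboundary (s := [:: 0%N]) (fun v => I (v 0 0)) i j).
Proof.
move=> [[gr0 gr] [res0 res1 res] mini].
pose im k := fun v : 'rV[S]_(size (ambient k)) => exists w, v = w *m stage k.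
have graded k a b m : m \in msupp (stage k a b) ->
    (mdeg m + nth 0 (ambient k) b)%N = nth 0%N (shifts F k) a.
  case: k a b => [|k] a b h; last exact: gr.
  by rewrite /= (ord1 b) addn0; apply: gr0; rewrite -(ord1 b).
have kerE k v : v *m stage k = 0 <-> im k.+1 v by case: k v => [|k] v; [apply: res1 | apply: res].
have min k (v : 'rV_(size (shifts F k))) : v *m stage k = 0 -> forall l, (v 0 l)@_0%MM = 0.
  move=> hv l; have [w ->] := proj1 (kerE _ _) hv; rewrite mxE raddf_sum big1 //= => a _.
  by rewrite rmorphM /= mini mulr0.
(* Generalised over [k]: passing to syzygies trades one homological degree for one stage, so H_i of
   stage [k] becomes H_0 of stage [i + k]. *)
have main k : qdim {a : 'I_(size (shifts F (i + k))) | nth 0%N (shifts F (i + k)) a == j}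
    (kcycle (im k) i j) (kboundary (im k) i j).
  elim: i k => [|i' IH] k; first by apply: qdim_koszul0; [apply: graded | apply: min].
  apply: qdim_koszul_step; [apply: graded | apply: min | rewrite addSnnS].
  apply: qdim_ext (IH k.+1) => c.
    by apply: kcycle_ext => v; exact: (iff_sym (kerE _ _)).
  by apply: kboundary_ext => v; exact: (iff_sym (kerE _ _)).
have im0 v : im 0%N v <-> I (v 0 0).
  rewrite res0; split => -[w E]; exists w; first by rewrite E.
  by apply/rowP => l; rewrite (ord1 l).
have := main 0%N; rewrite addn0; apply: qdim_ext => c.
  exact: kcycle_ext.
exact: kboundary_ext.
Qed.

End BettiKoszul.

(** * Existence of minimal graded free resolutions *)

Section MinimalGenerators.
Variables (n : nat) (K : fieldType).
Notation S := {mpoly K[n]}.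

Lemma mpoly_irrelevant (p : S) : p@_0%MM = 0 -> exists q : 'I_n -> S, p = \sum_k 'X_k * q k.
Proof.
move=> p0; have [|||b db _] := @koszul_exact n K (fun f => if f == set0 then p else 0) (fun m v => m v != 0%N).
- move=> f; rewrite /kdiff1 big1 // => v _; rewrite ifF ?mulr0 //.
  by apply/eqP => /setP /(_ v); rewrite !inE eqxx.
- move=> f mu; case: eqP => [->|_]; last by rewrite msupp0.
  rewrite mcoeff_msupp => h; apply/existsP; apply: contraNT h.
  rewrite negb_exists => /forallP all0; suff -> : mu = 0%MM by rewrite p0.
  apply/mnmP => v; rewrite mnm0E; have := all0 v; rewrite negbK => /eqP.
  by rewrite mnmDE chiE; lia.
- by [].
exists (fun k => ksign S k set0 * b (k |: set0)).
have := db set0; rewrite eqxx => <-; rewrite /kdiff1; apply: eq_big => k; first by rewrite inE.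
by move=> _; rewrite mulrCA mulrA.
Qed.

Lemma degs_projX s (D : pred nat) (v : 'rV[S]_(size s)) (k : 'I_n) :
  degs_proj D ('X_k *: v) = 'X_k *: degs_proj (fun d => D d.+1) v.
Proof.
apply/rowP => b; apply/mpolyP => m; rewrite degs_projE !mxE !mcoeff_XM.
case: eqP => [_|/eqP mk]; first by case: ifP.
have := @degs_projE n K s (fun d => D d.+1) v b (m - U_(k))%MM; rewrite mxE => ->.
have -> // : (mdeg m + nth 0 s b = (mdeg (m - U_(k)) + nth 0 s b).+1)%N.
have /submK {1}<- : (U_(k) <= m)%MM by rewrite lep1mP.
by rewrite mdegD mdeg1 addn1 addSn.
Qed.

Lemma degs_projD s (D : pred nat) (u v : 'rV[S]_(size s)) :
  degs_proj D (u + v) = degs_proj D u + degs_proj D v.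
Proof.
apply/rowP => b; apply/mpolyP => m; rewrite [in RHS]mxE mcoeffD !degs_projE mxE mcoeffD.
by case: ifP; rewrite ?addr0.
Qed.

Lemma degs_proj_sum s (D : pred nat) (I : Type) (r : seq I) (F : I -> 'rV[S]_(size s)) :
  degs_proj D (\sum_(i <- r) F i) = \sum_(i <- r) degs_proj D (F i).
Proof.
elim: r => [|i r IH]; rewrite ?big_nil ?big_cons ?degs_projD ?IH //.
apply/rowP => b; apply/mpolyP => m; rewrite degs_projE !mxE mcoeff0; by case: ifP.
Qed.

(** Used to choose a family of independent generators that admits no extension by one. *)
Lemma ex_last (P : nat -> Prop) B : P 0%N -> (forall k, P k -> (k <= B)%N) ->
  exists2 k, P k & ~ P k.+1.
Proof.
move=> P0 PB; apply: Classical_Prop.NNPP => H.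
suff /PB : P B.+1 by rewrite ltnn.
elim: B.+1 => // k Pk; apply: Classical_Prop.NNPP => nPk; apply: H; by exists k.
Qed.

Section Generators.
Variables (s : seq nat) (Z : 'rV[S]_(size s) -> Prop) (N : nat).
Hypothesis subZ : submod Z.
Hypothesis gradedZ : forall D v, Z v -> Z (degs_proj D v).
Hypothesis vanishZ : forall j c, (N < j)%N -> kcycle Z 0 j c -> kboundary Z 0 j c.

Let mZ (v : 'rV[S]_(size s)) : Prop := exists2 z : 'I_n -> 'rV[S]_(size s), (forall k, Z (z k)) & v = \sum_k 'X_k *: z k.

Definition row_graded t (G : 'M[S]_(size t, size s)) : Prop :=
  forall a b m, m \in msupp (G a b) -> (mdeg m + nth 0 s b)%N = nth 0%N t a.

Let const_row r (a : 'rV[K]_r) : 'rV[S]_r := map_mx (mpolyC n (R := K)) a.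

(** Partial families of minimal generators: homogeneous elements of [Z], of degree at most [N],
    independent over [K] modulo (x_1, ..., x_n) Z. *)
Let good t (G : 'M[S]_(size t, size s)) : Prop :=
  [/\ forall a : 'I_(size t), (nth 0 t a <= N)%N, forall a, Z (row a G), row_graded G
    & forall a : 'rV[K]_(size t), mZ (const_row a *m G) -> a = 0].

Let mZ0 : mZ 0.
Proof. by exists (fun=> 0) => [k|]; [exact: subZ.1 | rewrite big1 // => k _; rewrite scaler0]. Qed.

(** Independence modulo [mZ] implies independence over [K], and only monomials of degree at most [N]
    occur, so the coefficient vectors live in a fixed finite-dimensional space. *)
Let good_bound t (G : 'M[S]_(size t, size s)) :
  good G -> (size t <= #|{: 'I_(size s) * 'X_{1..n < N.+1}}|)%N.
Proof.
case=> tN _ gr free.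
pose A : 'M[K]_(size t, #|{: 'I_(size s) * 'X_{1..n < N.+1}}|) :=
  \matrix_(a, k) let p : 'I_(size s) * 'X_{1..n < N.+1} := enum_val k in (G a p.1)@_(p.2).
suff : row_free A by move=> /eqP <-; apply: rank_leq_col.
apply: inj_row_free => a aA; apply: free; suff -> : const_row a *m G = 0 by [].
apply/rowP => b; apply/mpolyP => m; rewrite !mxE mcoeff0 raddf_sum /=.
have [mN|mN] := ltnP (mdeg m) N.+1.
  move/rowP: aA => /(_ (enum_rank (b, BMultinom mN))); rewrite !mxE => E.
  by rewrite -[RHS]E; apply: eq_bigr => k _; rewrite !mxE enum_rankK mcoeffCM.
rewrite big1 // => k _; rewrite mxE mcoeffCM (memN_msupp_eq0 (m := m)) ?mulr0 //.
apply: contraTN mN => /gr E; rewrite -ltnNge ltnS.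
by apply: leq_trans (tN k); rewrite -E leq_addr.
Qed.

Let image (t : seq nat) (G : 'M[S]_(size t, size s)) (v : 'rV[S]_(size s)) : Prop :=
  exists w, v = w *m G.

Let sub_image (t : seq nat) (G : 'M[S]_(size t, size s)) : submod (image G) := submod_im G.

(** H_0(Z) is Z modulo (x_1, ..., x_n) Z, so its vanishing says that no new generator is needed in
    degree [j]. *)
Let chain_irrelevant j v : (N < j)%N -> Z v -> degs_in (pred1 j) v -> mZ v.
Proof.
move=> Nj Zv dv; have hc := kchain_chain0 subZ Zv dv.
have [b hb /ffunP /(_ set0)] := vanishZ Nj (conj hc (kchain0_cycle hc)).
rewrite !ffunE eqxx => ->; exists (fun k => ksign S k set0 *: b (k |: set0)).
  by move=> k; apply: submodZ => //; have [] := hb (k |: set0).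
by apply: eq_big => k; rewrite ?inE // => _; rewrite scalerA mulrC.
Qed.

(** Graded Nakayama by induction on the degree: an element outside the rows plus [mZ] could be
    adjoined to a maximal family, and the [mZ] part is handled in lower degree. *)
Let good_generates t (G : 'M[S]_(size t, size s)) : good G ->
  (forall t' (G' : 'M[S]_(size t', size s)), size t' = (size t).+1 -> ~ good G') ->
  forall d v, Z v -> degs_in (pred1 d) v -> image G v.
Proof.
move=> [tN ZG gr free] maxi; elim/ltn_ind => d IH v Zv dv.
suff [u [z Zz E]] : exists u, exists2 z, (forall k, Z (z k)) & v = u *m G + \sum_k 'X_k *: z k.
  rewrite -(degs_proj_id dv) E degs_projD (degs_proj_mul gr) degs_proj_sum.
  apply: (submodD (sub_image G)); first by exists (degs_proj (pred1 d) u).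
  apply: (submod_sum (sub_image G)) => k _; rewrite degs_projX.
  apply: (submodZ (sub_image G)).
  have Zp : Z (degs_proj (fun e => pred1 d e.+1) (z k)) by apply: gradedZ.
  have dp := @degs_proj_in n K s (fun e => pred1 d e.+1) (z k).
  clear dv E; case: d IH Zp dp => [|d] IH Zp dp.
    suff -> : degs_proj (fun e => pred1 0%N e.+1) (z k) = 0 by exists 0; rewrite mul0mx.
    by apply: (degs_in_disjoint (D := pred0)) => b m /dp.
  by apply: (IH d) => // b m /dp.
have [dN|dN] := ltnP N d.
  have [z Zz E] := chain_irrelevant dN Zv dv.
  by exists 0, z => //; rewrite mul0mx add0r.
have := maxi (d :: t) (col_mx v G) erefl.
move=> H; apply: Classical_Prop.NNPP => nH; apply: H; split.
- move=> a; rewrite -[size (d :: t)]/(1 + size t)%N in a *.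
  by case: (splitP a) => l ->; rewrite ?(ord1 l) // add1n /=.
- move=> a; rewrite -[size (d :: t)]/(1 + size t)%N in a *.
  rewrite -(splitK a); case: (split a) => l.
    by rewrite -[unsplit _]/(lshift _ l) rowKu (ord1 l) row_id.
  by rewrite -[unsplit _]/(rshift _ l) rowKd.
- move=> a b m; rewrite -[size (d :: t)]/(1 + size t)%N in a *.
  rewrite -(splitK a); case: (split a) => l.
    by rewrite -[unsplit _]/(lshift _ l) col_mxEu (ord1 l) => /dv /eqP.
  by rewrite -[unsplit _]/(rshift _ l) col_mxEd => /gr.
move=> a; rewrite -[size (d :: t)]/(1 + size t)%N in a *.
rewrite -[a]hsubmxK; set a0 := lsubmx a; set a1 := rsubmx a.
rewrite /const_row map_row_mx -/(const_row a0) -/(const_row a1) mul_row_col => -[z Zz E].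
have a0E : const_row a0 *m v = (a0 0 0)%:MP *: v.
  by apply/rowP => b; rewrite !mxE big_ord1 !mxE.
(* With zero coefficient at [v] the relation is one among the old rows, hence trivial; otherwise it
   can be solved for [v], against [nH]. *)
have [a00|a00] := eqVneq (a0 0 0) 0.
  have a0_0 : a0 = 0 by apply/rowP => l; rewrite (ord1 l) a00 mxE.
  rewrite a0_0 (free a1) ?row_mx0 //; exists z => //.
  by rewrite -E a0E a00 rmorph0 scale0r add0r.
case: nH; exists (- ((a0 0 0)^-1%:MP *: const_row a1)), (fun k => (a0 0 0)^-1%:MP *: z k).
  by move=> k; apply: submodZ.
under eq_bigr do rewrite scalerA mulrC -scalerA.
rewrite -scaler_sumr -E a0E mulNmx -scalemxAl scalerDr scalerA -rmorphM /= mulVf //.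
by rewrite rmorph1 scale1r addrCA addNr addr0.
Qed.

Lemma minimal_generators : exists (t : seq nat) (G : 'M[S]_(size t, size s)),
  [/\ row_graded G, forall v, Z v <-> exists w, v = w *m G
    & forall v : 'rV_(size t), v *m G = 0 -> forall k, (v 0 k)@_0%MM = 0].
Proof.
have [||_ [t [<- [G gG]]] maxi] := @ex_last
    (fun k => exists t : seq nat, size t = k /\ exists G : 'M[S]_(size t, size s), good G)
    #|{: 'I_(size s) * 'X_{1..n < N.+1}}|.
- exists [::]; split => //; exists 0; split; try by case.
  by move=> a _; apply/rowP; case.
- by move=> _ [t [<- [G /good_bound]]].
exists t, G; have [_ ZG gr free] := gG; split => //.
  move=> v; split=> [Zv|[w ->]]; last first.
    by rewrite mulmx_sum_row; apply: submod_sum => // a _; apply: submodZ.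
  have gen := good_generates gG (fun t' G' E gG' =>
    maxi (ex_intro _ t' (conj E (ex_intro _ G' gG')))).
  (* An arbitrary [v] is peeled from its top degree downwards; [M] bounds its degrees. *)
  have [M] : exists M, degs_in (fun d => (d < M)%N) v.
    exists (\max_(b < size s) \max_(m <- msupp (v 0%R b)) (mdeg m + nth 0 s b).+1)%N => b m h.
    apply: leq_trans (leq_bigmax b).
    exact: (@leq_bigmax_seq _ _ xpredT (fun m => (mdeg m + nth 0 s b).+1)).
  elim: M v Zv => [|M IH] v Zv dv.
    exists 0; rewrite mul0mx; apply: (degs_in_disjoint dv) => b m /dv; by rewrite ltn0.
  rewrite -[v](subrK (degs_proj (pred1 M) v)); apply: (submodD (sub_image G)).
    apply: IH; first by apply: submodB => //; apply: gradedZ.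
    move=> b m h; have /= := degs_proj_out h.
    suff : (mdeg m + nth 0 s b < M.+1)%N by rewrite ltnS leq_eqVlt; case: eqP.
    move: h; rewrite mxE [(- _ : 'M_(_,_)) _ _]mxE => /msuppB_le; rewrite mem_cat.
    by case/orP => [|/degs_proj_msupp] /dv.
  by apply: (gen M); [apply: gradedZ | apply: degs_proj_in].
(* The constant terms of a syzygy form a relation modulo [mZ], so they vanish by independence. *)
move=> v vG; pose a : 'rV[K]_(size t) := \row_k (v 0 k)@_0%MM.
suff a0 : a = 0 by move=> l; have /rowP/(_ l) := a0; rewrite !mxE.
apply: free.
have [q hq] : exists q : 'I_(size t) -> 'I_n -> S,
    forall l, v 0 l - ((v 0 l)@_0%MM)%:MP = \sum_k 'X_k * q l k.
  apply: (@fin_all_exists _ (fun=> 'I_n -> S) (fun l q => v 0 l - ((v 0 l)@_0%MM)%:MP = \sum_k 'X_k * q k)) => l.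
  by apply: mpoly_irrelevant; rewrite mcoeffB mcoeffC eqxx mulr1 subrr.
exists (fun k => - ((\row_l q l k) *m G)).
  move=> k; rewrite -scaleN1r; apply: submodZ => //.
  by rewrite mulmx_sum_row; apply: submod_sum => // l _; apply: submodZ.
have -> : const_row a = v - \sum_k 'X_k *: \row_l q l k.
  apply/rowP => l; rewrite !mxE summxE; apply/eqP; rewrite eq_sym subr_eq addrC -subr_eq hq.
  by apply/eqP; apply: eq_bigr => k _; rewrite !mxE.
rewrite mulmxBl vG sub0r mulmx_suml -sumrN; apply: eq_bigr => k _.
by rewrite -scalemxAl scalerN.
Qed.

End Generators.
End MinimalGenerators.

Section ResolutionExists.
Variables (n : nat) (K : fieldType).
Notation S := {mpoly K[n]}.
Variables (I : S -> Prop) (N : nat).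
Notation Z0 := (fun v : 'rV[S]_(size [:: 0%N]) => I (v 0 0)).
Hypothesis sub_I : submod Z0.
Hypothesis graded_I : forall D v, Z0 v -> Z0 (degs_proj D v).
Hypothesis vanish_I : forall i j c, (N < j)%N -> kcycle Z0 i j c -> kboundary Z0 i j c.

Let image (s t : seq nat) (G : 'M[S]_(size t, size s)) (v : 'rV[S]_(size s)) : Prop :=
  exists w, v = w *m G.

Let stage_ok (s t : seq nat) (G : 'M[S]_(size t, size s)) : Prop :=
  [/\ row_graded G, forall v : 'rV_(size t), v *m G = 0 -> forall k, (v 0 k)@_0%MM = 0
    & forall i j c, (N < j)%N -> kcycle (image G) i j c -> kboundary (image G) i j c].

(** The bound [N] is the same at the next stage, because the snake isomorphism lowers the
    homological degree and keeps the total degree [j]. *)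
Let next_stage (s t : seq nat) (G : 'M[S]_(size t, size s)) : stage_ok G ->
  exists (u : seq nat) (G' : 'M[S]_(size u, size t)),
    stage_ok G' /\ forall v, v *m G = 0 <-> image G' v.
Proof.
case=> gr min van.
have {}vanK i j c : (N < j)%N -> kcycle (fun v : 'rV_(size t) => v *m G = 0) i j c ->
    kboundary (fun v : 'rV_(size t) => v *m G = 0) i j c.
  by move=> Nj; apply: (vanish_koszul_step gr min) => c' ?; apply: van.
have [||u [G' [gr' im' min']]] := minimal_generators (submod_ker G) (N := N).
- move=> D v vG; rewrite -degs_proj_mul // vG; apply/rowP => b; apply/mpolyP => m.
  by rewrite degs_projE !mxE mcoeff0; case: ifP.
- by move=> j c; apply: vanK.
exists u, G'; split => //; split => // i j c Nj /(kcycle_ext im') h.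
by apply/(kboundary_ext im'); apply: vanK.
Qed.

Record stage_data := StageData {
  st_source : seq nat; st_gens : seq nat;
  st_map : 'M[S]_(size st_gens, size st_source);
  st_ok : stage_ok st_map }.

Let next (x : stage_data) : {y : {u : seq nat & {G' : 'M[S]_(size u, size (st_gens x)) | stage_ok G'}} |
  forall v, v *m st_map x = 0 <-> image (sval (projT2 y)) v}.
Proof.
apply: constructive_indefinite_description.
have [u [G' [ok im]]] := next_stage (st_ok x).
by exists (existT _ u (exist _ G' ok)).
Qed.

Let next_data (x : stage_data) : stage_data :=
  StageData (svalP (projT2 (sval (next x)))).

Theorem minimal_resolution_exists : exists F, minimal_graded_free_resolution F I.
Proof.
have [||t [G [gr im min]]] := minimal_generators sub_I (N := N).
- exact: graded_I.
- by move=> j c; apply: vanish_I.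
have ok : stage_ok G.
  split=> // i j c Nj /(kcycle_ext im) h.
  by apply/(kboundary_ext im); apply: vanish_I.
pose x0 := StageData ok.
pose x k := iter k next_data x0.
have kerE k (v : 'rV_(size (st_gens (x k)))) :
  v *m st_map (x k) = 0 <-> exists w : 'rV_(size (st_gens (x k.+1))), v = w *m st_map (x k.+1).
  exact: (svalP (next (x k))).
exists (@FreeComplex K n (fun k => st_gens (x k)) (st_map (x 0%N)) (fun k => st_map (x k.+1))).
split.
- split=> [a m h|i a b m]; last by have [gr' _ _] := st_ok (x i.+1); apply: gr'.
  by have := gr a 0 m h; rewrite /= addn0.
- split=> /=.
  + move=> f; split=> [If|[v ->]]; last by apply/im; exists v.
    have [|w E] := (im (const_mx f)).1; first by rewrite mxE.
    by exists w; rewrite -E mxE.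
  + exact: (kerE 0%N).
  + by move=> i; apply: (kerE i.+1).
(* Rows of a differential are syzygies of the previous stage, so their constant terms vanish. *)
- move=> i a b /=.
  have := (kerE i (row a (st_map (x i.+1)))).2.
  case: (st_ok (x i)) => _ min' _ /(_ _) h.
  have := min' (row a (st_map (x i.+1))); rewrite h => [/(_ erefl b)|]; first by rewrite mxE.
  by exists (delta_mx 0 a); rewrite rowE.
Qed.

End ResolutionExists.

(** * Matchings in complements of triangle-free graphs *)

Section Matchings.
Local Open Scope nat_scope.
Variables (n : nat) (D : {set {set 'I_n}}).
Implicit Types (A B F : {set 'I_n}) (M : {set {set 'I_n}}).

Lemma adj_sym : ssrbool.symmetric (adj D).
Proof. by move=> x y; rewrite /adj /= eq_sym setUC. Qed.

Lemma adj_irrefl : irreflexive (adj D).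
Proof. by move=> x; rewrite /adj /= eqxx. Qed.

Definition triangle_free := forall x y z, adj D x y -> adj D y z -> ~~ adj D x z.

Definition complete_between A B := forall x y, x \in A -> y \in B -> adj D x y.

Lemma complete_between_sym A B : complete_between A B -> complete_between B A.
Proof. by move=> h x y xB yA; rewrite adj_sym h. Qed.

Lemma complete_between_disjoint A B x :
  complete_between A B -> x \in A -> x \notin B.
Proof. by move=> h xA; apply/negP => xB; have := h x x xA xB; rewrite adj_irrefl. Qed.

Lemma complete_between_card A B : complete_between A B -> #|A :|: B| = #|A| + #|B|.
Proof.
move=> h; rewrite cardsU [A :&: B](_ : _ = set0) ?cards0 ?subn0 //.
by apply/setP => x; rewrite !inE; case: (boolP (x \in A)) => //= /(complete_between_disjoint h)/negPf.
Qed.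

Definition odd_bipartite F := exists A B,
  [/\ F = A :|: B, odd #|A|, odd #|B| & complete_between A B].

Definition matchable k F := exists M,
  [/\ matching (compl_edges D) M, #|M| = k & cover M \subset F].

Lemma matchable0 F : matchable 0 F.
Proof.
exists set0; rewrite /matching sub0set cards0 /cover big_set0 sub0set; split => //.
by rewrite /trivIset /cover !big_set0 cards0.
Qed.

Lemma matchable_sub k F F' : F \subset F' -> matchable k F -> matchable k F'.
Proof. by move=> FF [M [h1 h2 h3]]; exists M; split => //; apply: subset_trans FF. Qed.

Lemma matchableU k l F F' : matchable k F -> matchable l F' -> [disjoint F & F'] ->
  matchable (k + l) (F :|: F').
Proof.
move=> [M [/andP[ME Mt] Mk Mc]] [M' [/andP[ME' Mt'] Mk' Mc']] dis.
have subF E : E \in M -> E \subset F.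
  by move=> h; apply: subset_trans Mc; apply: bigcup_sup h.
have subF' E : E \in M' -> E \subset F'.
  by move=> h; apply: subset_trans Mc'; apply: bigcup_sup h.
have disE E E' : E \in M -> E' \in M' -> [disjoint E & E'].
  by move=> /subF h /subF' h'; apply: disjointWl h _; apply: disjointWr h' _.
exists (M :|: M'); split.
- rewrite /matching subUset ME ME' /=; apply/trivIsetP => E E'; rewrite !inE.
  move/trivIsetP: Mt => Mt; move/trivIsetP: Mt' => Mt'.
  case/orP => h /orP[] h' ne.
  + exact: Mt.
  + exact: disE.
  + by rewrite disjoint_sym; apply: disE.
  + exact: Mt'.
- rewrite cardsU Mk Mk' [M :&: M'](_ : _ = set0) ?cards0 ?subn0 //.
  apply/setP => E; rewrite !inE; apply/negP => /andP[h h'].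
  have := disE _ _ h h'; rewrite -setI_eq0 setIid => /eqP E0.
  by have := subsetP ME _ h; rewrite inE E0 cards0.
- apply/subsetP => x /bigcupP [E]; rewrite !inE => /orP[/subF|/subF'] /subsetP h /h ->//.
  by rewrite orbT.
Qed.

Lemma compl_edgesP x y : ([set x; y] \in compl_edges D) = (x != y) && ~~ adj D x y.
Proof. by rewrite inE cards2 /adj /=; case: (x == y). Qed.

Lemma matchable_edge x y : x != y -> ~~ adj D x y -> matchable 1 [set x; y].
Proof.
move=> xy nxy; exists [set [set x; y]].
split; rewrite ?cards1 /cover ?big_set1 //.
by rewrite /matching sub1set compl_edgesP xy nxy /trivIset /cover !big_set1 eqxx.
Qed.

Lemma card_ge2 F : 2 <= #|F| -> exists x y, [/\ x \in F, y \in F & x != y].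
Proof.
move=> h; have /card_gt0P [x xF] : 0 < #|F| by lia.
have /card_gt0P [y] : 0 < #|F :\ x| by rewrite (cardsD1 x) xF in h; lia.
by rewrite !inE => /andP[yx yF]; exists x, y; rewrite eq_sym.
Qed.

Definition independent F := forall x y, x \in F -> y \in F -> ~~ adj D x y.

Lemma setD2_edge F x y : x \in F -> y \in F -> x != y ->
  [/\ F = [set x; y] :|: (F :\ x :\ y), [disjoint [set x; y] & F :\ x :\ y] & #|F| = #|F :\ x :\ y|.+2].
Proof.
move=> xF yF xy; split.
- apply/setP => z; rewrite !inE; case: (z =P x) => [->|_] //=.
  by case: (z =P y) => [->|_].
- rewrite -setI_eq0; apply/eqP/setP => z; rewrite !inE.
  by case: (z == x); case: (z == y).
- by rewrite (cardsD1 x) xF (cardsD1 y (F :\ x)) !inE eq_sym xy yF.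
Qed.

(** Any two vertices of an independent set form an edge of the complement, so they can be paired off
    arbitrarily. *)
Lemma matchable_independent k F : independent F -> 2 * k <= #|F| -> matchable k F.
Proof.
elim: k F => [|k IH] F iF Fk; first exact: matchable0.
have [|x [y [xF yF xy]]] := @card_ge2 F; first by lia.
have [E dis cF] := setD2_edge xF yF xy; rewrite E -add1n.
apply: matchableU => //; first by apply: matchable_edge => //; apply: iF.
apply: IH; last by lia.
by move=> a b; rewrite !inE => /andP[_ /andP[_ aF]] /andP[_ /andP[_ bF]]; apply: iF.
Qed.

Lemma half_sum_odd a b k : odd a -> odd b -> a + b = 2 * k ->
  k.+1 = (1 + a)./2 + (1 + b)./2 /\ k = (1 + a)./2 + b./2.
Proof. by move=> oa ob E; split; lia. Qed.

Section TriangleFree.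
Hypothesis no_triangle : triangle_free.

Lemma complete_between_independent A B y : complete_between A B -> y \in B -> independent A.
Proof.
move=> h yB a b aA bA; apply: (no_triangle (y := y)); first exact: h.
by rewrite adj_sym; apply: h.
Qed.

Lemma independentU1 A x : independent A -> (forall a, a \in A -> ~~ adj D x a) ->
  independent (x |: A).
Proof.
move=> iA xA a b; rewrite !inE => /orP[/eqP ->|aA] /orP[/eqP ->|bA].
- by rewrite adj_irrefl.
- exact: xA.
- by rewrite adj_sym; apply: xA.
- exact: iA.
Qed.

(** A neighbour on each side would close a triangle. *)
Lemma nonadjacent_side A B x : complete_between A B ->
  (forall a, a \in A -> ~~ adj D x a) \/ (forall b, b \in B -> ~~ adj D x b).
Proof.
move=> h; have [/existsP [a /andP[aA xa]]|/existsPn hA] := boolP [exists a, (a \in A) && adj D x a].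
  by right=> b bB; apply: (no_triangle xa); apply: h.
by left=> a aA; have := hA a; rewrite aA.
Qed.

Lemma odd_gt0_ex A : odd #|A| -> exists a, a \in A.
Proof. by move=> oA; apply/card_gt0P; case: #|A| oA. Qed.

(** The vertex [x] joins the side where it has no neighbour, which becomes even and is paired off;
    the other odd side leaves one vertex out. *)
Lemma odd_bipartite_matchable_add k F x : #|F| = 2 * k -> x \notin F ->
  odd_bipartite F -> matchable k (x |: F).
Proof.
move=> Fk xF [A [B [EF]]].
wlog: A B EF / forall a, a \in A -> ~~ adj D x a.
  move=> W oA oB h; have [xA|xB] := nonadjacent_side x h; first exact: (W A B).
  by apply: (W B A) => //; [rewrite setUC | apply: complete_between_sym].
move=> xA oA oB h.
have [a aA] := odd_gt0_ex oA; have [b bB] := odd_gt0_ex oB.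
have cF : #|A| + #|B| = 2 * k by rewrite -complete_between_card // -EF.
have -> : k = (#|A|.+1)./2 + (#|B|)./2 by lia.
rewrite EF setUA; apply: matchableU.
- apply: matchable_independent.
    by apply: independentU1 xA; apply: complete_between_independent h bB.
  rewrite cardsU1; move: xF; rewrite EF inE negb_or => /andP[-> _]; lia.
- apply: matchable_independent; last by lia.
  exact: complete_between_independent (complete_between_sym h) aA.
- rewrite -setI_eq0; apply/eqP/setP => z; rewrite !inE.
  apply/negP => /andP[/orP[/eqP ->|zA] zB].
    by move: xF; rewrite EF inE zB orbT.
  by have := complete_between_disjoint h zA; rewrite zB.
Qed.

(** Induction by removing a nonadjacent pair x, y. If the remainder is odd bipartite with parts A
    and B, either x and y can be absorbed with every vertex matched, or both join the same part and
    F is odd bipartite. *)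
Lemma even_matchable k F : #|F| = 2 * k -> matchable k F \/ odd_bipartite F.
Proof.
elim: k F => [|k IH] F Fk; first by left; apply: matchable0.
have [/existsP [x /existsP [y /and4P[xF yF xy nxy]]]|none] :=
  boolP [exists x, exists y, [&& x \in F, y \in F, x != y & ~~ adj D x y]]; last first.
  (* Without nonadjacent pairs F is a clique, hence a single edge, with parts of size 1. *)
  have [|x [y [xF yF xy]]] := @card_ge2 F; first by lia.
  have [EF dis cF] := setD2_edge xF yF xy.
  have all_adj a b : a \in F -> b \in F -> a != b -> adj D a b.
    move=> aF bF ab; apply: contraNT none => nab.
    by apply/existsP; exists a; apply/existsP; exists b; rewrite aF bF ab.
  right; exists [set x], [set y]; rewrite !cards1; split => //; last first.
    by move=> a b; rewrite !inE => /eqP -> /eqP ->; apply: all_adj.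
  suff E0 : F :\ x :\ y = set0 by rewrite EF E0 setU0.
  apply/setP => z; rewrite !inE; apply/negP => /and3P[zy zx zF].
  have := no_triangle (all_adj _ _ xF yF xy) (all_adj _ _ yF zF _).
  by rewrite eq_sym zy => /(_ isT); rewrite all_adj // eq_sym.
have [EF dis cF] := setD2_edge xF yF xy; set F' := F :\ x :\ y in EF dis cF.
have F'k : #|F'| = 2 * k by lia.
have mxy := matchable_edge xy nxy.
have [m|[A [B [EF' oA oB h]]]] := IH F' F'k.
  by left; rewrite EF -add1n; apply: matchableU.
have xyF' z : z \in [set x; y] -> (z \in A = false) * (z \in B = false).
  move=> zxy; have : z \notin F' by apply/negP => zF'; move/pred0P: dis => /(_ z) /=; rewrite zxy zF'.
  by rewrite EF' inE negb_or => /andP[/negPf-> /negPf->].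
have [xA xB] := xyF' x (set21 x y); have [yA yB] := xyF' y (set22 x y).
wlog: A B EF' oA oB h xA xB yA yB {xyF'} / forall a, a \in A -> ~~ adj D x a.
  move=> W; have [xA'|xB'] := nonadjacent_side x h; first exact: (W A B).
  by apply: (W B A) => //; [rewrite setUC | apply: complete_between_sym].
move=> xA'.
have cAB : #|A| + #|B| = 2 * k by rewrite -complete_between_card // -EF'.
have [a aA] := odd_gt0_ex oA; have [b bB] := odd_gt0_ex oB.
have iA := complete_between_independent h bB.
have iB := complete_between_independent (complete_between_sym h) aA.
have disAB z : z \in A -> z \in B = false by move=> /(complete_between_disjoint h)/negPf.
(* x has no neighbour in A; if y has none in B, both sides become even independent sets. *)
have [yB'|/forallPn/=[b1]] := boolP [forall b, (b \in B) ==> ~~ adj D y b].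
  left; have -> : k.+1 = (#|x |: A|)./2 + (#|y |: B|)./2.
    by rewrite !cardsU1 xA yB (half_sum_odd oA oB cAB).1.
  have -> : F = (x |: A) :|: (y |: B).
    rewrite EF EF' -!setUA; congr (_ :|: _); rewrite setUCA; congr (_ :|: _).
  apply: matchableU.
  - apply: matchable_independent; first exact: independentU1.
    by clear; lia.
  - apply: matchable_independent; last by clear; lia.
    by apply: independentU1 => // c cB; move/forallP: yB' => /(_ c); rewrite cB.
  - rewrite -setI_eq0; apply/eqP/setP => z; rewrite !inE.
    case: (z =P x) => [->|_] /=; first by rewrite xB (negPf xy).
    by case: (boolP (z \in A)) => //= zA; rewrite disAB // orbF; apply: contraTF zA => /eqP ->; rewrite yA.
rewrite negb_imply negbK => /andP[b1B yb1].
have yA' : forall a, a \in A -> ~~ adj D y a.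
  by have [//|/(_ _ b1B)] := nonadjacent_side y h; rewrite yb1.
(* [z] misses some [b2] of B: then z, b2 is an edge of the complement, [w] completes A to an even
   set, and B minus [b2] is even. *)
have two z w : [set z; w] = [set x; y] -> z != w -> z \in A = false -> z \in B = false ->
    w \in A = false -> w \in B = false -> (forall a, a \in A -> ~~ adj D w a) ->
    forall b2, b2 \in B -> ~~ adj D z b2 -> matchable k.+1 F.
  move=> Ezw zw zA zB wA wB hw b2 b2B nzb2.
  have -> : k.+1 = 1 + ((#|w |: A|)./2 + (#|B :\ b2|)./2).
    rewrite cardsU1 wA {1}(half_sum_odd oA oB cAB).2 -addn1 addnC; congr (_ + (_ + _)).
    by rewrite (cardsD1 b2 B) b2B /= in oB *; rewrite uphalf_half (negPf oB).
  have -> : F = [set z; b2] :|: ((w |: A) :|: (B :\ b2)).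
    rewrite EF EF' -Ezw -[in LHS](setD1K b2B).
    by apply/setP => t; rewrite !inE; do !case: (_ == _) => //=; rewrite ?orbT ?orbF.
  have zb2 : z != b2 by apply: contraTneq b2B => <-; rewrite zB.
  apply: matchableU; first exact: matchable_edge.
  - apply: matchableU.
    + apply: matchable_independent; first exact: independentU1.
    by clear; lia.
    + apply: matchable_independent; last by clear; lia.
      by move=> c d; rewrite !inE => /andP[_ cB] /andP[_ dB]; apply: iB.
    + rewrite -setI_eq0; apply/eqP/setP => t; rewrite !inE.
      case: (t =P w) => [->|_] /=; first by rewrite wB andbF.
      by case: (boolP (t \in A)) => //= tA; rewrite disAB // andbF.
  - rewrite -setI_eq0; apply/eqP/setP => t; rewrite !inE.
    case: (t =P z) => [->|_] /=; first by rewrite (negPf zw) zA zB andbF.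
    case: (t =P b2) => //= ->; rewrite orbF; apply/negP => /orP[/eqP E|b2A].
      by move: b2B; rewrite E wB.
    by rewrite disAB in b2B.
have [xB'|/forallPn/=[b2]] := boolP [forall b, (b \in B) ==> adj D x b]; last first.
  by rewrite negb_imply => /andP[b2B nxb]; left; apply: (two x y erefl) nxb.
have [yB'|/forallPn/=[b2]] := boolP [forall b, (b \in B) ==> adj D y b]; last first.
  rewrite negb_imply => /andP[b2B nyb]; left; apply: (two y x _ _ _ _ _ _ _ b2 b2B nyb) => //.
    by rewrite setUC.
  by rewrite eq_sym.
(* Both x and y are joined to all of B, so A grows by two vertices and stays odd. *)
right; exists (x |: (y |: A)), B; split => //.
- by rewrite EF EF' -!setUA.
- by rewrite !cardsU1 !inE negb_or xy xA yA /= ?add1n /= negbK.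
- move=> c d; rewrite !inE => /or3P[/eqP->|/eqP->|cA] dB.
  + by move/forallP: xB' => /(_ d); rewrite dB.
  + by move/forallP: yB' => /(_ d); rewrite dB.
  + exact: h.
Qed.

Lemma odd_matchable k F : #|F| = (2 * k).+1 -> matchable k F.
Proof.
move=> Fk; have /card_gt0P [x xF] : 0 < #|F| by lia.
have FDk : #|F :\ x| = 2 * k by rewrite (cardsD1 x) xF in Fk; lia.
rewrite -(setD1K xF); have [m|b] := even_matchable FDk.
  by apply: matchable_sub m; apply: subsetUr.
by apply: odd_bipartite_matchable_add; rewrite ?setD11.
Qed.

End TriangleFree.

(** A matching with k edges would cover F; each of its edges, being a nonadjacent pair, lies inside
    A or inside B, so #|A| would be even. *)
Lemma odd_bipartite_unmatchable k F : #|F| = 2 * k -> odd_bipartite F -> ~ matchable k F.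
Proof.
move=> Fk [A [B [EF oA oB h]]] [M [/andP[/subsetP ME tM] Mk Mc]].
have M2 E : E \in M -> #|E| = 2 by move/ME; rewrite inE => /andP[/eqP].
have cM : #|cover M| = 2 * k.
  move/eqP: (tM) => <-; rewrite (eq_bigr (fun=> 2)) => [|E /M2 //].
  by rewrite sum_nat_const Mk mulnC.
have EM : cover M = F by apply/eqP; rewrite eqEcard Mc cM Fk leqnn.
suff : 2 %| #|A| by rewrite dvdn2 oA.
have -> : #|A| = \sum_(E in M) #|E :&: A|.
  have -> : #|A| = \sum_(x in cover M) (x \in A).
    rewrite EM EF -sum1_card big_mkcond [RHS]big_mkcond; apply: eq_bigr => x _.
    by rewrite inE; case: (x \in A); case: (x \in B).
  rewrite big_trivIset //=; apply: eq_bigr => E _.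
  rewrite -sum1_card big_mkcond [RHS]big_mkcond; apply: eq_bigr => x _.
  by rewrite inE; case: (x \in A); case: (x \in E).
apply: dvdn_sum => E EinM; have := ME _ EinM; rewrite inE => /andP[/cards2P [x [y [xy Exy]]] ED].
have nadj : ~~ adj D x y by rewrite /adj /= xy -Exy.
have inF z : z \in E -> (z \in A) || (z \in B).
  by move=> zE; rewrite -in_setU -EF -EM; apply/bigcupP; exists E.
have xF : (x \in A) || (x \in B) by apply: inF; rewrite Exy set21.
have yF : (y \in A) || (y \in B) by apply: inF; rewrite Exy set22.
have xyA : (x \in A) = (y \in A).
  case xA : (x \in A); case yA : (y \in A) => //.
    by move: nadj; rewrite h // -[y \in B]orFb -yA.
  by move: nadj; rewrite adj_sym h // -[x \in B]orFb -xA.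
case xA : (x \in A).
  by rewrite (setIidPl _) ?M2 // Exy subUset !sub1set -xyA xA.
suff -> : E :&: A = set0 by rewrite cards0.
by apply/setP => z; rewrite Exy !inE; apply/negP => /andP[/orP[]/eqP ->]; rewrite -?xyA xA.
Qed.

End Matchings.

(** * Squarefree powers as monomial ideals *)

Section MonomialIdeals.
Variables (K : fieldType) (n : nat).
Notation S := {mpoly K[n]}.
Implicit Types (G : S -> Prop) (m : 'X_{1..n}) (f g : S) (F : {set 'I_n}) (M : {set {set 'I_n}}).

Definition supp m : {set 'I_n} := [set i | m i != 0%N].

Lemma supp_chi (F : {set 'I_n}) : supp (chi F) = F.
Proof. by apply/setP => i; rewrite inE chiE; case: (i \in F). Qed.

Lemma suppS m m' : (m <= m')%MM -> supp m \subset supp m'.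
Proof.
move/mnm_lepP => h; apply/subsetP => i; rewrite !inE; have := h i; lia.
Qed.

Lemma chi_supp_le m : (chi (supp m) <= m)%MM.
Proof. by apply/mnm_lepP => i; rewrite chiE inE; lia. Qed.

Lemma mdeg_le m m' : (m <= m')%MM -> (mdeg m <= mdeg m')%N.
Proof. by move/submK <-; rewrite mdegD leq_addl. Qed.

Lemma lepm_mdeg_eq m m' : (m' <= m)%MM -> (mdeg m <= mdeg m')%N -> m' = m.
Proof.
move=> le; rewrite -{1}(submK le) mdegD => h.
have /eqP : mdeg (m - m')%MM == 0%N by clear -h; lia.
by move/eqP; rewrite mdeg_eq0 => /eqP E; rewrite -(submK le) E add0m.
Qed.

Lemma squarefree_chi m : squarefree m -> m = chi (supp m).
Proof. by move=> h; apply/mnmP => i; rewrite chiE inE; have := h i; case: (m i) => [|[]]. Qed.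

Lemma ideal_gen_in G g : G g -> ideal_gen G g.
Proof.
move=> Gg; exists [:: (1, g)]; rewrite big_seq1 mul1r; split => // q.
by rewrite inE => /eqP ->.
Qed.

Lemma ideal_genM G f g : ideal_gen G g -> ideal_gen G (f * g).
Proof.
move=> [s [hs ->]]; exists [seq (f * q.1, q.2) | q <- s]; split.
  by move=> q /mapP [q' /hs h ->].
by rewrite big_map mulr_sumr; apply: eq_bigr => q _; rewrite mulrA.
Qed.

Lemma ideal_genD G f g : ideal_gen G f -> ideal_gen G g -> ideal_gen G (f + g).
Proof.
move=> [s [hs ->]] [t [ht ->]]; exists (s ++ t); rewrite big_cat; split => // q.
by rewrite mem_cat => /orP[/hs|/ht].
Qed.

Lemma ideal_gen0 G : ideal_gen G 0.
Proof. by exists [::]; rewrite big_nil. Qed.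

Lemma ideal_gen_monomials G f :
  (forall m, m \in msupp f -> ideal_gen G 'X_[m]) -> ideal_gen G f.
Proof.
move=> h; rewrite [f]mpolyE big_seq; apply: (big_ind (ideal_gen G)).
- exact: ideal_gen0.
- by move=> ? ?; apply: ideal_genD.
- by move=> m /h hm; rewrite -mul_mpolyC; apply: ideal_genM.
Qed.

Lemma ideal_gen_msupp G f m : ideal_gen G f -> m \in msupp f ->
  exists g m', [/\ G g, m' \in msupp g & (m' <= m)%MM].
Proof.
move=> [s [hs ->]]; rewrite big_seq => /msuppD_sum [q /hs Gq].
move=> /msuppMP [m1 [m2 [_ h ->]]]; exists q.2, m2; split => //; exact: lem_addl.
Qed.

Lemma prod_varsE (F : {set 'I_n}) : \prod_(i in F) 'X_i = 'X_[chi F] :> S.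
Proof.
rewrite mprodXE; congr 'X_[_]; apply/mnmP => j; rewrite mnm_sumE chiE.
rewrite (eq_bigr (fun i => (i == j : nat))) => [|i _]; last by rewrite mnm1E.
rewrite big_mkcond (bigD1 j) //= big1 ?addn0; first by rewrite eqxx; case: (j \in F).
by move=> i /negPf ->; case: (i \in F).
Qed.

Section SquarefreePower.
Variables (D : {set {set 'I_n}}).
Hypotheses (D_complex : simplicial_complex D) (D_dim : complex_dim D = 1%R).
Notation I := (stanley_reisner K D).

Lemma face_card F : F \in D -> (#|F| <= 2)%N.
Proof.
move=> FD; have : (\max_(F in D) #|F|)%N = 2%N.
  move: D_dim; rewrite /complex_dim; move: (\max_(F in D) _)%N => a h.
  by clear -h; lia.
by move=> <-; apply: (leq_bigmax_cond _ FD).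
Qed.

Lemma small_face F : (forall x y, x \in F -> y \in F -> x != y -> adj D x y) ->
  (#|F| <= 2)%N -> F \in D.
Proof.
have [D0 D1 _] := D_complex.
move=> h; rewrite leq_eqVlt => /orP[/cards2P [x [y [xy EF]]]|].
  by have := h x y; rewrite EF set21 set22 xy /adj /= => /(_ isT isT isT) /andP[].
rewrite ltnS leq_eqVlt => /orP[/cards1P [x ->]|]; first exact: D1.
by rewrite ltnS leqn0 cards_eq0 => /eqP ->.
Qed.

Lemma stanley_reisner_msupp f m : I f -> m \in msupp f ->
  exists2 F : {set 'I_n}, F \notin D & F \subset supp m.
Proof.
move=> If /(ideal_gen_msupp If) [_ [m' [[F FD ->]]]].
rewrite prod_varsE => /mem_msuppXP <- /suppS; rewrite supp_chi => s.
by exists F.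
Qed.

(** A triangle is a nonface for dimension reasons, so its monomial is divisible by a monomial of
    degree 2 whose support contains a nonface; but any two vertices of a triangle form a face. *)
Lemma flag_triangle_free : flag K D -> triangle_free D.
Proof.
move=> [G G2 GI] x y z xy yz; apply/negP => xz.
have [D0 D1 Dsub] := D_complex.
have xNy : x != y by case/andP: xy.
have yNz : y != z by case/andP: yz.
have xNz : x != z by case/andP: xz.
pose F := x |: [set y; z].
have F3 : #|F| = 3%N by rewrite cardsU1 !inE negb_or xNy xNz cards2 yNz.
have FD : F \notin D by apply/negP => /face_card; rewrite F3.
have IF : I ('X_[chi F]) by apply: ideal_gen_in; exists F => //; rewrite prod_varsE.
have mF : chi F \in msupp ('X_[chi F] : S) by rewrite msuppX inE.
have [g [m [Gg mg mF']]] := ideal_gen_msupp ((GI _).1 IF) mF.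
have Ig : I g by apply/GI/ideal_gen_in.
have [F' F'D F'm] := stanley_reisner_msupp Ig mg.
case/negP: F'D; apply: small_face.
  have sub w : w \in F' -> w \in F.
    by move=> /(subsetP F'm) /(subsetP (suppS mF')); rewrite supp_chi.
  move=> a b /sub aF /sub bF; move: aF bF; rewrite !inE.
  case/or3P => /eqP -> /or3P[] /eqP ->; rewrite ?eqxx // => _; rewrite // adj_sym //.
apply: leq_trans (subset_leq_card F'm) _; rewrite -mdeg_chi.
apply: leq_trans (mdeg_le (chi_supp_le m)) _.
by have /dhomogP /(_ _ mg) -> := G2 _ Gg.
Qed.

Hypothesis no_triangle : triangle_free D.

Lemma nonface_edge F : F \notin D -> exists x y, [/\ x \in F, y \in F, x != y & ~~ adj D x y].
Proof.
move=> FD; have [/existsP [x /existsP [y /and4P[xF yF xy nxy]]]|none] :=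
  boolP [exists x, exists y, [&& x \in F, y \in F, x != y & ~~ adj D x y]].
  by exists x, y.
have all_adj a b : a \in F -> b \in F -> a != b -> adj D a b.
  move=> aF bF ab; apply: contraNT none => nab.
  by apply/existsP; exists a; apply/existsP; exists b; rewrite aF bF ab.
case/negP: FD; apply: small_face => //; rewrite leqNgt; apply/negP => F3.
have [x [y [xF yF xy]]] := card_ge2 (ltnW F3).
have [_ _ cF] := setD2_edge xF yF xy; rewrite cF !ltnS in F3.
have /card_gt0P [z] := F3; rewrite !inE => /and3P[zy zx zF].
have := no_triangle (all_adj _ _ xF yF xy) (all_adj _ _ yF zF _).
by rewrite eq_sym zy all_adj // ?[x == z]eq_sym // => /(_ isT).
Qed.

Lemma stanley_reisner_edge f m : I f -> m \in msupp f ->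
  exists x y, [/\ x \in supp m, y \in supp m, x != y & ~~ adj D x y].
Proof.
move=> If mf; have [F FD /subsetP sF] := stanley_reisner_msupp If mf.
by have [x [y [xF yF xy nxy]]] := nonface_edge FD; exists x, y; split; rewrite ?sF.
Qed.

Lemma supp_card_le m : (#|supp m| <= mdeg m)%N.
Proof. by rewrite -mdeg_chi mdeg_le // chi_supp_le. Qed.

Lemma msupp_prod_deg (J : Type) (r : seq J) (g : J -> S) m : (forall j, I (g j)) ->
  m \in msupp (\prod_(j <- r) g j) -> (2 * size r <= mdeg m)%N.
Proof.
move=> Ig; elim: r m => [|j r IH] m; first by rewrite muln0.
rewrite big_cons => /msuppMP [m1 [m2 [h1 /IH h2 ->]]].
have [x [y [xm ym xy _]]] := stanley_reisner_edge (Ig j) h1.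
suff : (2 <= mdeg m1)%N by rewrite mdegD /=; move: h2; clear; lia.
apply: leq_trans (supp_card_le m1); have <- : #|[set x; y]| = 2%N by rewrite cards2 xy.
by apply: subset_leq_card; rewrite subUset !sub1set xm ym.
Qed.

(** In a squarefree product the factors have disjoint supports, and each contributes a nonadjacent
    pair. *)
Lemma msupp_prod_matchable (J : Type) (r : seq J) (g : J -> S) m : (forall j, I (g j)) ->
  m \in msupp (\prod_(j <- r) g j) -> squarefree m -> matchable D (size r) (supp m).
Proof.
move=> Ig; elim: r m => [|j r IH] m; first by move=> _ _; apply: matchable0.
rewrite big_cons => /msuppMP [m1 [m2 [h1 h2 ->]]] sq.
have sq2 : squarefree m2 by move=> i; have := sq i; rewrite mnmDE; lia.
have [x [y [xm ym xy nxy]]] := stanley_reisner_edge (Ig j) h1.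
have -> : supp (m1 + m2)%MM = supp m1 :|: supp m2.
  by apply/setP => i; rewrite !inE mnmDE addn_eq0 negb_and.
rewrite -[size _]add1n; apply: matchableU (IH _ h2 sq2) _.
  apply: matchable_sub (matchable_edge xy nxy).
  by rewrite subUset !sub1set xm ym.
rewrite -setI_eq0; apply/eqP/setP => i; rewrite !inE.
by have := sq i; rewrite mnmDE; lia.
Qed.

Variable p : nat.

Lemma size_index_ord : size (index_enum 'I_p) = p.
Proof. by rewrite [index_enum _]unlock -enumT size_enum_ord. Qed.

Lemma ideal_pow_deg m : ideal_pow I p 'X_[m] -> (2 * p <= mdeg m)%N.
Proof.
move=> h; have mm : m \in msupp ('X_[m] : S) by rewrite msuppX inE.
have [_ [m' [[g Ig ->] h' le]]] := ideal_gen_msupp h mm.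
apply: leq_trans (mdeg_le le); have := msupp_prod_deg Ig h'.
by rewrite size_index_ord.
Qed.

Lemma ideal_pow_matchable m : ideal_pow I p 'X_[m] -> squarefree m -> matchable D p (supp m).
Proof.
move=> h sq; have mm : m \in msupp ('X_[m] : S) by rewrite msuppX inE.
have [_ [m' [[g Ig ->] h' le]]] := ideal_gen_msupp h mm.
have sq' : squarefree m'.
  by move=> i; apply: leq_trans (sq i); move/mnm_lepP: le.
apply: matchable_sub (suppS le) _; have := msupp_prod_matchable Ig h' sq'.
by rewrite size_index_ord.
Qed.

Lemma cover_card M : matching (compl_edges D) M -> #|cover M| = (2 * #|M|)%N.
Proof.
move=> /andP[/subsetP ME /eqP <-]; rewrite (eq_bigr (fun=> 2%N)) => [|E /ME].
  by rewrite sum_nat_const mulnC.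
by rewrite inE => /andP[/eqP].
Qed.

Lemma matching_monomial M : matching (compl_edges D) M -> #|M| = p ->
  min_monomial_gen (ideal_pow I p) (chi (cover M)).
Proof.
move=> mM Mp; have /andP[/subsetP ME tM] := mM; split; last first.
  move=> m' /ideal_pow_deg le h; apply: lepm_mdeg_eq => //.
  by rewrite mdeg_chi cover_card // Mp.
subst p; apply: ideal_gen_in; exists (fun i => 'X_[chi (enum_val i)]).
  move=> i; have := ME _ (enum_valP i); rewrite inE => /andP[_ ED].
  by apply: ideal_gen_in; exists (enum_val i); rewrite ?prod_varsE.
rewrite -(big_enum_val (fun E => 'X_[chi E])) /= mprodXE; congr 'X_[_].
apply/mnmP => i; rewrite mnm_sumE chiE.
transitivity (\sum_(x in cover M) (x == i : nat))%N.
  rewrite big_mkcond (bigD1 i) //= big1 ?addn0; first by rewrite eqxx; case: (i \in _).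
  by move=> x /negPf ->; case: (x \in _).
rewrite big_trivIset //=; apply: eq_bigr => E _; rewrite chiE.
rewrite big_mkcond (bigD1 i) //= big1 ?addn0; first by rewrite eqxx; case: (i \in _).
by move=> x /negPf ->; case: (x \in _).
Qed.

(** Membership depends only on the supports of the monomials; the homology is computed from this
    description alone. *)
Theorem squarefree_powerP f :
  squarefree_power I p f <-> forall m, m \in msupp f -> matchable D p (supp m).
Proof.
split=> [If m /(ideal_gen_msupp If) [_ [m' [[m0 [[h _] sq ->]]]]] |h].
  move=> /mem_msuppXP <- le; apply: matchable_sub (suppS le) _.
  exact: ideal_pow_matchable.
apply: ideal_gen_monomials => m /h [M [mM Mp sM]].
have le : (chi (cover M) <= m)%MM.
  apply: lepm_trans (chi_supp_le m); apply/mnm_lepP => i; rewrite !chiE.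
  by case: (boolP (i \in cover M)) => // /(subsetP sM) ->.
rewrite -(submK le) mpolyXD; apply: ideal_genM; apply: ideal_gen_in.
exists (chi (cover M)); split => //; first exact: matching_monomial.
by move=> i; rewrite chiE; case: (_ \in _).
Qed.

End SquarefreePower.
End MonomialIdeals.

(** * Crowns from supports of cycles *)

Section Crowns.
Local Open Scope nat_scope.
Variables (n : nat) (D : {set {set 'I_n}}).
Implicit Types (A B F W : {set 'I_n}).
Notation e := (adj D).
Hypothesis no_triangle : triangle_free D.

Lemma common_neighbor x y z : e x z -> e y z -> e x y = false.
Proof. by move=> xz yz; apply/negbTE/(no_triangle (y := z)); rewrite // adj_sym. Qed.

Section CrownCriterion.
Variables (J : finType) (u v : J -> 'I_n) (W : {set 'I_n}).
Hypothesis J3 : 3 <= #|J|.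
Hypothesis uv : forall i j, e (u i) (v j) = (i != j).

Lemma crown_injl : injective u.
Proof. by move=> i j E; apply/eqP; rewrite -[_ == _]negbK -uv E uv eqxx. Qed.

Lemma crown_injr : injective v.
Proof. by move=> i j E; apply/eqP; rewrite -[_ == _]negbK -uv -E uv eqxx. Qed.

(** With at least three indices, any two vertices of one side have a common neighbour, so
    triangle-freeness forces the remaining nonadjacencies of the crown. *)
Lemma third_index (i j : J) : exists k, (k != i) && (k != j).
Proof.
have /card_gt0P [k] : 0 < #|~: [set i; j]|.
  by rewrite cardsCs setCK cards2; case: (_ != _); lia.
by rewrite !inE negb_or => h; exists k.
Qed.

Lemma crown_indepl i j : e (u i) (u j) = false.
Proof.
have [k /andP[ki kj]] := third_index i j.
by apply: (common_neighbor (z := v k)); rewrite uv eq_sym.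
Qed.

Lemma crown_indepr i j : e (v i) (v j) = false.
Proof.
have [k /andP[ki kj]] := third_index i j.
by apply: (common_neighbor (z := u k)); rewrite adj_sym uv.
Qed.

Lemma crown_disjoint i j : u i != v j.
Proof.
have [k /andP[ki kj]] := third_index i j; apply/eqP => E.
by have := crown_indepl k i; rewrite E uv kj.
Qed.

Lemma crown_induced m : (forall i, u i \in W) -> (forall i, v i \in W) ->
  m = #|J| -> #|W| = 2 * m -> induced_iso (@crown m) D W.
Proof.
move=> uW vW Em Wm; pose phi i : J := enum_val (cast_ord Em i).
have phi_inj : injective phi by move=> i j /enum_val_inj /cast_ord_inj.
pose f : {ffun 'I_m + 'I_m -> 'I_n} :=
  [ffun x => match x with inl i => u (phi i) | inr i => v (phi i) end].
have f_inj : injective f.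
  move=> [i|i] [j|j]; rewrite !ffunE.
  - by move/crown_injl/phi_inj ->.
  - by move=> E; have := crown_disjoint (phi i) (phi j); rewrite E eqxx.
  - by move=> E; have := crown_disjoint (phi j) (phi i); rewrite E eqxx.
  - by move/crown_injr/phi_inj ->.
apply/existsP; exists f; apply/and3P; split; first exact/injectiveP.
  rewrite eqEcard card_imset // card_sum card_ord Wm mul2n addnn leqnn andbT.
  by apply/subsetP => _ /imsetP [[i|i] _ ->]; rewrite ffunE.
apply/forallP => -[i|i]; apply/forallP => -[j|j]; rewrite !ffunE /=.
- by rewrite crown_indepl.
- by rewrite uv (inj_eq phi_inj).
- by rewrite adj_sym uv (inj_eq phi_inj) [j == i]eq_sym.
- by rewrite crown_indepr.
Qed.

End CrownCriterion.

(* The supports of nonzero cycles in the degree 2p - 1 homology satisfy these two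
   closure properties; everything about such cycles is derived from them. *)
Section Supports.
Variables (p : nat) (W : {set 'I_n}) (nz : {set 'I_n} -> Prop).
Hypothesis p_ge2 : 2 <= p.
Hypothesis W_card : #|W| = 4 * p + 2.
Hypothesis nz_face : forall F, nz F -> [/\ F \subset W, #|F| = 2 * p & odd_bipartite D F].
Hypothesis nz_swap : forall F x, nz F -> x \in F ->
  exists2 y, y \in W :\: F & nz (y |: (F :\ x)).

Definition nz_pair A B := [/\ nz (A :|: B), complete_between D A B, odd #|A| & odd #|B|].

Lemma nz_pair_sym A B : nz_pair A B -> nz_pair B A.
Proof. by case=> h1 h2 h3 h4; split=> //; [rewrite setUC | apply: complete_between_sym]. Qed.

Lemma nz_pair_card A B : nz_pair A B -> #|A| + #|B| = 2 * p.
Proof. by case=> /nz_face [_ <- _] h _ _; rewrite -(complete_between_card h). Qed.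

Lemma nz_pair_sub A B x : nz_pair A B -> (x \in A) || (x \in B) -> x \in W.
Proof. by case=> /nz_face [/subsetP s _ _] _ _ _ h; apply: s; rewrite inE. Qed.

(** The new bipartition must extend the old one: no vertex of A or of B - x can change sides without
    closing a triangle, and [y] on the side of A would make that side even. *)
Lemma nz_swapr A B x : nz_pair A B -> x \in B ->
  exists y, [/\ y \in W, y \notin A, y \notin B, forall a, a \in A -> e a y
    & nz_pair A (y |: (B :\ x))].
Proof.
move=> [nzAB h oA oB] xB.
have xA : x \notin A by apply: complete_between_disjoint (complete_between_sym h) xB.
have [|y] := nz_swap nzAB (x := x); first by rewrite inE xB orbT.
rewrite !inE negb_or -andbA => /and3P[yA yB yW] nz'.
have EF : y |: ((A :|: B) :\ x) = A :|: (y |: (B :\ x)).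
  apply/setP => z; rewrite !inE; case: (z =P y) => [->|_]; rewrite ?orbT //=.
  by case: (z =P x) => [->|]; rewrite ?(negPf xA).
rewrite EF in nz'; have [_ _ [A' [B' [EF']]]] := nz_face nz'.
have [a0 a0A] := odd_gt0_ex oA.
wlog a0A' : A' B' EF' / a0 \in A'.
  move=> wl oA' oB' h'.
  have : a0 \in A' :|: B' by rewrite -EF' inE a0A.
  rewrite inE => /orP[a0A'|a0B']; first exact: (wl A' B').
  by apply: (wl B' A') => //; [rewrite EF' setUC | apply: complete_between_sym].
move=> oA' oB' h'.
have in' z : (z \in A) || (z == y) || (z \in B :\ x) = (z \in A') || (z \in B').
  by move/setP: EF' => /(_ z); rewrite !inE -orbA.
have disj z : z \in A' -> z \notin B' by apply: complete_between_disjoint h'.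
have AA' a : a \in A -> a \in A'.
  move=> aA; have := in' a; rewrite aA => /esym /orP[//|aB'].
  by have := h' a0 a a0A' aB'; rewrite (common_neighbor (z := x)) // h.
have BB' b : b \in B :\ x -> b \in B'.
  move=> bB; have := in' b; rewrite bB !orbT => /esym /orP[bA'|//].
  have [b' b'B'] := odd_gt0_ex oB'.
  have bB1 : b \in B by move: bB; rewrite inE => /andP[].
  by have := h a0 b a0A bB1; rewrite (common_neighbor (z := b')) // h'.
have yB' : y \in B'.
  have := in' y; rewrite eqxx orbT => /esym /orP[yA'|//].
  have EA' : A' = y |: A.
    apply/setP => z; rewrite !inE; apply/idP/orP => [zA'|[/eqP ->|/AA']//].
    have := in' z; rewrite zA' /= => /orP[/orP[zA|zy]|/BB']; [by right | by left |].
    by rewrite (negPf (disj _ zA')).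
  by move: oA'; rewrite EA' cardsU1 yA /= oA.
have EA : A' = A.
  apply/setP => z; apply/idP/idP => [zA'|/AA'//].
  have := in' z; rewrite zA' /= => /orP[/orP[//|/eqP zy]|/BB'].
    by have := disj _ zA'; rewrite zy yB'.
  by rewrite (negPf (disj _ zA')).
have EB : B' = y |: (B :\ x).
  apply/setP => z; rewrite !inE; apply/idP/idP => [zB'|/orP[/eqP -> //|]]; last first.
    by move=> hz; apply: BB'; rewrite !inE.
  have := in' z; rewrite zB' orbT !inE => /orP[/orP[zA|->//]|->]; rewrite ?orbT //.
  by rewrite -EA in zA; rewrite (negPf (disj _ zA)) in zB'.
exists y; split => //; first by move=> a aA; apply: h' => //; rewrite EA.
by subst A' B'; split; rewrite -?EF'.
Qed.

Lemma nz_swapl A B x : nz_pair A B -> x \in A ->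
  exists y, [/\ y \in W, y \notin A, y \notin B, forall b, b \in B -> e y b
    & nz_pair (y |: (A :\ x)) B].
Proof.
move=> /nz_pair_sym g xA; have [y [h1 h2 h3 h4 h5]] := nz_swapr g xA.
exists y; split=> //; last exact: nz_pair_sym.
by move=> b bB; rewrite adj_sym h4.
Qed.

Hypothesis no_even_bipartite : forall A B, complete_between D A B ->
  ~~ odd #|A| -> ~~ odd #|B| -> 2 <= #|A| -> 2 <= #|B| -> #|A| + #|B| = 2 * p + 2 -> False.

(** Otherwise adding [x] to A and [y] to B would give complete even parts on 2p + 2 vertices. *)
Lemma nz_outer_nonadj A B x y : nz_pair A B ->
  x \notin A -> (forall b, b \in B -> e x b) ->
  y \notin B -> (forall a, a \in A -> e a y) -> e x y = false.
Proof.
move=> g xA xB yB yA; apply/negP => xy; have cAB := nz_pair_card g.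
have [_ h oA oB] := g.
apply: (@no_even_bipartite (x |: A) (y |: B)); rewrite ?cardsU1 ?xA ?yB /= ?negbK //;
  rewrite ?add1n ?ltnS ?odd_gt0 // ?addSn ?addnS ?cAB ?addn0 //.
move=> a b; rewrite !inE => /orP[/eqP ->|aA] /orP[/eqP ->|bB] //.
- exact: xB.
- exact: yA.
- exact: h.
Qed.

Definition outer_partner A B x hx := exists y,
  [/\ [/\ hx \in W, hx \notin A, e hx x = false
      & forall b, b \in B -> b != x -> e hx b],
    [/\ y \in W, y \notin B, forall a, a \in A -> e a y & e hx y]
    & nz_pair A (y |: (B :\ x))].

(** Replace [x] by [y] in B, then a vertex of A by [hx], which is joined to [y] and to B - x. Both
    [x] and [hx] are outer vertices of the intermediate pair, hence not adjacent. *)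
Lemma nz_partner A B x : nz_pair A B -> x \in B -> exists hx, outer_partner A B x hx.
Proof.
move=> g xB; have [_ h oA oB] := g.
have [y [yW yA yB ya g']] := nz_swapr g xB.
have [a0 a0A] := odd_gt0_ex oA.
have [hx [hW hA hB hadj _]] := nz_swapl g' a0A.
exists hx, y; split=> //; split=> //.
- apply: (nz_outer_nonadj g') => //.
    by rewrite !inE eqxx orbF; apply: contraNneq yB => <-.
  by move=> a aA; apply: h.
- by move=> b bB bx; apply: hadj; rewrite !inE bx bB orbT.
- by apply: hadj; rewrite !inE eqxx.
Qed.

(** A count: A, the partners [h] of B and [x0] form one side; B, the partners [g] of A and [y0] the
    other. The sides are disjoint with #|A| + #|B| + 1 = 2p + 1 vertices each, so they exhaust the
    4p + 2 vertices of W, which also makes [x0] and [y0] unique. *)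
Lemma nz_structure A B : nz_pair A B -> 1 < #|B| ->
  exists (h g : 'I_n -> 'I_n) (y0 x0 : 'I_n),
  [/\ [/\ y0 \in W, y0 \notin B, forall a, a \in A -> e a y0
        & forall y, y \in W -> y \notin B -> (forall a, a \in A -> e a y) -> y = y0],
      [/\ x0 \in W, x0 \notin A, forall b, b \in B -> e x0 b
        & forall x, x \in W -> x \notin A -> (forall b, b \in B -> e x b) -> x = x0],
      forall x, x \in B -> [/\ h x \in W, e (h x) x = false,
        forall b, b \in B -> b != x -> e (h x) b, e (h x) y0 & nz_pair A (y0 |: (B :\ x))],
      forall a, a \in A -> [/\ g a \in W, e (g a) a = false,
        forall b, b \in A -> b != a -> e (g a) b & e (g a) x0]
    & forall w, w \in W -> (w \in A) \/ (exists2 x, x \in B & w = h x) \/ w = x0 \/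
        (w \in B) \/ (exists2 a, a \in A & w = g a) \/ w = y0].
Proof.
move=> gAB B2; have [_ cAB oA oB] := gAB; have cardAB := nz_pair_card gAB.
have [a0 a0A] := odd_gt0_ex oA; have [b0 b0B] := odd_gt0_ex oB.
have [y0 [y0W y0A y0B y0adj _]] := nz_swapr gAB b0B.
have [x0 [x0W x0A x0B x0adj _]] := nz_swapl gAB a0A.
have partners A' B' : nz_pair A' B' -> exists h : 'I_n -> 'I_n,
    forall x, x \in B' -> outer_partner A' B' x (h x).
  move=> gAB'; apply: (@fin_all_exists _ (fun=> 'I_n)
    (fun x hx => x \in B' -> outer_partner A' B' x hx)) => x.
  have [xB|_] := boolP (x \in B'); last by exists x.
  by have [hx H] := nz_partner gAB' xB; exists hx.
have [h hP] := partners _ _ gAB; have [g gP] := partners _ _ (nz_pair_sym gAB).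
have hadj x b : x \in B -> b \in B -> e (h x) b = (b != x).
  move=> xB bB; have [y [[_ _ hxx hxb] _ _]] := hP _ xB.
  by case: eqP => [->//|/eqP /hxb ->].
have gadj x b : x \in A -> b \in A -> e (g x) b = (b != x).
  move=> xA bA; have [y [[_ _ hxx hxb] _ _]] := gP _ xA.
  by case: eqP => [->//|/eqP /hxb ->].
(* This is where [1 < #|B|] enters: each [h x] has a neighbour in B, which keeps L and R
   disjoint. *)
have other x : x \in B -> exists2 b, b \in B & b != x.
  move=> xB; have /card_gt0P [b] : 0 < #|B :\ x| by rewrite (cardsD1 x) xB add1n ltnS in B2.
  by rewrite !inE => /andP[bx bB]; exists b.
pose L := x0 |: (A :|: h @: B); pose R := y0 |: (B :|: g @: A).
have L_adj w : w \in L -> exists2 b, b \in B & e w b.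
  rewrite !inE => /or3P[/eqP->|wA|/imsetP [x xB ->]].
  - by exists b0 => //; apply: x0adj.
  - by exists b0 => //; apply: cAB.
  - by have [b bB bx] := other _ xB; exists b; rewrite ?hadj.
have L_A w a : w \in L -> a \in A -> e w a = false.
  move=> wL aA; have [y wy ya] : exists2 y, e w y & e a y.
    move: wL; rewrite !inE => /or3P[/eqP->|wA|/imsetP [x xB ->]].
    - by exists b0; [apply: x0adj | apply: cAB].
    - by exists b0; apply: cAB.
    - by have [y [_ [_ _ ya hy] _]] := hP _ xB; exists y => //; apply: ya.
  exact: common_neighbor wy ya.
have R_B w b : w \in R -> b \in B -> e w b = false.
  move=> wR bB; have [y wy yb] : exists2 y, e w y & e b y.
    move: wR; rewrite !inE => /or3P[/eqP->|wB|/imsetP [x xA ->]].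
    - by exists a0; rewrite adj_sym; [apply: y0adj | apply: cAB].
    - by exists a0; rewrite adj_sym; apply: cAB.
    - by have [y [_ [_ _ ya hy] _]] := gP _ xA; exists y => //; apply: ya.
  exact: common_neighbor wy yb.
have LR : L :&: R = set0.
  apply/setP => w; rewrite in_setI in_set0; apply/negP => /andP[/L_adj [b bB wb] wR].
  by rewrite R_B in wb.
have h_inj : {in B &, injective h}.
  move=> x y xB yB E; apply/eqP; rewrite -[_ == _]negbK -(hadj y) // -E hadj ?eqxx //.
have g_inj : {in A &, injective g}.
  move=> x y xB yB E; apply/eqP; rewrite -[_ == _]negbK -(gadj y) // -E gadj ?eqxx //.
have cL : #|L| = #|A| + #|B| + 1.
  rewrite /L cardsU1 cardsU card_in_imset // [A :&: _](_ : _ = set0); last first.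
    apply/setP => w; rewrite !inE; apply/negP => /andP[wA /imsetP [x xB E]].
    by have := cAB _ _ wA xB; rewrite E hadj // eqxx.
  rewrite cards0 subn0 inE negb_or x0A /= [X in (~~ X)](_ : _ = false); first by rewrite addnC.
  by apply/negP => /imsetP [x xB E]; have := x0adj _ xB; rewrite E hadj // eqxx.
have cR : #|R| = #|A| + #|B| + 1.
  rewrite /R cardsU1 cardsU card_in_imset // [B :&: _](_ : _ = set0); last first.
    apply/setP => w; rewrite !inE; apply/negP => /andP[wB /imsetP [x xA E]].
    by have := cAB _ _ xA wB; rewrite adj_sym E gadj // eqxx.
  rewrite cards0 subn0 inE negb_or y0B /= [X in (~~ X)](_ : _ = false); first by rewrite addnC [#|B| + _]addnC.
  by apply/negP => /imsetP [x xA E]; have := y0adj _ xA; rewrite adj_sym E gadj // eqxx.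
have WE : L :|: R = W.
  apply/eqP; rewrite eqEcard cardsU LR cards0 subn0 cL cR W_card cardAB.
  rewrite (_ : _ <= _); last by clear; lia.
  rewrite andbT; apply/subsetP => w; rewrite !inE.
  case/orP => [/or3P[/eqP->|wA|/imsetP [x xB ->]] | /or3P[/eqP->|wB|/imsetP [x xA ->]]] //.
  - by apply: (nz_pair_sub gAB); rewrite wA.
  - by have [y [[]]] := hP _ xB.
  - by apply: (nz_pair_sub gAB); rewrite wB orbT.
  - by have [y [[]]] := gP _ xA.
have uniqR y : y \in W -> y \notin B -> (forall a, a \in A -> e a y) -> y = y0.
  move=> yW yB ya; move: yW; rewrite -WE inE => /orP[yL|].
    by have := ya _ a0A; rewrite adj_sym L_A.
  rewrite !inE => /or3P[/eqP //|yB'|/imsetP [a aA E]]; first by rewrite yB' in yB.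
  by have := ya _ aA; rewrite adj_sym E gadj // eqxx.
have uniqL x : x \in W -> x \notin A -> (forall b, b \in B -> e x b) -> x = x0.
  move=> xW xA xb; move: xW; rewrite -WE inE orbC => /orP[xR|].
    by have := xb _ b0B; rewrite R_B.
  rewrite !inE => /or3P[/eqP //|xA'|/imsetP [b bB E]]; first by rewrite xA' in xA.
  by have := xb _ bB; rewrite E hadj // eqxx.
exists h, g, y0, x0; split=> //.
- move=> x xB; have [y [[h1 h2 h3 h4] [yW yB ya hy] g']] := hP _ xB.
  by rewrite -(uniqR y).
- move=> x xA; have [y [[h1 h2 h3 h4] [yW yA yb hy] g']] := gP _ xA.
  rewrite -(uniqL y) // => b bB; rewrite adj_sym; exact: yb.
- move=> w; rewrite -WE !inE => /orP[|] /or3P[/eqP->|wA|/imsetP [x xB ->]]; try tauto.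
  + by right; left; exists x.
  + by do 4 right; left; exists x.
Qed.

(** What [nz_structure] leaves open is that partners [h x] and [g a] from different parts are
    adjacent; this follows from the structure of a neighbouring pair. *)
Lemma nz_crown F : nz F -> induced_iso (@crown (2 * p + 1)) D W.
Proof.
move=> nzF; have [_ Fp [A [B [EF oA oB cAB]]]] := nz_face nzF.
have {nzF EF} : nz_pair A B by split => //; rewrite -EF.
(* The larger part has at least p >= 2 vertices, as [nz_structure] requires. *)
wlog leAB : A B oA oB cAB / #|A| <= #|B|.
  move=> wl gAB; have [le|lt] := leqP #|A| #|B|; first exact: (wl A B).
  by apply: (wl B A) => //; [apply: complete_between_sym | apply: ltnW | apply: nz_pair_sym].
move=> gAB; have cardAB := nz_pair_card gAB.
have B2 : 1 < #|B| by lia.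
have [h [g [y0 [x0 [[y0W y0B y0A uniqR] [x0W x0A x0B uniqL] hP gP WP]]]]] := nz_structure gAB B2.
have hg x a : x \in B -> a \in A -> e (h x) (g a).
  move=> xB aA; have [hW hx hb hy gAB1] := hP _ xB.
  set B1 := y0 |: (B :\ x) in gAB1.
  have B1card : #|B1| = #|B|.
    by rewrite /B1 cardsU1 !inE negb_and y0B orbT (cardsD1 x B) xB.
  have [h1 [g1 [y1 [x1 [_ [_ _ _ uniqL1] _ _ _]]]]] := nz_structure gAB1 (etrans (congr1 _ B1card) B2).
  have hA : h x \notin A by apply/negP => hA; have := cAB _ _ hA xB; rewrite hx.
  have hB1 b : b \in B1 -> e (h x) b.
    by rewrite !inE => /orP[/eqP -> //|/andP[bx bB]]; apply: hb.
  (* The vertex entering for [a] is joined to all of [B1], as [h x] is, so they coincide by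
     uniqueness. Exchanging [y0] next yields a vertex [y] joined to [h x] and to A - a; among the
     vertices of W only [g a] fits. *)
  have [w [wW wA wB1 wadj g2]] := nz_swapl gAB1 aA.
  have wh : w = h x by rewrite (uniqL1 w) // (uniqL1 (h x)).
  rewrite {w}wh in wW wA wB1 wadj g2.
  have y0B1 : y0 \in B1 by rewrite !inE eqxx.
  have [y [yW yA2 yB1 yadj _]] := nz_swapr g2 y0B1.
  have hy' : e (h x) y by apply: yadj; rewrite !inE eqxx.
  have yA' c : c \in A -> c != a -> e c y by move=> cA ca; apply: yadj; rewrite !inE ca cA orbT.
  have [b bB bx] : exists2 b, b \in B & b != x.
    have /card_gt0P [b] : 0 < #|B :\ x| by rewrite (cardsD1 x) xB add1n ltnS in B2.
    by rewrite !inE => /andP[bx bB]; exists b.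
  have [yA|[[x2 x2B E]|[E|[yB|[[a2 a2A E]|E]]]]] := WP _ yW.
  - by move: hy'; rewrite (common_neighbor (z := y0)) //; apply: y0A.
  - by move: hy'; rewrite E (common_neighbor (z := y0)) //; have [] := hP _ x2B.
  - by move: hy'; rewrite E (common_neighbor (z := b)) //; [apply: hb | apply: x0B].
  - move: yB1; rewrite !inE yB andbT negb_or negbK => /andP[_ /eqP E].
    by move: hy'; rewrite E hx.
  - have [a2a|a2a] := eqVneq a2 a; first by rewrite -a2a -E.
    have [_ ga _ _] := gP _ a2A.
    by have := yA' _ a2A a2a; rewrite E adj_sym ga.
  - by move: yB1; rewrite E y0B1.
(* One index for each vertex of A and B together with its partner, and [None] for the pair x0, y0:
   2p + 1 in all. *)
pose J := option {x | x \in A :|: B}.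
pose u (j : J) := if j is Some (exist x _) then if x \in A then x else h x else x0.
pose v (j : J) := if j is Some (exist x _) then if x \in A then g x else x else y0.
have inB x : x \in A :|: B -> x \in A = false -> x \in B by rewrite inE => + E; rewrite E.
have cJ : 2 * p + 1 = #|{: J}|.
  rewrite card_option card_sig (eq_card (B := mem (A :|: B))) //.
  by rewrite (complete_between_card cAB) cardAB addn1.
have disB x : x \in A -> x \notin B by apply: complete_between_disjoint cAB.
apply: (@crown_induced J u v W) => //; rewrite -?cJ ?W_card.
- by clear - p_ge2; lia.
- move=> [[x xAB]|] [[y yAB]|] /=.
  + have -> : (Some (exist _ x xAB) != Some (exist _ y yAB) :> J) = (x != y) by [].
    case: ifP => xA; case: ifP => yA.
    * have [_ gyy gyb _] := gP _ yA; rewrite adj_sym.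
      by case: eqP => [->//|/eqP xy]; rewrite gyb.
    * rewrite cAB ?inB //; apply/esym; apply: contraFneq yA => <- //.
    * rewrite hg ?inB //; apply/esym; apply: contraFneq xA => -> //.
    * have [_ hxx hxb _ _] := hP _ (inB _ xAB xA).
      by case: eqP => [<-//|/eqP xy]; rewrite hxb ?inB // eq_sym.
  + by case: ifP => xA; [apply: y0A | have [] := hP _ (inB _ xAB xA)].
  + case: ifP => yA; first by rewrite adj_sym; have [] := gP _ yA.
    by rewrite x0B ?inB.
  + exact: (nz_outer_nonadj gAB).
- move=> [[x xAB]|] //=; case: ifP => xA; first by apply: (nz_pair_sub gAB); rewrite xA.
  by have [] := hP _ (inB _ xAB xA).
- move=> [[x xAB]|] //=; case: ifP => xA; first by have [] := gP _ xA.
  by apply: (nz_pair_sub gAB); rewrite inB ?orbT.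
- by clear; lia.
Qed.

End Supports.
End Crowns.

(** * Exchange moves between the faces of a crown *)

Lemma imset_setD1 (T U : finType) (f : T -> U) (A : {set T}) x :
  injective f -> f @: (A :\ x) = (f @: A) :\ f x.
Proof.
move=> f_inj; apply/setP => y; rewrite !inE; apply/imsetP/andP.
  by case=> z /setD1P [zx zA] ->; rewrite inj_eq // zx imset_f.
by case=> yx /imsetP [z zA Ey]; exists z; rewrite // !inE zA andbT -(inj_eq f_inj) -Ey.
Qed.

Section CrownFaces.
Local Open Scope nat_scope.
Variables (n : nat) (D : {set {set 'I_n}}).
Hypothesis no_triangle : triangle_free D.
Variables (p : nat) (W : {set 'I_n}) (nz : {set 'I_n} -> Prop).
Hypothesis p_ge2 : 2 <= p.
Hypothesis nz_face : forall F, nz F -> [/\ F \subset W, #|F| = 2 * p & odd_bipartite D F].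
Hypothesis nz_swap : forall F x, nz F -> x \in F ->
  exists2 y, y \in W :\: F & nz (y |: (F :\ x)).
Notation e := (adj D).
Notation idx := 'I_(2 * p + 1).
Implicit Types (I J : {set idx}).

Lemma idx_ge3 : 3 <= #|{: idx}|.
Proof. by rewrite card_ord; clear - p_ge2; lia. Qed.

Definition crown_coords (u v : idx -> 'I_n) : Prop :=
  (forall i j, e (u i) (v j) = (i != j)) /\
  (forall w, w \in W -> exists i, w = u i \/ w = v i).

Lemma crown_coords_sym u v : crown_coords u v -> crown_coords v u.
Proof.
move=> [h1 h2]; split=> [i j|w /h2 [i [h|h]]]; first by rewrite adj_sym h1 eq_sym.
  by exists i; right.
by exists i; left.
Qed.

Definition index_pair (u v : idx -> 'I_n) I J : Prop := nz_pair D nz (u @: I) (v @: J).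

Lemma index_pair_sym u v I J : index_pair u v I J -> index_pair v u J I.
Proof. exact: nz_pair_sym. Qed.

Section Coordinates.
Variables (u v : idx -> 'I_n).
Hypothesis uv : crown_coords u v.
Let u_inj : injective u := crown_injl uv.1.
Let v_inj : injective v := crown_injr uv.1.

Lemma index_pair_disjoint I J i : index_pair u v I J -> i \in I -> i \notin J.
Proof.
move=> [_ h _ _] iI; apply/negP => iJ.
by have := h (u i) (v i) (imset_f _ iI) (imset_f _ iJ); rewrite uv.1 eqxx.
Qed.

Lemma index_pair_card I J : index_pair u v I J -> #|I| + #|J| = 2 * p.
Proof. by move/(nz_pair_card nz_face); rewrite !card_imset. Qed.

Lemma index_pair_missing I J : index_pair u v I J -> exists m, ~: (I :|: J) = [set m].
Proof.
move=> g; apply/cards1P; rewrite cardsCs setCK card_ord cardsU.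
rewrite [I :&: J](_ : _ = set0) ?cards0; last first.
  apply/setP => i; rewrite !inE; apply/negP => /andP[/(index_pair_disjoint g)].
  by move=> /negPf ->.
by rewrite (index_pair_card g) subn0 addKn.
Qed.

(** The entering vertex is joined to all of [u @: I]; this excludes the left vertices and the [v i]
    with [i] in I, so only the missing index remains. *)
Lemma index_pair_mover I J m j : index_pair u v I J -> ~: (I :|: J) = [set m] -> j \in J ->
  index_pair u v I (m |: (J :\ j)).
Proof.
move=> g Em jJ; have [y [yW yI yJ ya g']] := nz_swapr no_triangle nz_face nz_swap g (imset_f v jJ).
have [_ h oI _] := g; have [_ /imsetP [i0 i0I _]] := odd_gt0_ex oI.
have := ya _ (imset_f u i0I); have [i [E|E]] := uv.2 _ yW; rewrite E.
  by rewrite (crown_indepl no_triangle idx_ge3 uv.1).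
move=> _; suff Eim : i = m.
  by move: g'; rewrite /index_pair imsetU1 imset_setD1 // E Eim.
have : i \in ~: (I :|: J); last by rewrite Em inE => /eqP.
rewrite !inE negb_or; apply/andP; split; last first.
  by apply: contra yJ => iJ; rewrite E imset_f.
by apply/negP => iI; have := ya _ (imset_f u iI); rewrite E uv.1 eqxx.
Qed.

End Coordinates.

Section Connected.
Variables (u v : idx -> 'I_n).
Hypothesis uv : crown_coords u v.
Notation pair := (index_pair u v).
Let u_inj : injective u := crown_injl uv.1.
Let v_inj : injective v := crown_injr uv.1.

Lemma index_pair_movel I J m i : pair I J -> ~: (I :|: J) = [set m] -> i \in I ->
  pair (m |: (I :\ i)) J.
Proof.
move=> /index_pair_sym g Em iI; apply: index_pair_sym.
by apply: (index_pair_mover (crown_coords_sym uv) g) => //; rewrite setUC.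
Qed.

Lemma missingE I J m : (forall i, i \in I -> i \notin J) -> ~: (I :|: J) = [set m] ->
  forall i, (i == m) = (i \notin I) && (i \notin J).
Proof. by move=> _ /setP E i; have := E i; rewrite !inE negb_or => ->. Qed.

(** The missing index [m] serves as a free slot: [m] replaces [j] in J, [j] replaces [i] in I, and
    [i] replaces [m] in J. *)
Lemma index_pair_exchange I J i j : pair I J -> i \in I -> j \in J ->
  pair (j |: (I :\ i)) (i |: (J :\ j)).
Proof.
move=> g iI jJ; have [m Em] := index_pair_missing uv g.
have dis := index_pair_disjoint uv g.
have mE := missingE dis Em.
have mI : m \notin I by have := mE m; rewrite eqxx => /esym/andP[].
have mJ : m \notin J by have := mE m; rewrite eqxx => /esym/andP[].
have jI : j \notin I by apply: contraTN jJ; apply: dis.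
have iJ := dis _ iI.
have g1 := index_pair_mover uv g Em jJ.
have E1 : ~: (I :|: (m |: (J :\ j))) = [set j].
  apply/setP => k; rewrite !inE; have [->|kj] := eqVneq k j.
    by rewrite (negPf jI) /= orbF; apply: contraNneq mJ => <-.
  by have := mE k; case: (k == m); case: (k \in I); case: (k \in J).
have g2 := index_pair_movel g1 E1 iI.
have E2 : ~: ((j |: (I :\ i)) :|: (m |: (J :\ j))) = [set i].
  apply/setP => k; rewrite !inE; have [->|ki] := eqVneq k i.
    rewrite /= orbF negb_or (negPf iJ) andbF orbF; apply/andP; split.
      by apply: contraNneq jI => <-.
    by apply: contraNneq mI => <-.
  have [->|kj] := eqVneq k j; first by [].
  by have := mE k; case: (k == m); case: (k \in I); case: (k \in J).
have g3 := index_pair_mover uv g2 E2 (setU11 m _).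
suff <- : i |: ((m |: (J :\ j)) :\ m) = i |: (J :\ j) by [].
by rewrite setU1K // !inE (negPf mJ) andbF.
Qed.

(** Once a single move aligns the missing indices, I determines J, and exchanging some i of I - I'
    with some j of I' - I decreases #|I - I'|. *)
Lemma index_pair_connected I J I' J' : pair I J ->
  (forall i, i \in I' -> i \notin J') -> #|I'| = #|I| -> #|J'| = #|J| -> pair I' J'.
Proof.
move=> g dis' cI cJ; have cIJ := index_pair_card uv g.
have /eqP/cards1P [m' Em'] : #|~: (I' :|: J')| = 1.
  rewrite cardsCs setCK card_ord cardsU.
  rewrite [I' :&: J'](_ : _ = set0) ?cards0; last first.
    by apply/setP => i; rewrite !inE; apply/negP => /andP[/dis' /negPf ->].
  by rewrite cI cJ cIJ subn0 addKn.
wlog {cIJ} Em : I J g cI cJ / ~: (I :|: J) = [set m'].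
  move=> wl; have [m Em] := index_pair_missing uv g.
  have dis := index_pair_disjoint uv g; have mE := missingE dis Em.
  have [mm|mm] := eqVneq m m'; first by apply: (wl I J); rewrite // -mm.
  have := mE m'; rewrite eq_sym (negPf mm) => /esym/negbT.
  have [mI mJ] : m \notin I /\ m \notin J by have := mE m; rewrite eqxx => /esym/andP.
  rewrite negb_and !negbK => /orP[m'I|m'J].
    have g' := index_pair_movel g Em m'I.
    apply: (wl (m |: (I :\ m')) J) => //.
      by rewrite cardsU1 !inE (negPf mI) andbF cI (cardsD1 m' I) m'I.
    apply/setP => k; rewrite !inE; have := mE k.
    case: (k =P m') => [->|_] /=.
      by rewrite [m' == m]eq_sym (negPf mm) /= => _; exact: dis.
    by case: (k =P m) => //= _; case: (k \in I); case: (k \in J).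
  have g' := index_pair_mover uv g Em m'J.
  apply: (wl I (m |: (J :\ m'))) => //.
    by rewrite cardsU1 !inE (negPf mJ) andbF cJ (cardsD1 m' J) m'J.
  apply/setP => k; rewrite !inE; have := mE k.
  case: (k =P m') => [->|_] /=.
    rewrite [m' == m]eq_sym (negPf mm) /= orbF => _.
    by apply: contraTN m'J; apply: dis.
  by case: (k =P m) => //= _; case: (k \in I); case: (k \in J); rewrite ?orbT.
have JE (X Y : {set idx}) : (forall i, i \in X -> i \notin Y) -> ~: (X :|: Y) = [set m'] -> Y = ~: (m' |: X).
  move=> d E; apply/setP => k; rewrite !inE (missingE d E k); have := d k.
  by case: (k \in X); case: (k \in Y) => // /(_ isT).
elim: {I}#|I :\: I'| {-2}I (leqnn #|I :\: I'|) J g cI cJ Em => [|d IH] I.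
  rewrite leqn0 cards_eq0 setD_eq0 => sII' J g cI cJ Em.
  have EI : I = I' by apply/eqP; rewrite eqEcard sII' cI leqnn.
  have dis i : i \in I -> i \notin J by apply: index_pair_disjoint g.
  by rewrite (JE _ _ dis' Em') -EI -(JE _ _ dis Em).
move=> le J g cI cJ Em; have dis := index_pair_disjoint uv g.
have [/eqP|/set0Pn [i]] := boolP (I :\: I' == set0).
  by move=> E; apply: (IH I _ J) => //; rewrite E cards0.
rewrite inE => /andP[iI' iI].
have : I' :\: I != set0.
  rewrite setD_eq0; apply: contra iI' => s; suff -> : I' = I by [].
  by apply/eqP; rewrite eqEcard s cI leqnn.
case/set0Pn => j; rewrite inE => /andP[jI jI'].
have jJ : j \in J.
  have := missingE dis Em j; rewrite jI /= => E; apply: contraT => jJ.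
  rewrite jJ in E; have /eqP jm := E.
  by have := missingE dis' Em' j; rewrite jm eqxx -jm jI'.
have iJ := dis _ iI.
have g' := index_pair_exchange g iI jJ.
apply: (IH (j |: (I :\ i)) _ (i |: (J :\ j))) => //.
- rewrite -ltnS; apply: leq_trans le; apply: proper_card; apply/properP; split.
    apply/subsetP => k; rewrite !inE => /andP[kI' /orP[/eqP kj|/andP[_ ->]]]; last by rewrite kI'.
    by rewrite kj jI' in kI'.
  exists i; first by rewrite inE iI iI'.
  rewrite !inE eqxx /= orbF negb_and negbK; apply/orP; right.
  by apply: contraNneq jI => <-.
- by rewrite cI (cardsD1 i I) iI cardsU1 !inE (negPf jI) andbF.
- by rewrite cJ (cardsD1 j J) jJ cardsU1 !inE (negPf iJ) andbF.
- rewrite -Em; congr (~: _); apply/setP => k; rewrite !inE.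
  case: (k =P j) => [->|kj] /=; first by rewrite jJ !orbT.
  by case: (k =P i) => [->|ki] /=; rewrite ?iI ?orbT.
Qed.

(** Representative of the piece with 2k + 1 left vertices; its missing index is 2p. *)
Definition crown_face (k : nat) : {set 'I_n} :=
  u @: [set i : idx | i < 2 * k + 1] :|: v @: [set i : idx | (2 * k + 1 <= i) && (i < 2 * p)].

Lemma card_idx_lt k : k <= 2 * p + 1 -> #|[set i : idx | i < k]| = k.
Proof.
move=> kp; rewrite -sum1_card (eq_bigl (fun i : idx => i < k)) => [|i]; last by rewrite inE.
by rewrite -(big_ord_widen _ (fun=> 1) kp) sum1_card card_ord.
Qed.

Lemma nz_index_pair F : nz F -> exists I J, pair I J /\ F = u @: I :|: v @: J.
Proof.
move=> nzF; have [/subsetP FW _ [A [B [EF]]]] := nz_face nzF.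
have indl := crown_indepl no_triangle idx_ge3 uv.1.
have indr := crown_indepr no_triangle idx_ge3 uv.1.
wlog: A B EF / exists2 i, u i \in A & True.
  move=> wl oA oB h; have [a aA] := odd_gt0_ex oA; have [b bB] := odd_gt0_ex oB.
  have aW : a \in W by apply: FW; rewrite EF inE aA.
  have bW : b \in W by apply: FW; rewrite EF inE bB orbT.
  have [i [E|E]] := uv.2 _ aW; first by apply: (wl A B) => //; exists i; rewrite -?E.
  have [j [E'|E']] := uv.2 _ bW.
    apply: (wl B A) => //; [by rewrite setUC | by exists j; rewrite -?E' |].
    exact: complete_between_sym.
  by have := h _ _ aA bB; rewrite E E' indr.
move=> [i iA _] oA oB h; have [b bB] := odd_gt0_ex oB.
have BV b' : b' \in B -> exists j, b' = v j.
  move=> b'B; have /(uv.2) [j [E|E]] : b' \in W by apply: FW; rewrite EF inE b'B orbT.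
    by have := h _ _ iA b'B; rewrite E indl.
  by exists j.
have AU a : a \in A -> exists j, a = u j.
  move=> aA; have /(uv.2) [j [E|E]] : a \in W by apply: FW; rewrite EF inE aA.
    by exists j.
  by have [k Eb] := BV _ bB; have := h _ _ aA bB; rewrite E Eb indr.
have EA : u @: (u @^-1: A) = A.
  apply/setP => a; apply/imsetP/idP => [[j]|aA]; first by rewrite inE => + ->.
  by have [j Ea] := AU _ aA; exists j => //; rewrite inE -Ea.
have EB : v @: (v @^-1: B) = B.
  apply/setP => a; apply/imsetP/idP => [[j]|aB]; first by rewrite inE => + ->.
  by have [j Ea] := BV _ aB; exists j => //; rewrite inE -Ea.
exists (u @^-1: A), (v @^-1: B); rewrite /index_pair EA EB; split => //.
by split => //; rewrite -EF.
Qed.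

Lemma nz_crown_face F : nz F -> exists2 k, k < p & nz (crown_face k).
Proof.
move=> /nz_index_pair [I [J [g _]]]; have cIJ := index_pair_card uv g.
have [_ _ oI oJ] := g; rewrite !card_imset // in oI oJ.
have [k kp [Ik Jk]] : exists2 k, k < p & #|I| = 2 * k + 1 /\ #|J| = 2 * p - (2 * k + 1).
  move: oI oJ cIJ; move: #|I| #|J| => a b; clear => oa ob E.
  by exists a./2; [lia | split; lia].
exists k => //.
have k1 : 2 * k + 1 <= 2 * p + 1 by clear - kp; lia.
have [] // : pair [set i : idx | i < 2 * k + 1] [set i : idx | (2 * k + 1 <= i) && (i < 2 * p)].
apply: (index_pair_connected g).
- by move=> i; rewrite !inE => ik; rewrite leqNgt ik.
- by rewrite card_idx_lt.
- rewrite Jk; apply: (@addnI (2 * k + 1)); rewrite subnKC; last by clear - kp; lia.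
  rewrite -{1}(card_idx_lt k1) -[RHS]card_idx_lt; last by rewrite leq_addr.
  rewrite -cardsUI [_ :&: _](_ : _ = set0) ?cards0 ?addn0.
    congr #|pred_of_set _|; apply/setP => i; rewrite !inE; move: (val i) => a; clear - kp.
    by apply/idP/idP; lia.
  by apply/setP => i; rewrite !inE; move: (val i) => a; clear; apply/negP; lia.
Qed.

End Connected.
End CrownFaces.

(** * The cocycles of a crown *)

Section CrownCocycle.
Variables (n : nat) (K : fieldType) (D : {set {set 'I_n}}).
Hypothesis no_triangle : triangle_free D.
Variables (p : nat) (W : {set 'I_n}).
Hypothesis p_ge2 : (2 <= p)%N.
Notation e := (adj D).
Notation idx := 'I_(2 * p + 1).
Variables (u v : idx -> 'I_n) (ix : 'I_n -> idx).
Hypothesis uv : crown_coords D W u v.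
Hypotheses (uW : forall i, u i \in W) (vW : forall i, v i \in W).
Hypotheses (ixu : cancel u ix) (ixv : cancel v ix).
Implicit Types (F T : {set 'I_n}).

Let eta (i j : idx) : K := (-1) ^+ (i < j)%N.
(** Ratio of the comparison signs in the order of the vertices and in the order of their indices. It
    is symmetric for distinct indices, so [rho] is a product over unordered pairs. *)
Let kappa (w x : 'I_n) : K := (-1) ^+ (w < x)%N * eta (ix w) (ix x).

Let etaC i j : i != j -> eta i j = - eta j i.
Proof. exact: (@sign_ltC (2 * p + 1) K). Qed.

Let kappaC w x : ix w != ix x -> kappa w x = kappa x w.
Proof.
move=> ne; rewrite /kappa (etaC ne) (@sign_ltC _ K w x) ?mulrNN //.
by apply: contraNneq ne => ->.
Qed.

Let rho F : K := \prod_(x in F) \prod_(w in F | (w < x)%N) kappa w x.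

Let rhoU1 x T : x \notin T -> (forall w, w \in T -> ix w != ix x) ->
  rho (x |: T) = rho T * \prod_(w in T) kappa w x.
Proof.
move=> xT ixT; rewrite /rho big_setU1 //=.
have -> : \prod_(w in x |: T | (w < x)%N) kappa w x = \prod_(w in T | (w < x)%N) kappa w x.
  by apply: eq_bigl => w; rewrite !inE; case: eqP => [->|]; rewrite ?ltnn ?andbF.
have -> : \prod_(y in T) \prod_(w in x |: T | (w < y)%N) kappa w y =
    \prod_(y in T) ((if (x < y)%N then kappa x y else 1) * \prod_(w in T | (w < y)%N) kappa w y).
  apply: eq_bigr => y yT; rewrite big_mkcondr big_setU1 //= -big_mkcondr //.
rewrite [X in _ * X = _]big_split /= [RHS]mulrC mulrA; congr (_ * _).
rewrite big_mkcondr -big_split /=; apply: eq_bigr => w wT.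
have wx : w != x by apply: contraNneq xT => <-.
case: (ltngtP w x) => [_|_|/val_inj E]; rewrite ?mulr1 ?mul1r //.
  by rewrite kappaC // eq_sym ixT.
by rewrite E eqxx in wx.
Qed.

(** Injectivity of [ix] on F, expressed by cardinality, says that F contains no two opposite
    vertices. *)
Definition crown_valid k F :=
  [&& F \subset W, #|ix @: F| == #|F|, #|F| == (2 * p)%N & #|F :&: u @: setT| == (2 * k + 1)%N].

(* Up to the factors ksign x (W :\ x), which turn boundaries of complements into
   coboundaries, and rho, which replaces the order of 'I_n by that of the indices,
   the value at F is the sign of the position of the index missed by F. *)
Definition crown_cocycle k F : K :=
  if crown_valid k F then
    (\prod_(x in F) (ksign K x (W :\ x) * \prod_(j in ~: (ix @: F)) eta j (ix x))) * rho F
  else 0.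

Let sign_neq0 (b : nat) : (-1) ^+ b != 0 :> K.
Proof. by rewrite signr_eq0. Qed.

Let prod_neq0 (I : finType) (P : pred I) (G : I -> K) :
  (forall i, P i -> G i != 0) -> \prod_(i | P i) G i != 0.
Proof.
by move=> h; apply: (big_ind (fun z : K => z != 0)) => //;
  [exact: oner_neq0 | exact: mulf_neq0].
Qed.

Lemma crown_cocycle_neq0 k F : (crown_cocycle k F != 0) = crown_valid k F.
Proof.
rewrite /crown_cocycle; case: ifP => _; last by rewrite eqxx.
rewrite mulf_neq0 //; apply: prod_neq0 => x _.
  by rewrite mulf_neq0 //; apply: prod_neq0 => ? _; apply: sign_neq0.
by apply: prod_neq0 => w _; rewrite mulf_neq0 //; apply: sign_neq0.
Qed.

Let sidew w : w \in W -> w = u (ix w) \/ w = v (ix w).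
Proof. by move=> /(uv.2) [i [->|->]]; rewrite ?ixu ?ixv; [left | right]. Qed.

Let u_inj : injective u := crown_injl uv.1.
Let v_inj : injective v := crown_injr uv.1.
Let uv_neq i j : u i != v j.
Proof. exact: (crown_disjoint no_triangle (idx_ge3 p_ge2) uv.1). Qed.

Lemma crown_valid_bipartite k F : (k < p)%N -> crown_valid k F -> odd_bipartite D F.
Proof.
move=> kp /and4P[FW /imset_injP ix_inj /eqP cF /eqP cU].
have EF : F = (F :&: u @: setT) :|: (F :&: v @: setT).
  rewrite -setIUr; apply/esym/setIidPl/subsetP => w /(subsetP FW) /sidew; rewrite inE.
  by case=> ->; rewrite imset_f ?orbT.
have dis : (F :&: u @: setT) :&: (F :&: v @: setT) = set0.
  apply/setP => w; rewrite !inE; apply/negP => /andP[/andP[_ /imsetP[i _ Ei]] /andP[_ /imsetP[j _ Ej]]].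
  by have := uv_neq i j; rewrite -Ei -Ej eqxx.
have cV : (#|F :&: u @: setT| + #|F :&: v @: setT| = 2 * p)%N.
  by rewrite -[RHS]cF [F in RHS]EF cardsU dis cards0 subn0.
exists (F :&: u @: setT), (F :&: v @: setT); split => //.
- by rewrite cU addn1 /= oddM.
- have := congr1 odd cV; rewrite oddD cU !addn1 /= !oddM /=.
  by case: (odd _).
- move=> x y; rewrite !inE => /andP[xF /imsetP[i _ Ei]] /andP[yF /imsetP[j _ Ej]].
  rewrite Ei Ej uv.1; apply/eqP => ij; have := uv_neq i j; rewrite -Ei -Ej.
  by rewrite (ix_inj x y) ?eqxx // Ei Ej ixu ixv.
Qed.

Lemma crown_valid_face k l : (k < p)%N -> crown_valid l (crown_face u v k) = (l == k).
Proof.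
move=> kp; set I := [set i : idx | (i < 2 * k + 1)%N].
set J := [set i : idx | (2 * k + 1 <= i)%N && (i < 2 * p)%N].
have cI : #|I| = (2 * k + 1)%N by apply: card_idx_lt; clear - kp; lia.
have cIJ : #|I :|: J| = (2 * p)%N.
  rewrite -[RHS](@card_idx_lt p (2 * p)) ?leq_addr //; congr #|pred_of_set _|.
  apply/setP => i; rewrite !inE; move: (val i) => a; clear - kp.
  by apply/idP/idP; lia.
have dis : crown_face u v k :&: u @: setT = u @: I.
  apply/setP => w; rewrite !inE; apply/andP/idP => [[/orP[//|/imsetP [j _ ->]] /imsetP[i _ E]]|wI].
    by have := uv_neq i j; rewrite E eqxx.
  by rewrite wI; split=> //; have /imsetP [i _ ->] := wI; rewrite imset_f.
have Eix : ix @: crown_face u v k = I :|: J.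
  rewrite /crown_face imsetU -!imset_comp; congr (_ :|: _); rewrite -[RHS]imset_id;
  by apply: eq_imset => i /=; rewrite ?ixu ?ixv.
have cF : #|crown_face u v k| = (2 * p)%N.
  apply/eqP; rewrite eqn_leq -{2}cIJ -Eix leq_imset_card andbT.
  apply: leq_trans (leq_card_setU _ _) _; rewrite !card_imset // -cardsUI.
  rewrite cIJ [_ :&: _](_ : _ = set0) ?cards0 ?addn0 //.
  by apply/setP => i; rewrite !inE; move: (val i) => a; clear; apply/negP; lia.
rewrite /crown_valid Eix cIJ cF dis card_imset // cI !eqxx /=.
rewrite eqn_add2r eqn_mul2l /= eq_sym; case: eqP => _; rewrite ?andbT ?andbF //.
by apply/subsetP => w; rewrite inE => /orP[] /imsetP [i _ ->].
Qed.


Let const_part T : K := (\prod_(w in T) ksign K w (W :\ w)) * rho T.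

(** Once the vertex-order signs cancel against [rho], what depends on [x] is a product of index
    signs only. *)
Let crown_term k T x m' : x \in W :\: T -> crown_valid k (x |: T) -> T \subset W ->
  (forall w, w \in T -> ix w != ix x) -> ~: (ix @: (x |: T)) = [set m'] ->
  ksign K x (W :\: T :\ x) * crown_cocycle k (x |: T) =
  const_part T * (eta m' (ix x) * \prod_(w in T) (eta m' (ix w) * eta (ix w) (ix x))).
Proof.
move=> /setDP[xW xT] val TW ixT Em; rewrite /crown_cocycle val Em.
under eq_bigr do rewrite big_set1.
rewrite rhoU1 // big_split big_setU1 //= big_setU1 //=.
have -> : ksign K x (W :\ x) = ksign K x T * ksign K x (W :\: T :\ x).
  rewrite /ksign -[RHS]bigU /=; last first.
    rewrite -setI_eq0; apply/eqP/setP => w; rewrite !inE.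
    by case: (w \in T); rewrite ?andbF.
  apply: eq_bigl => w; rewrite !inE; case: (w =P x) => [->|_] /=; first by rewrite (negPf xT).
  by case: (boolP (w \in T)) => //= /(subsetP TW) ->.
have -> : \prod_(w in T) kappa w x = ksign K x T * \prod_(w in T) eta (ix w) (ix x).
  by rewrite -big_split.
rewrite [X in _ = _ * (_ * X)]big_split /= /const_part.
have := ksign_sqr K x T; have := ksign_sqr K x (W :\: T :\ x).
move: (ksign K x _) (ksign K x T) => a b aa bb.
set A := \prod_(w in T) ksign _ _ _; set B := \prod_(w in T) eta m' _.
set C := \prod_(w in T) eta _ _; set E := eta m' _.
transitivity ((a * a) * (b * b) * (A * rho T * (E * (B * C)))); first by ring.
by rewrite aa bb !mul1r.
Qed.

(** Unless all terms vanish, T misses two indices. Keeping 2k + 1 left vertices fixes the side of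
    the added vertex, so two terms survive, one for each missing index. Interchanging the indices
    flips one sign between them and two signs for each [w] in T, so the terms are opposite. *)
Lemma crown_cocycle_cycle k T : T \subset W ->
  \sum_(x in W :\: T) ksign K x (W :\: T :\ x) * crown_cocycle k (x |: T) = 0.
Proof.
move=> TW.
have [x0 /andP[x0WT val0]|none] := pickP (fun x => (x \in W :\: T) && crown_valid k (x |: T));
  last first.
  rewrite big1 // => x xWT; have := none x; rewrite xWT -crown_cocycle_neq0 /=.
  by move/eqP ->; rewrite mulr0.
have /setDP [x0W x0T] := x0WT.
have /and4P[_ inj0 /eqP c0 /eqP cU0] := val0.
have cix : #|ix @: (x0 |: T)| = (2 * p)%N by rewrite (eqP inj0).
move/imset_injP: inj0 => inj0.
have ixT w : w \in T -> ix w != ix x0.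
  move=> wT; apply: contraNneq x0T => /inj0 <- //; rewrite !inE ?eqxx //.
  by rewrite wT orbT.
have [m2 Em2] : exists m2, ~: (ix @: (x0 |: T)) = [set m2].
  by apply/cards1P; rewrite cardsCs setCK card_ord cix addKn.
have mE j : (j \in ix @: T) = (j != ix x0) && (j != m2).
  have := (proj2 (setP _ _) Em2) j; rewrite imsetU1 !inE negb_or => <-.
  rewrite negb_and !negbK; have [->|_] /= := eqVneq j (ix x0); last by [].
  by apply/negP => /imsetP [w wT E]; have := ixT _ wT; rewrite E eqxx.
have m12 : m2 != ix x0.
  by have := (proj2 (setP _ _) Em2) m2; rewrite imsetU1 !inE eqxx negb_or => /andP[].
(* [c] parametrises the side of [x0]; the other surviving term comes from the vertex [x1] of that
   side with the second missing index. *)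
pose U := u @: setT; pose c := if x0 \in U then u else v.
have cU j : (c j \in U) = (x0 \in U).
  rewrite /c; case: ifP => // _; first exact: imset_f.
  by apply/negP => /imsetP [i _ E]; have := uv_neq i j; rewrite E eqxx.
have ixc j : ix (c j) = j by rewrite /c; case: ifP => _; rewrite ?ixu ?ixv.
have cW j : c j \in W by rewrite /c; case: ifP.
have side w : w \in W -> (w \in U) = (x0 \in U) -> w = c (ix w).
  move=> wW wU; rewrite /c -wU; case: (sidew wW) => E.
    have wUt : w \in U by rewrite E imset_f.
    by rewrite wUt.
  case: ifP => [/imsetP [i _ Ei]|//].
  by have := uv_neq i (ix w); rewrite -Ei -E eqxx.
have cardU x : x \notin T -> #|(x |: T) :&: U| = ((x \in U) + #|T :&: U|)%N.
  move=> xT; rewrite setIUl; case: (boolP (x \in U)) => xU.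
    by rewrite (setIidPl _) ?sub1set // cardsU1 inE (negPf xT).
  rewrite [_ :&: U](_ : _ = set0) ?set0U //; apply/setP => w; rewrite !inE.
  by case: eqP => // ->; apply: negbTE.
have x0c : x0 = c (ix x0) by apply: side.
set x1 := c m2; have x1W : x1 \in W by apply: cW.
have ix1 : ix x1 = m2 by apply: ixc.
have x1T : x1 \notin T.
  apply/negP => h; have := imset_f ix h; by rewrite ix1 mE eqxx andbF.
have x10 : x1 != x0 by apply: contraNneq m12 => <-; rewrite ix1.
have cT : (#|T|.+1 = 2 * p)%N by rewrite -c0 cardsU1 x0T.
have cixT : #|ix @: T| = #|T|.
  by apply: card_in_imset => w w' wT w'T; apply: inj0; rewrite !inE ?wT ?w'T orbT.
have E1 : ix @: (x1 |: T) = ~: [set ix x0].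
  apply/setP => j; rewrite imsetU1 in_setU1 ix1 mE !inE.
  by have [->|] := eqVneq j m2; rewrite ?andbT.
have val1 : crown_valid k (x1 |: T).
  rewrite /crown_valid subUset sub1set x1W TW cardsU1 x1T add1n cT eqxx cardU //= cU -cardU // cU0 eqxx.
  by rewrite E1 cardsC1 card_ord addn1 eqxx.
have only x : x \in W :\: T -> x != x0 -> x != x1 -> crown_cocycle k (x |: T) = 0.
  move=> /setDP [xW xT] n0 n1; apply/eqP; apply: contraT; rewrite crown_cocycle_neq0.
  move=> /and4P[_ /imset_injP injx _ /eqP cUx].
  have xU : (x \in U) = (x0 \in U).
    move: cUx; rewrite -cU0 !cardU // => /addIn.
    by case: (x \in U); case: (x0 \in U).
  have xc := side _ xW xU.
  have : ix x \notin ix @: T.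
    apply/negP => /imsetP [w wT E]; move: xT.
    by rewrite (injx x w) ?wT // !inE ?eqxx // wT orbT.
  rewrite mE negb_and !negbK => /orP[] /eqP E.
    by move: n0; rewrite xc E -x0c eqxx.
  by move: n1; rewrite xc E eqxx.
rewrite (bigD1 x0) //= (bigD1 x1) /=; last by rewrite inE x1T x1W x10.
rewrite [X in _ + (_ + X)]big1 ?addr0; last first.
  by move=> x /andP[/andP[xWT n0] n1]; rewrite only ?mulr0.
rewrite (crown_term x0WT val0 TW ixT Em2) (@crown_term k T x1 (ix x0)) //; last first.
- by rewrite E1 setCK.
- move=> w wT; apply: contraTneq (imset_f ix wT) => ->; by rewrite ix1 mE eqxx andbF.
- by rewrite inE x1T.
rewrite ix1 -mulrDr; set P0 := \prod_(w in T) _; set P1 := \prod_(w in T) _.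
have -> : P1 = P0.
  apply: eq_bigr => w wT; have := imset_f ix wT; rewrite mE => /andP[w0 w2].
  by rewrite mulrC (etaC w2) (etaC (_ : ix x0 != ix w)) ?mulrNN // eq_sym.
by rewrite -mulrDl (etaC m12) addNr mul0r mulr0.
Qed.

End CrownCocycle.

(** * Spanning the second linear strand *)

(** Fredholm alternative: if [b] is not in the row space, some column of the cokernel matrix kills
    every [y j] but not [b]. *)
Lemma linear_duality (K : fieldType) (T J : finType) (y : J -> T -> K) (b : T -> K) :
  (exists c : J -> K, forall t, b t = \sum_j c j * y j t) \/
  (exists2 z : T -> K, (forall j, \sum_t z t * y j t = 0) & \sum_t z t * b t != 0).
Proof.
pose Y : 'M[K]_(#|J|, #|T|) := \matrix_(j, t) y (enum_val j) (enum_val t).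
pose B : 'rV[K]_#|T| := \row_t b (enum_val t).
have sumT (F : T -> K) : \sum_t F t = \sum_(i < #|T|) F (enum_val i).
  by rewrite (big_enum_val F).
have [/submxP [C E]|nsub] := boolP (B <= Y)%MS.
  left; exists (fun j => C 0 (enum_rank j)) => t.
  have /rowP/(_ (enum_rank t)) := E; rewrite !mxE enum_rankK => ->.
  rewrite [RHS](big_enum_val (fun j => C 0 (enum_rank j) * y j t)).
  by apply: eq_bigr => i _; rewrite mxE enum_rankK enum_valK.
right; have [k Bk] : exists k, (B *m cokermx Y) 0 k != 0.
  apply/existsP; apply: contraNT nsub; rewrite negb_exists submxE => /forallP h.
  by apply/eqP/rowP => k; rewrite [RHS]mxE; apply/eqP; have := h k; rewrite negbK.
exists (fun t => cokermx Y (enum_rank t) k) => [j|].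
  have /matrixP/(_ (enum_rank j) k) := mulmx_coker Y; rewrite !mxE => E.
  rewrite -[RHS]E sumT; apply: eq_bigr => i _.
  by rewrite enum_valK [Y _ _]mxE enum_rankK mulrC.
move: Bk; rewrite mxE sumT; congr (_ != 0); apply: eq_bigr => i _.
by rewrite [B _ _]mxE enum_valK mulrC.
Qed.

Section Span.
Variables (n : nat) (K : fieldType).
Implicit Types (s t : {set 'I_n}) (g z : {set 'I_n} -> K).

Lemma sdiff_pairing z g :
  \sum_s z s * sdiff g s = \sum_t g t * \sum_(v in t) ksign K v (t :\ v) * z (t :\ v).
Proof.
under eq_bigr do rewrite /sdiff mulr_sumr.
under [RHS]eq_bigr do rewrite mulr_sumr.
rewrite (exchange_big_dep xpredT) //= [RHS](exchange_big_dep xpredT) //=.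
apply: eq_bigr => v _; rewrite (reindex_onto (fun t => t :\ v) (fun s => v |: s)) /=; last first.
  by move=> s vs; rewrite setU1K.
apply: eq_big => [t|t /andP[_ /eqP ->]]; last by ring.
rewrite setD11 /=; apply/eqP/idP => [<-|vt]; [exact: setU11 | exact: setD1K].
Qed.

Definition delta t s : K := (s == t)%:R.

Lemma sum_delta t (f : {set 'I_n} -> K) : \sum_s f s * delta t s = f t.
Proof.
rewrite (bigD1 t) //= /delta eqxx mulr1 big1 ?addr0 // => s /negPf ->.
by rewrite mulr0.
Qed.

Lemma sum_delta' t (f : {set 'I_n} -> K) : \sum_s f s * delta s t = f t.
Proof. by rewrite -[RHS](sum_delta t f); apply: eq_bigr => s _; rewrite /delta eq_sym. Qed.

Lemma sdiff_delta g s : sdiff g s = \sum_t g t * sdiff (delta t) s.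
Proof.
rewrite /sdiff; under [RHS]eq_bigr do rewrite mulr_sumr.
rewrite exchange_big; apply: eq_bigr => v _ /=.
by rewrite -{1}(sum_delta' (v |: s) g) mulr_sumr; apply: eq_bigr => t _; rewrite mulrCA.
Qed.

Variables (D : {set {set 'I_n}}) (p : nat) (W : {set 'I_n}).
Hypothesis no_triangle : triangle_free D.
Hypothesis W_card : #|W| = (4 * p + 2)%N.

(* The sets s whose complement in W is a (2p - 1)-dimensional face of the complex
   with Stanley-Reisner ideal the squarefree power. *)
Definition coface s := [&& s \subset W & #|s| == (2 * p + 2)%N] /\ ~ matchable D p (W :\: s).

(** By duality, failure gives [z] supported on cofaces with complement outside [S0] and orthogonal
    to all boundaries. A relation with one nonzero term has a second one, so the complements of the
    support of [z] are closed under exchange and must meet [S0], a contradiction. *)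
Lemma coface_span (S0 : {set {set 'I_n}}) (h : {set 'I_n} -> K) :
  (forall nz : {set 'I_n} -> Prop,
     (forall F, nz F -> [/\ F \subset W, #|F| = (2 * p)%N & odd_bipartite D F]) ->
     (forall F x, nz F -> x \in F -> exists2 y, y \in W :\: F & nz (y |: (F :\ x))) ->
     forall F, nz F -> exists2 F0, F0 \in S0 & nz F0) ->
  exists g, (forall t, g t != 0 -> t \subset W /\ #|t| = (2 * p + 3)%N) /\
    forall s, coface s -> W :\: s \notin S0 -> h s = sdiff g s.
Proof.
move=> propagate.
pose okt t := (t \subset W) && (#|t| == (2 * p + 3)%N).
pose oks s : bool := if excluded_middle_informative (coface s /\ W :\: s \notin S0) then true else false.
(* Delta functions at the unconstrained [s] are added to the boundaries, so that [h] has to be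
   matched only where [oks] holds. *)
pose y (j : {set 'I_n} + {set 'I_n}) : {set 'I_n} -> K := match j with
  | inl t => if okt t then sdiff (delta t) else fun=> 0
  | inr s => if oks s then fun=> 0 else delta s end.
have [[c hc]|[z hz hzh]] := linear_duality y h.
  exists (fun t => if okt t then c (inl t) else 0); split.
    by move=> t; rewrite /okt; case: ifP => [/andP[-> /eqP ->]|]; rewrite ?eqxx.
  move=> s cs sS; rewrite hc big_sumType /= [X in _ + X]big1 ?addr0; last first.
    move=> s' _; case: ifP => [_|]; first by rewrite mulr0.
    rewrite /oks; case: excluded_middle_informative => // nok _; rewrite /delta.
    by case: eqP => [E|]; rewrite ?mulr0 //; case: nok; rewrite -E.
  rewrite [RHS]sdiff_delta; apply: eq_bigr => t _.
  by case: ifP => _; rewrite ?mulr0 ?mul0r.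
exfalso.
have z_ok s : z s != 0 -> coface s /\ W :\: s \notin S0.
  move=> zs; have := hz (inr s); rewrite /= /oks.
  case: excluded_middle_informative => [ok _ //|nok]; rewrite sum_delta => E.
  by rewrite E eqxx in zs.
have z_cyc t : okt t -> \sum_(v in t) ksign K v (t :\ v) * z (t :\ v) = 0.
  move=> ot; have := hz (inl t); rewrite /= ot sdiff_pairing => E; apply: etrans E; apply: (etrans (esym _)).
    by apply: (sum_delta t (fun t => \sum_(v in t) ksign K v (t :\ v) * z (t :\ v))).
  by apply: eq_bigr => t' _; rewrite mulrC.
pose nz (F : {set 'I_n}) : Prop := F \subset W /\ z (W :\: F) != 0.
have WDD (F : {set 'I_n}) : F \subset W -> W :\: (W :\: F) = F.
  by move=> FW; rewrite setDDr setDv set0U; apply/setIidPr.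
have [s zs] : exists s, z s != 0.
  apply/existsP; apply: contraNT hzh; rewrite negb_exists => /forallP z0.
  rewrite big1 // => s _; have := z0 s; rewrite negbK => /eqP ->.
  by rewrite mul0r.
have [[/andP[sW _] _] _] := z_ok _ zs.
have nzs : nz (W :\: s) by split; rewrite ?subsetDl // WDD.
have [||F0 F0S [F0W zF0]] := propagate nz _ _ _ nzs.
- move=> F [FW /z_ok [[/andP[_ /eqP cF] nm] _]]; rewrite WDD // in nm.
  have F2p : #|F| = (2 * p)%N.
    have := cardsD W F; rewrite cF W_card (setIidPr FW).
    have := subset_leq_card FW; rewrite W_card; clear; lia.
  by split => //; case: (even_matchable no_triangle F2p).
- move=> F x [FW zF] xF.
  have [[/andP[_ /eqP cF] _] _] := z_ok _ zF.
  have xW := subsetP FW _ xF.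
  (* The relation at F - x is the one indexed by its complement x + (W - F), which has 2p + 3
     elements. *)
  have ot : okt (x |: (W :\: F)).
    rewrite /okt subUset sub1set xW subsetDl cardsU1 inE xF /= cF; apply/eqP.
    by clear; lia.
  have := z_cyc _ ot; rewrite (bigD1 x) ?setU11 //= setU1K ?inE ?xF //.
  have [/existsP [w /and3P[wt wx zw]]|none] := boolP [exists w, [&& w \in x |: (W :\: F), w != x & z ((x |: (W :\: F)) :\ w) != 0]]; last first.
    rewrite big1 => [|w /andP[wt wx]].
      move/eqP; rewrite addr0 mulf_eq0 (negPf zF) orbF => /eqP E.
      by have := ksign_sqr K x (W :\: F); rewrite E mul0r => /esym/eqP; rewrite oner_eq0.
    apply/eqP; rewrite mulf_eq0; apply/orP; right; apply: contraNT none => zw.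
    by apply/existsP; exists w; rewrite wt wx.
  move=> _; have wWF : w \in W :\: F by move: wt; rewrite in_setU1 (negPf wx).
  exists w => //; have /setDP [wW wF] := wWF.
  have sub : w |: (F :\ x) \subset W.
    by rewrite subUset sub1set wW (subset_trans (subsetDl _ _) FW).
  split => //; suff <- : (x |: (W :\: F)) :\ w = W :\: (w |: (F :\ x)) by [].
  apply/setP => a; rewrite !inE; case: (a =P w) => //= _.
  by case: (a =P x) => [->|_] /=; rewrite ?xW.
by have [_] := z_ok _ zF0; rewrite WDD // F0S.
Qed.

End Span.

(** * Koszul chains with coefficients in a monomial ideal *)

Section MonomialChains.
Variables (n : nat) (K : fieldType).
Notation S := {mpoly K[n]}.
Notation chain := {ffun {set 'I_n} -> 'rV[S]_(size [:: 0%N])}.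
Implicit Types (s t F W : {set 'I_n}) (m mu : 'X_{1..n}) (c b : chain).

Lemma klinearD (V : lmodType S) (P : V -> Prop) x y : klinear P -> P x -> P y -> P (x + y).
Proof. by move=> [_ PD] Px Py; rewrite -[x]scale1r -mpolyC1; apply: PD. Qed.

Definition cmp m c s : K := comp m (fun t => c t 0 0) s.

Lemma cmpE mu c s : cmp (mu + chi s) c s = (c s 0 0)@_mu.
Proof. exact: compE. Qed.

Lemma mem_msupp_cmp mu c s : (mu \in msupp (c s 0 0)) = (cmp (mu + chi s) c s != 0).
Proof. by rewrite cmpE mcoeff_msupp. Qed.

Lemma cmpD m c b s : cmp m (c + b) s = cmp m c s + cmp m b s.
Proof. by rewrite /cmp /comp; case: ifP; rewrite ?addr0 // ffunE mxE mcoeffD. Qed.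

Lemma cmpZ m a c s : cmp m (a%:MP *: c) s = a * cmp m c s.
Proof. by rewrite /cmp /comp; case: ifP; rewrite ?mulr0 // ffunE mxE mcoeffCM. Qed.

Lemma cmp0 m s : cmp m 0 s = 0.
Proof. by rewrite /cmp /comp ffunE mxE mcoeff0 if_same. Qed.

Lemma cmpB m c b s : cmp m (c - b) s = cmp m c s - cmp m b s.
Proof.
rewrite cmpD -scaleN1r -[-1](rmorphN1 (mpolyC n (R := K))) cmpZ.
by rewrite mulN1r.
Qed.

Lemma cmp_sum (I : Type) (r : seq I) (P : pred I) (f : I -> chain) m s :
  cmp m (\sum_(i <- r | P i) f i) s = \sum_(i <- r | P i) cmp m (f i) s.
Proof. by apply: (big_morph (fun c => cmp m c s)) => [c b|]; [apply: cmpD | apply: cmp0]. Qed.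

Lemma cmp_kdiff m c s : cmp m (kdiff c) s = sdiff (cmp m c) s.
Proof.
rewrite -comp_kdiff /cmp /comp; case: ifP => // _; by rewrite kdiff_entry.
Qed.

Lemma chi_le s t : (chi s <= chi t)%MM = (s \subset t).
Proof.
apply/mnm_lepP/subsetP => [h i si|h i]; first by have := h i; rewrite !chiE si; case: (i \in t).
by rewrite !chiE; case: (boolP (i \in s)) => // /h ->.
Qed.

Lemma chiD s t : s \subset t -> chi t = (chi (t :\: s) + chi s)%MM.
Proof.
move=> st; apply/mnmP => i; rewrite mnmDE !chiE inE.
by case: (boolP (i \in s)) => //= [/(subsetP st) ->|_]; rewrite ?addn0.
Qed.

(** The chain of multidegree [chi W] with scalar coefficients [a]; the monomial on W - s is
    forced. *)
Definition mono W (a : {set 'I_n} -> K) : chain :=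
  [ffun s : {set 'I_n} => const_mx (if s \subset W then a s *: 'X_[chi (W :\: s)] else 0)].

Lemma msupp_mono W a s m : m \in msupp (mono W a s 0 0) ->
  [/\ a s != 0, s \subset W & m = chi (W :\: s)].
Proof.
rewrite ffunE mxE; case: ifP => [sW|_]; last by rewrite msupp0.
have [->|as0] := eqVneq (a s) 0; first by rewrite scale0r msupp0.
by rewrite msuppMCX // inE => /eqP.
Qed.

Lemma cmp_mono W a m s : cmp m (mono W a) s = if (m == chi W) && (s \subset W) then a s else 0.
Proof.
rewrite /cmp /comp ffunE mxE.
have [sW|sW] := boolP (s \subset W); last by rewrite mcoeff0 if_same andbF.
rewrite andbT mcoeffZ mcoeffX; case: ifP => [sm|/negbT sm].
  rewrite -(inj_eq (@addIm _ (chi s))) submK // -chiD // eq_sym.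
  by case: eqP; rewrite ?mulr1 ?mulr0.
by rewrite ifF //; apply: contraNF sm => /eqP ->; rewrite chi_le.
Qed.

Lemma msupp_kdiff c s m : m \in msupp (kdiff c s 0 0) ->
  exists v mu, [/\ v \notin s, mu \in msupp (c (v |: s) 0 0)
    & (m + chi s = mu + chi (v |: s))%MM].
Proof.
rewrite kdiff_entry => /msuppD_sum [v vs]; rewrite ksignC -mulrA mul_mpolyC => /msuppZ_le.
move=> /msuppMP [m1 [m2 [/mem_msuppXP <- h ->]]]; exists v, m2; split => //.
by rewrite chiU1 // addmA [(m2 + _)%MM]addmC.
Qed.

Definition filter_multidegree (P : pred 'X_{1..n}) c : chain :=
  [ffun s : {set 'I_n} => const_mx
    (\sum_(m <- msupp (c s 0 0) | P (m + chi s)%MM) (c s 0 0)@_m *: 'X_[m])].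

Lemma filter_multidegreeE P c s m :
  (filter_multidegree P c s 0 0)@_m = if P (m + chi s)%MM then (c s 0 0)@_m else 0.
Proof. by rewrite ffunE mxE (mcoeff_filter (fun m => P (m + chi s)%MM)). Qed.

Section MonomialModule.
Variable N : {set 'I_n} -> Prop.
Hypothesis N_up : forall s t, s \subset t -> N s -> N t.

Definition monomials_in (v : 'rV[S]_(size [:: 0%N])) : Prop :=
  forall m, m \in msupp (v 0 0) -> N (supp m).

Lemma submod_monomials : submod monomials_in.
Proof.
split=> [m|a x y hx hy m]; first by rewrite mxE msupp0.
rewrite !mxE => /msuppD_le; rewrite mem_cat => /orP[/msuppMP|/hy //].
by case=> m1 [m2 [_ /hx h ->]]; apply: N_up h; apply: suppS; apply: lem_addl.
Qed.

Lemma graded_monomials P v : monomials_in v -> monomials_in (degs_proj P v).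
Proof. by move=> h m /degs_proj_msupp /h. Qed.

Lemma kchainP (Z : 'rV[S]_(size [:: 0%N]) -> Prop) i j c :
  (forall s, Z (c s)) ->
  (forall s m, m \in msupp (c s 0 0) -> #|s| = i /\ (mdeg m + i)%N = j) ->
  kchain Z i j c.
Proof.
move=> Zc h s; split => //.
  move=> l m; rewrite (ord1 l) => hm; have [-> <-] := h s m hm.
  by rewrite /= addn0.
move=> si; apply/rowP => l; rewrite (ord1 l) [RHS]mxE; apply/mpolyP => m.
rewrite mcoeff0; apply/eqP; rewrite mcoeff_eq0; apply/negP => /h [E _].
by rewrite E eqxx in si.
Qed.

Lemma kchain_msupp Z i j c s m : kchain Z i j c -> m \in msupp (c s 0 0) ->
  #|s| = i /\ (mdeg m + i)%N = j.
Proof.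
move=> hc hm; have [_ d0 s0] := hc s.
have si : #|s| = i.
  by apply/eqP; apply: contraLR hm => /s0 ->; rewrite mxE msupp0.
by have := d0 _ _ hm; rewrite /= addn0 si => /eqP.
Qed.

Lemma mono_kchain W a i j :
  (forall s, a s != 0 -> s \subset W -> #|s| = i /\ #|W| = j) ->
  kchain (fun=> True) i j (mono W a).
Proof.
move=> h; apply: kchainP => // s m /msupp_mono [as0 sW ->].
have [si Wj] := h s as0 sW; split=> //.
by rewrite mdeg_chi cardsD (setIidPr sW) si Wj subnK // -si -Wj subset_leq_card.
Qed.

(* A variable of exponent at least 2 may be added to or removed from the exterior
   part without changing the support of the coefficient. *)
Lemma monomial_koszul_exact i j c : kchain monomials_in i j c -> kdiff c = 0 ->
  (forall s m, m \in msupp (c s 0 0) -> exists v, (1 < (m + chi s)%MM v)%N) ->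
  kboundary monomials_in i j c.
Proof.
move=> hc dc h2.
have [|||b db hb] := @koszul_exact n K (fun s => c s 0 0) (fun m v => 1 < m v)%N.
- by move=> s; rewrite -kdiff_entry dc ffunE mxE.
- by move=> s m /h2.
- by move=> m v; case: (m v).
exists [ffun s => const_mx (b s)]; last first.
  apply/ffunP => s; apply/rowP => l; rewrite (ord1 l) -db kdiff_entry /kdiff1.
  by apply: eq_bigr => v _; rewrite ffunE mxE.
apply: kchainP => [s m|s m]; rewrite ffunE mxE => /hb [v [v2 vs h]].
  have [Zc _ _] := hc (s :\ v); suff <- : supp (m + U_(v))%MM = supp m by apply: Zc.
  apply/setP => l; rewrite !inE mnmDE mnm1E.
  have [<-|_] := eqVneq v l; last by rewrite addn0.
  by move: v2; rewrite mnmDE chiE vs; clear; lia.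
have [E <-] := kchain_msupp hc h; split; first by rewrite (cardsD1 v) vs E.
by rewrite mdegD mdeg1 addn1 addnS.
Qed.

(** A multidegree with all exponents at most 1 has degree at most [n], so above [n] some exponent is
    at least 2. *)
Lemma monomial_vanish i j c : (n < j)%N -> kcycle monomials_in i j c ->
  kboundary monomials_in i j c.
Proof.
move=> nj [hc dc]; apply: monomial_koszul_exact => // s m hm.
have [si E] := kchain_msupp hc hm; apply/existsP; apply: contraLR nj.
rewrite negb_exists => /forallP h; rewrite -leqNgt -E -si -mdeg_chi -mdegD mdegE.
apply: leq_trans (_ : \sum_(v < n) 1 <= _)%N; last by rewrite sum1_card card_ord.
by apply: leq_sum => v _; have := h v; rewrite -leqNgt.
Qed.

End MonomialModule.
End MonomialChains.

(** * A basis of the homology indexed by crowns and sizes *)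

Section CrownHomology.
Variables (n : nat) (K : fieldType) (D : {set {set 'I_n}}) (p : nat).
Notation S := {mpoly K[n]}.
Notation chain := {ffun {set 'I_n} -> 'rV[S]_(size [:: 0%N])}.
Hypothesis no_triangle : triangle_free D.
Hypothesis p_ge2 : (2 <= p)%N.
Hypothesis no_even_bipartite : forall A B, complete_between D A B ->
  ~~ odd #|A| -> ~~ odd #|B| -> (2 <= #|A|)%N -> (2 <= #|B|)%N ->
  (#|A| + #|B| = 2 * p + 2)%N -> False.
Notation idx := 'I_(2 * p + 1).
Notation module := (@monomials_in n K (matchable D p)).
Notation crowns := {W : {set 'I_n} | induced_iso (@crown (2 * p + 1)) D W}.
Notation i0 := (2 * p + 1)%N.
Notation j0 := (4 * p + 2)%N.

Let subM : submod module.
Proof. exact: (submod_monomials K (@matchable_sub n D p)). Qed.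

Definition crown_chart (W : {set 'I_n}) (c : (idx -> 'I_n) * (idx -> 'I_n) * ('I_n -> idx)) :=
  [/\ crown_coords D W c.1.1 c.1.2, forall i, c.1.1 i \in W /\ c.1.2 i \in W,
      cancel c.1.1 c.2 & cancel c.1.2 c.2].

Lemma crown_chart_exists W : induced_iso (@crown i0) D W -> exists c, crown_chart W c.
Proof.
case/existsP => f /and3P[/injectiveP f_inj /eqP fW /forallP fadj].
have lt0 : (0 < i0)%N by rewrite addn1.
pose ix w : idx := odflt (Ordinal lt0) [pick i | (w == f (inl i)) || (w == f (inr i))].
exists (fun i => f (inl i), fun i => f (inr i), ix); split => /=.
- split=> [i j|w]; first by have /forallP/(_ (inr j))/eqP := fadj (inl i).
  by rewrite -fW => /imsetP [[i|i] _ ->]; exists i; [left | right].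
- by move=> i; rewrite -fW !imset_f.
- move=> i; rewrite /ix; case: pickP => [k /orP[]/eqP /f_inj //|/(_ i)].
    by case=> ->.
  by rewrite eqxx.
- move=> i; rewrite /ix; case: pickP => [k /orP[]/eqP /f_inj //|/(_ i)].
    by case=> ->.
  by rewrite eqxx orbT.
Qed.

Lemma crown_card W : induced_iso (@crown i0) D W -> #|W| = j0.
Proof.
case/existsP => f /and3P[/injectiveP f_inj /eqP <- _].
rewrite card_imset // card_sum card_ord; clear; lia.
Qed.

Let kdiffB (b b' : chain) : kdiff (b - b') = kdiff b - kdiff b'.
Proof. exact: linearB. Qed.

Let kdiffD (b b' : chain) : kdiff (b + b') = kdiff b + kdiff b'.
Proof. exact: linearD. Qed.

Section Charts.
Variable ch : crowns -> (idx -> 'I_n) * (idx -> 'I_n) * ('I_n -> idx).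
Hypothesis chP : forall x, crown_chart (val x) (ch x).

Let face (x : crowns) (k : nat) := crown_face (ch x).1.1 (ch x).1.2 k.
Let cocycle (x : crowns) k F := crown_cocycle K (val x) (ch x).1.1 (ch x).2 k F.
Let valid (x : crowns) k F := crown_valid (val x) (ch x).1.1 (ch x).2 k F.

Let cocycle_neq0 x k F : (cocycle x k F != 0) = valid x k F.
Proof. exact: crown_cocycle_neq0. Qed.

Let valid_face x (k : 'I_p) l : valid x l (face x k) = (l == k).
Proof.
have [h1 h2 h3 h4] := chP x; apply: (crown_valid_face no_triangle p_ge2 h1) => // i.
  by case: (h2 i).
by case: (h2 i).
Qed.

Let valid_odd x (k : 'I_p) F : valid x k F -> odd_bipartite D F.
Proof.
have [h1 h2 h3 h4] := chP x.
exact: (crown_valid_bipartite no_triangle p_ge2 h1 h3 h4).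
Qed.

Let face_sub x (k : 'I_p) : face x k \subset val x.
Proof. by have /and4P[] : valid x k (face x k) by rewrite valid_face. Qed.

Let face_card x (k : 'I_p) : #|face x k| = (2 * p)%N.
Proof. by have /and4P[_ _ /eqP] : valid x k (face x k) by rewrite valid_face. Qed.

Let face_inj x (k l : 'I_p) : face x k = face x l -> k = l.
Proof.
by move=> E; apply/val_inj/eqP; rewrite -(valid_face x l k) -E valid_face.
Qed.

(** Lift of a basis class to the free Koszul complex: its boundary lies in the module although its
    own coefficient, the monomial of an unmatchable face, does not. *)
Let gen (t : crowns * 'I_p) : chain := mono (val t.1) (@delta n K (val t.1 :\: face t.1 t.2)).

Let gen_chain t : kchain (fun=> True) i0.+1 j0 (gen t).
Proof.
apply: mono_kchain => s; rewrite /delta.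
have [-> _ _|_] := eqVneq s (val t.1 :\: face t.1 t.2); last by rewrite eqxx.
have cW := crown_card (valP t.1).
rewrite cardsD (setIidPr (face_sub _ _)) face_card cW; split => //.
by clear; lia.
Qed.

Let gen_cycle t : kcycle module i0 j0 (kdiff (gen t)).
Proof.
split; last exact: kdiff_kdiff.
have hc := kchain_kdiff (submod_anything _) (gen_chain t).
apply: kchainP => [s m hm|s m]; last exact: kchain_msupp hc.
have [si mE] := kchain_msupp hc hm.
have [v [mu [vs /msupp_mono [_ sW ->] E]]] := msupp_kdiff hm.
rewrite -chiD // in E.
have sW' : s \subset val t.1 by apply: subset_trans sW; apply: subsetUr.
have -> : m = chi (val t.1 :\: s) by apply: (@addIm _ (chi s)); rewrite E -chiD.
(* Every coefficient of the boundary sits on 2p + 1 vertices. *)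
rewrite supp_chi; apply: (odd_matchable no_triangle).
rewrite cardsD (setIidPr sW') si (crown_card (valP t.1)).
by clear; lia.
Qed.

(** The functional defined by the cocycle: it vanishes on boundaries and on chains of the module,
    and is diagonal with nonzero entries on the [gen t]. *)
Let pairing (x : crowns) k (c : chain) : K :=
  \sum_(s : {set 'I_n}) (if s \subset val x then cocycle x k (val x :\: s) else 0) * cmp (chi (val x)) c s.

Let cmp_sub (m : 'X_{1..n}) (c : chain) s : cmp m c s != 0 -> (chi s <= m)%MM.
Proof. by rewrite /cmp /comp; case: ifP => //; rewrite eqxx. Qed.

Let pairing_kdiff x (k : 'I_p) c : pairing x k (kdiff c) = 0.
Proof.
rewrite /pairing; under eq_bigr do rewrite cmp_kdiff.
rewrite sdiff_pairing big1 // => t _.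
have [->|ct] := eqVneq (cmp (chi (val x)) c t) 0; first by rewrite mul0r.
have tW : t \subset val x by have := cmp_sub ct; rewrite chi_le.
have [h1 h2 h3 h4] := chP x.
have TW : val x :\: t \subset val x by apply: subsetDl.
have := crown_cocycle_cycle K no_triangle p_ge2 h1 (fun i => (h2 i).1) (fun i => (h2 i).2) h3 h4 k TW.
rewrite setDDr setDv set0U (setIidPr tW) => E.
rewrite [X in _ * X](_ : _ = 0) ?mulr0 // -[RHS]E; apply: eq_bigr => v vt; congr (_ * _).
rewrite (subset_trans (subsetDl _ _) tW); congr crown_cocycle.
apply/setP => w; rewrite !inE; case: (w =P v) => //= ->.
by rewrite (subsetP tW).
Qed.

Let pairing_module x (k : 'I_p) (c : chain) : (forall s, module (c s)) -> pairing x k c = 0.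
Proof.
move=> hc; rewrite /pairing big1 // => s _.
have [->|cs] := eqVneq (cmp (chi (val x)) c s) 0; first by rewrite mulr0.
have sW : s \subset val x by have := cmp_sub cs; rewrite chi_le.
rewrite sW; have [->|zs] := eqVneq (cocycle x k (val x :\: s)) 0; first by rewrite mul0r.
have v := zs; rewrite cocycle_neq0 in v.
have /and4P[_ _ /eqP cF _] := v.
case: (odd_bipartite_unmatchable cF (valid_odd v)).
rewrite -[_ :\: s]supp_chi; apply: (hc s).
by rewrite mem_msupp_cmp -chiD.
Qed.

Let pairing_gen x (k : 'I_p) t :
  pairing x k (gen t) = if t == (x, k) then cocycle x k (face x k) else 0.
Proof.
rewrite /pairing; under eq_bigr do rewrite cmp_mono (inj_eq (@chi_inj n)).
case: t => y l; rewrite xpair_eqE /=; have [<-|nxy] := eqVneq y x; last first.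
  rewrite big1 // => s _; rewrite (_ : (_ == _) = false) ?mulr0 //=.
  by apply/negP => /eqP /val_inj E; rewrite E eqxx in nxy.
rewrite eqxx /= (bigD1 (val y :\: face y l)) //= big1 ?addr0; last first.
  by move=> s /negPf ns; rewrite /delta ns if_same mulr0.
rewrite subsetDl /delta eqxx mulr1 setDDr setDv set0U (setIidPr (face_sub _ _)).
case: eqP => [-> //|/eqP lk]; apply/eqP; apply: contraNT lk; rewrite cocycle_neq0 valid_face.
by rewrite eq_sym.
Qed.

(** If a combination of basis cycles bounds [b] in the module, the same combination of lifts minus
    [b] is a cycle of the free complex, hence a boundary; pairing with each cocycle isolates one
    coefficient. *)
Lemma crown_independent (a : crowns * 'I_p -> K) :
  kboundary module i0 j0 (\sum_t (a t)%:MP *: kdiff (gen t)) -> forall t, a t = 0.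
Proof.
case=> b hb; under eq_bigr do rewrite -linearZ.
rewrite -linear_sum /= => E [x k].
pose d := \sum_t (a t)%:MP *: gen t - b.
have linT := kchain_linear (s := [:: 0%N]) (@submod_anything n K 'rV[S]_(size [:: 0%N])) i0.+1 j0.
have hd : kchain (fun=> True) i0.+1 j0 d.
  apply: (klinearB linT); first by apply: (klinear_sum _ _ linT) => t; apply: gen_chain.
  by apply: kchain_sub hb.
have [||g hg Eg] := free_koszul_exact hd.
- by rewrite kdiffB E subrr.
- by move=> l; have [_ _ ->] := hd set0; rewrite ?mxE ?mcoeff0 // cards0.
have := pairing_kdiff x k g; rewrite -Eg.
have pB c c' : pairing x k (c - c') = pairing x k c - pairing x k c'.
  rewrite /pairing -sumrB; apply: eq_bigr => s _; by rewrite cmpB mulrBr.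
rewrite pB (pairing_module x k (c := b)) ?subr0; last by move=> s; have [] := hb s.
have -> : pairing x k (\sum_t (a t)%:MP *: gen t) = \sum_t a t * pairing x k (gen t).
  rewrite /pairing; under eq_bigr do rewrite cmp_sum mulr_sumr.
  rewrite exchange_big; apply: eq_bigr => t _ /=; rewrite mulr_sumr.
  by apply: eq_bigr => s _; rewrite cmpZ mulrCA.
rewrite (bigD1 (x, k)) //= pairing_gen eqxx big1 => [|t /negPf tx]; last first.
  by rewrite pairing_gen tx mulr0.
rewrite addr0 => /eqP; rewrite mulf_eq0 => /orP[/eqP //|].
by rewrite -[_ == 0]negbK cocycle_neq0 valid_face eqxx.
Qed.

(** A chain bounding [c] in the free complex is corrected by lifts of basis classes and by a
    boundary until its squarefree part lies in the module; exactness in multidegrees with an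
    exponent at least 2 absorbs the rest. *)
Lemma crown_span c : kcycle module i0 j0 c ->
  exists a : crowns * 'I_p -> K, kboundary module i0 j0 (c - \sum_t (a t)%:MP *: kdiff (gen t)).
Proof.
move=> [hc dc].
have linT := kchain_linear (s := [:: 0%N]) (@submod_anything n K 'rV[S]_(size [:: 0%N])) i0.+1 j0.
have linT' := kchain_linear (s := [:: 0%N]) (@submod_anything n K 'rV[S]_(size [:: 0%N])) i0.+2 j0.
have [|//||b hb Eb] := free_koszul_exact (i := i0) (j := j0) (c := c).
- by apply: kchain_sub hc.
- by move=> l; have [_ _ ->] := hc set0; rewrite ?mxE ?mcoeff0 // cards0 addn1.
(* The representatives in W, one for each k; the empty set if W does not induce a crown. *)
pose S0 (W : {set 'I_n}) : {set {set 'I_n}} :=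
  [set F | [exists x : crowns, (val x == W) && [exists k : 'I_p, F == face x k]]].
have propagate (W : {set 'I_n}) (nz : {set 'I_n} -> Prop) : #|W| = j0 ->
   (forall F, nz F -> [/\ F \subset W, #|F| = (2 * p)%N & odd_bipartite D F]) ->
   (forall F x, nz F -> x \in F -> exists2 y, y \in W :\: F & nz (y |: (F :\ x))) ->
   forall F, nz F -> exists2 F0, F0 \in S0 W & nz F0.
  move=> cW hf hs F nzF.
  have cr := nz_crown no_triangle p_ge2 cW hf hs no_even_bipartite nzF.
  pose x : crowns := exist _ W cr.
  have [h1 h2 h3 h4] := chP x.
  have [k kp nzk] := nz_crown_face no_triangle p_ge2 hf hs h1 nzF.
  exists (face x k) => //; rewrite inE; apply/existsP; exists x; rewrite eqxx.
  by apply/existsP; exists (Ordinal kp).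
have [g hg] : exists g : {set 'I_n} -> {set 'I_n} -> K, forall W : {set 'I_n},
    (forall t, g W t != 0 -> [/\ t \subset W, #|t| = (2 * p + 3)%N & #|W| = j0]) /\
    (#|W| = j0 -> forall s, coface D p W s -> W :\: s \notin S0 W ->
       cmp (chi W) b s = sdiff (g W) s).
  apply: (@fin_all_exists _ (fun=> {set 'I_n} -> K) (fun (W : {set 'I_n}) g =>
    (forall t, g t != 0 -> [/\ t \subset W, #|t| = (2 * p + 3)%N & #|W| = j0]) /\
    (#|W| = j0 -> forall s, coface D p W s -> W :\: s \notin S0 W ->
       cmp (chi W) b s = sdiff g s))) => W.
  have [cW|cW] := eqVneq #|W| j0; last first.
    by exists (fun=> 0); split=> [t|E]; [rewrite eqxx | rewrite E eqxx in cW].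
  have [g [h1 h2]] := coface_span no_triangle cW (cmp (chi W) b) (propagate W ^~ cW).
  by exists g; split=> // t /h1 [].
(* [g] is not controlled at the representatives; [a] is the coefficient that remains there. *)
pose a (t : crowns * 'I_p) : K :=
  let s := val t.1 :\: face t.1 t.2 in cmp (chi (val t.1)) b s - sdiff (g (val t.1)) s.
pose G : chain := \sum_W mono W (g W).
have hG : kchain (fun=> True) i0.+2 j0 G.
  apply: (big_ind (kchain (fun=> True) i0.+2 j0)); first exact: linT'.1.
    by move=> x y; apply: (klinearD linT').
  move=> W _; apply: mono_kchain => s gs _; have [_ -> ->] := (hg W).1 _ gs.
  by split=> //; clear; lia.
have cmpG W s : cmp (chi W) G s = g W s.
  rewrite cmp_sum (bigD1 W) //= big1 ?addr0 => [|W' nW].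
    rewrite cmp_mono eqxx /=; case: ifP => // sW; apply/esym/eqP.
    by apply: contraFT sW => /(hg W).1 [].
  by rewrite cmp_mono (inj_eq (@chi_inj n)) eq_sym (negPf nW).
exists a; pose X := \sum_t (a t)%:MP *: gen t.
pose b' := b - X - kdiff G.
have hb' : kchain (fun=> True) i0.+1 j0 b'.
  apply: (klinearB linT); last exact: kchain_kdiff.
  by apply: (klinearB linT) => //; apply: (klinear_sum _ _ linT) => t; apply: gen_chain.
have cmpX W s : cmp (chi W) X s =
    \sum_(t | val t.1 == W) a t * (s == W :\: face t.1 t.2)%:R.
  rewrite cmp_sum [RHS]big_mkcond; apply: eq_bigr => t _.
  rewrite cmpZ cmp_mono (inj_eq (@chi_inj n)) eq_sym; case: eqP => [->|] /=; last by rewrite mulr0.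
  rewrite /delta; case: eqP => [->|]; rewrite ?if_same ?mulr0 //.
  by rewrite subsetDl.
have WDD (W F : {set 'I_n}) : F \subset W -> W :\: (W :\: F) = F.
  by move=> FW; rewrite setDDr setDv set0U; apply/setIidPr.
have b'0 (W s : {set 'I_n}) : #|W| = j0 -> coface D p W s -> cmp (chi W) b' s = 0.
  move=> cW cs; rewrite /b' !cmpB cmp_kdiff.
  have -> : sdiff (cmp (chi W) G) s = sdiff (g W) s.
    by apply: eq_bigr => v _; rewrite cmpG.
  have sW : s \subset W by case: cs => /andP[].
  have [|nS] := boolP (W :\: s \in S0 W); last first.
    rewrite cmpX big1 ?subr0; last first.
      move=> t /eqP tW; case: eqP => [Es|]; rewrite ?mulr0 //; case/negP: nS.
      rewrite inE; apply/existsP; exists t.1; rewrite tW eqxx; apply/existsP; exists t.2.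
      by rewrite Es WDD // -tW face_sub.
    by rewrite ((hg W).2 cW s cs nS) subrr.
  rewrite inE => /existsP [x /andP[/eqP xW /existsP [k /eqP Ek]]].
  have Es : s = W :\: face x k by rewrite -Ek WDD.
  rewrite cmpX (bigD1 (x, k)) /= ?xW // -Es eqxx mulr1 big1 ?addr0.
    by rewrite /a /= xW -Es subKr subrr.
  move=> t /andP[/eqP tW ne]; case: eqP => [E|]; rewrite ?mulr0 //.
  have tx : t.1 = x by apply: val_inj; exact: (etrans tW (esym xW)).
  case/negP: ne; apply/eqP; case: t tx tW E => y l /= -> _ E; congr (_, _).
  have fW (q : 'I_p) : face x q \subset W by rewrite -[W]xW; apply: face_sub.
  by apply: (@face_inj x); rewrite -(WDD _ _ (fW l)) -E Ek.
pose sqf (m : 'X_{1..n}) := [forall v, m v <= 1]%N.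
(* The squarefree part of [b'] lies in the module, since its coefficients on cofaces vanish. *)
have [b1 b1E] : exists b1 : chain, forall s m,
    (b1 s 0 0)@_m = if sqf (m + chi s)%MM then (b' s 0 0)@_m else 0.
  by exists (filter_multidegree sqf b') => s m; apply: filter_multidegreeE.
have b1_supp s m : m \in msupp (b1 s 0 0) -> sqf (m + chi s)%MM /\ m \in msupp (b' s 0 0).
  by rewrite !mcoeff_msupp b1E; case: ifP => //; rewrite eqxx.
have hb1 : kchain module i0.+1 j0 b1.
  apply: kchainP => [s m /b1_supp [/forallP sq hm]|s m /b1_supp [_]]; last exact: kchain_msupp hb'.
  apply: Classical_Prop.NNPP => nm; have [cs mE] := kchain_msupp hb' hm.
  set W := supp (m + chi s)%MM.
  have EW : (m + chi s)%MM = chi W by apply: squarefree_chi => v; apply: sq.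
  have cW : #|W| = j0 by rewrite -mdeg_chi -EW mdegD mdeg_chi cs.
  have sW : s \subset W by rewrite -chi_le -EW lem_addl.
  have Em : m = chi (W :\: s) by apply: (@addIm _ (chi s)); rewrite EW -chiD.
  have cof : coface D p W s.
    split; last by rewrite Em supp_chi in nm.
    by rewrite sW cs; apply/eqP; clear; lia.
  by move: hm; rewrite mem_msupp_cmp EW b'0 // eqxx.
have Ec : c - \sum_t (a t)%:MP *: kdiff (gen t) = kdiff b'.
  have EX : kdiff X = \sum_t (a t)%:MP *: kdiff (gen t).
    by rewrite linear_sum; apply: eq_bigr => t _; rewrite linearZ.
  have -> : kdiff b' = kdiff b - kdiff X - kdiff (kdiff G) by rewrite /b' !kdiffB.
  by rewrite kdiff_kdiff subr0 -Eb EX.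
clearbody b'.
have cyc : kchain module i0 j0 (kdiff b').
  rewrite -Ec; apply: (klinearB (kchain_linear subM _ _)) => //.
  by apply: (klinear_sum _ _ (kchain_linear subM _ _)) => t; case: (gen_cycle t).
(* In squarefree multidegrees [b' - b1] is zero, so its boundary also bounds inside the module. *)
have [|||b2 hb2 Eb2] := @monomial_koszul_exact n K (matchable D p) i0 j0 (kdiff (b' - b1)).
- rewrite kdiffB; apply: (klinearB (kchain_linear subM _ _)); first exact: cyc.
  exact: kchain_kdiff hb1.
- exact: kdiff_kdiff.
- move=> s m /msupp_kdiff [v [mu [_ h ->]]]; apply/existsP; apply: contraLR h.
  rewrite negb_exists => /forallP h; rewrite -mcoeff_eq0 ffunE [(- b1) _]ffunE mxE [(- _ : 'M_(_,_)) _ _]mxE.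
  rewrite mcoeffB b1E ifT ?subrr //.
  by apply/forallP => w; have := h w; rewrite -leqNgt.
exists (b1 + b2); first exact: (klinearD (kchain_linear subM _ _) hb1 hb2).
by rewrite Ec kdiffD -Eb2 kdiffB [RHS]addrC subrK.
Qed.

Lemma crown_qdim : qdim (crowns * 'I_p)%type (kcycle module i0 j0) (kboundary module i0 j0).
Proof.
exists (fun t => kdiff (gen t)); split; [exact: gen_cycle | exact: crown_span | exact: crown_independent].
Qed.

End Charts.

Lemma koszul_homology_crowns :
  qdim (crowns * 'I_p)%type (kcycle module i0 j0) (kboundary module i0 j0).
Proof.
have [ch chP] : exists ch : crowns -> (idx -> 'I_n) * (idx -> 'I_n) * ('I_n -> idx),
    forall x, crown_chart (val x) (ch x).
  apply: (@fin_all_exists _ (fun=> ((idx -> 'I_n) * (idx -> 'I_n) * ('I_n -> idx))%type)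
    (fun (x : crowns) c => crown_chart (val x) c)) => x.
  exact: crown_chart_exists (valP x).
exact: crown_qdim chP.
Qed.

End CrownHomology.

(** * Identification of the Betti number *)

Lemma complete_bipartite_induced (n : nat) (D : {set {set 'I_n}}) (A B : {set 'I_n}) (a b : nat) :
  triangle_free D -> complete_between D A B -> (0 < a)%N -> (0 < b)%N ->
  #|A| = a -> #|B| = b -> induced_iso (@complete_bipartite a b) D (A :|: B).
Proof.
move=> tf h a0 b0 Aa Bb; subst a b.
have [y yB] := card_gt0P b0; have [x xA] := card_gt0P a0.
have iA := complete_between_independent tf h yB.
have iB := complete_between_independent tf (complete_between_sym h) xA.
pose f : {ffun 'I_#|A| + 'I_#|B| -> 'I_n} :=
  [ffun z => match z with inl i => enum_val i | inr j => enum_val j end].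
have AB i j : enum_val (A := A) i <> enum_val (A := B) j.
  move=> E; have := complete_between_disjoint h (enum_valP i).
  by rewrite E (enum_valP j).
apply/existsP; exists f; apply/and3P; split.
- apply/injectiveP => -[i|i] [j|j]; rewrite !ffunE.
  + by move/enum_val_inj ->.
  + by move/AB.
  + by move/esym/AB.
  + by move/enum_val_inj ->.
- apply/eqP/setP => z; rewrite inE; apply/imsetP/orP.
    by case=> -[i|i] _ ->; rewrite ffunE; [left | right]; apply: enum_valP.
  case=> [zA|zB].
    by exists (inl (enum_rank_in zA z)); rewrite // ffunE enum_rankK_in.
  by exists (inr (enum_rank_in zB z)); rewrite // ffunE enum_rankK_in.
- apply/forallP => -[i|i]; apply/forallP => -[j|j]; rewrite !ffunE /=.
  + by rewrite (negPf (iA _ _ (enum_valP i) (enum_valP j))).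
  + by rewrite h ?enum_valP.
  + by rewrite adj_sym h ?enum_valP.
  + by rewrite (negPf (iB _ _ (enum_valP i) (enum_valP j))).
Qed.

Lemma card_count_mem (s : seq nat) j :
  #|{: {a : 'I_(size s) | nth 0%N s a == j}}| = count_mem j s.
Proof.
rewrite card_sig -sum1_count (big_nth 0%N) big_mkord -sum1_card.
by apply: eq_bigl => i; rewrite inE.
Qed.

Local Open Scope nat_scope.

Theorem corollary4p5 (K : fieldType) (n : nat) (D : {set {set 'I_n}}) (p : nat)
  (D_complex : simplicial_complex D)
  (D_dim : complex_dim D = 1%R)
  (D_flag : flag K D)
  (p_ge2 : 2 <= p)
  (p_le_nu : p <= matching_number (compl_edges D))
  (no_bipartite : forall i : nat, ~~ odd i -> i <= p ->
     forall W : {set 'I_n},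
       ~~ induced_iso (@complete_bipartite (2 + i) (2 * p - i)) D W)
  (has_crown : exists W : {set 'I_n},
     induced_iso (@crown (2 * p + 1)) D W) :
  graded_betti (squarefree_power (stanley_reisner K D) p)
    (2 * p + 1) (4 * p + 2)
  = p * #|[set W : {set 'I_n} | induced_iso (@crown (2 * p + 1)) D W]|.
Proof.
have tf := flag_triangle_free D_complex D_dim D_flag.
have no_even (A B : {set 'I_n}) : complete_between D A B -> ~~ odd #|A| -> ~~ odd #|B| ->
    2 <= #|A| -> 2 <= #|B| -> #|A| + #|B| = 2 * p + 2 -> False.
  wlog le : A B / #|A| <= #|B|.
    move=> wl h eA eB A2 B2 E; have [le|lt] := leqP #|A| #|B|; first exact: (wl A B).
    by apply: (wl B A) => //; [apply: ltnW | apply: complete_between_sym | rewrite addnC].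
  move=> h eA eB A2 B2 E.
  (* With i = #|A| - 2 the excluded graph has parts 2 + i = #|A| and 2p - i = #|B|; the bound i <= p
     comes from #|A| <= #|B|. *)
  have [||] := negP (@no_bipartite (#|A| - 2) _ _ (A :|: B)).
  - by rewrite oddB // addbF.
  - by move: le E; move: #|A| #|B| => a b; clear; lia.
  apply: complete_bipartite_induced => //.
  - by move: le E A2; move: #|A| #|B| => a b; clear - p_ge2; lia.
  - by rewrite subnKC.
  - by move: le E A2; move: #|A| #|B| => a b; clear; lia.
pose I := squarefree_power (stanley_reisner K D) p.
have IP (v : 'rV[{mpoly K[n]}]_(size [:: 0])) :
    I (v 0%R 0%R) <-> monomials_in (matchable D p) v.
  exact: (squarefree_powerP D_complex D_dim tf).
have subI := submod_monomials K (@matchable_sub n D p).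
have [F0 hF0] : exists F, minimal_graded_free_resolution F I.
  apply: (@minimal_resolution_exists n K I n).
  - split; first by apply/IP; apply: subI.1.
    by move=> a x y /IP hx /IP hy; apply/IP; apply: subI.2.
  - by move=> P v /IP h; apply/IP; apply: graded_monomials.
  - move=> i j c nj /(kcycle_ext IP) h; apply/(kboundary_ext IP).
    exact: monomial_vanish nj h.
rewrite /graded_betti.
(* Existence makes the epsilon satisfy its specification; [F] is whichever resolution it
   selected. *)
have [|F hF ->] := epsilon_spec (inhabits 0) (fun b => exists2 F,
    minimal_graded_free_resolution F I & b = count_mem (4 * p + 2) (shifts F (2 * p + 1))).
  by exists (count_mem (4 * p + 2) (shifts F0 (2 * p + 1))), F0.
have q1 := qdim_ext (kcycle_ext IP _ _) (kboundary_ext IP _ _)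
  (qdim_resolution (2 * p + 1) (4 * p + 2) hF).
have q2 := koszul_homology_crowns K tf p_ge2 no_even.
(* Two bases of one homology space: the shifts of [F] equal to 4p + 2, and the pairs of a crown and
   some k < p. *)
rewrite -card_count_mem (qdim_unique (kboundary_linear subI _ _) q1 q2).
rewrite card_prod card_ord mulnC card_sig; congr (_ * _).
by apply: eq_card => W; rewrite !inE.
Qed.
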